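(* Let $n\ge2$. For all non-negative integers $a_1,\dots,a_n$ with $a_1+\dots+a_n=n$, the characteristic numbers of the algebra $CW_n$ are given by \[ c_{a_1,\dots,a_n}=\begin{cases}2^{a_2+\dots+a_{n-1}-1}&\text{if }a_1=a_n=0,\\ 2^{a_2+\dots+a_{n-1}}&\text{if }a_1=0,\ a_n>0\text{ or }a_1>0,\ a_n=0,\\ 2^{a_2+\dots+a_{n-1}+1}&\text{if }a_1,a_n>0.\end{cases} \]
   Context: Algebras are associative, commutative, unital and finite-dimensional over $\mathbb{C}$. For $n\ge2$, $CW_n=\mathbb{C}[x_0,\dots,x_{n-2}]/\big((x_ix_j\colon i\ne j)+(x_i^2-x_j^2\colon i\neq j)+(x_0^3)\big)$, the quotient by the apolar ideal of the form $\alpha_0^2+\dots+\alpha_{n-2}^2$; it has dimension $n+1$. Characteristic numbers of subspaces. Let $V$ be a complex vector space of dimension $N$. The variety of complete quadrics $\mathcal{CQ}(V)$ is the closure of the image of the rational map $\Phi\colon\mathbb{P}(S^2V)\dashrightarrow\prod_{i=1}^{N-1}\mathbb{P}(S^2(\bigwedge^iV))$, $[\varphi]\mapsto([\bigwedge^i\varphi])_i$, where $\varphi\in S^2V$ is viewed as a symmetric map $V^*\to V$ (in coordinates, $\bigwedge^i\varphi$ is the matrix of $i\times i$ minors of a symmetric matrix). Let $L_i$ be the pullback to $\mathcal{CQ}(V)$ of the hyperplane class of the $i$-th factor. For a linear subspace $L\subset S^2V$ of dimension $d+1$ containing a matrix of rank at least $N-1$, let $X_L$ be the closure of the image under $\Phi$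 of the open set of matrices of rank at least $N-1$ in $\mathbb{P}(L)$; $\dim X_L=d$. For non-negative integers $b_1,\dots,b_{N-1}$ with sum $d$, the characteristic number is $c^L_{b_1,\dots,b_{N-1}}=[X_L]\cdot L_1^{b_1}\cdots L_{N-1}^{b_{N-1}}\in\mathbb{Z}$ (intersection in the Chow ring of $\mathcal{CQ}(V)$), i.e. the number of points of the intersection of $X_L$ with $b_i$ general hyperplanes pulled back from the $i$-th factor, $i=1,\dots,N-1$. Characteristic numbers of algebras. For an algebra $A$ of dimension $N$, let $L^A\subset S^2A^*$ be the $N$-dimensional space of symmetric bilinear forms $(a,b)\mapsto\lambda(ab)$, $\lambda\in A^*$. The characteristic numbers of $A$, indexed by $(b_1,\dots,b_{N-1})$ with $\sum b_i=N-1$, are those of $L^A$ (with $V=A^*$). Here $N=n+1$. *)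

(* Defs.v *)
From HB Require Import structures.
From mathcomp Require Import all_boot all_order all_algebra falgebra.
From mathcomp Require Import generic_quotient ring_quotient complex.
From mathcomp Require Import boolp classical_sets functions cardinality reals.
From mathcomp Require Import mpoly.

Set Implicit Arguments.
Unset Strict Implicit.
Unset Printing Implicit Defensive.

Import GRing.Theory.

Local Open Scope ring_scope.
Local Open Scope classical_set_scope.

Section IdealGeneratedBy.
Variable R : comNzRingType.

Definition ideal_gen (G : set R) : set R :=
  [set p | exists2 s : seq (R * R),
     (forall q, q \in s -> G q.2) & p = \sum_(q <- s) q.1 * q.2].

Lemma ideal_gen0 (G : set R) : ideal_gen G 0.
Proof. by exists [::]; rewrite ?big_nil. Qed.

Lemma ideal_genD (G : set R) p q :
  ideal_gen G p -> ideal_gen G q -> ideal_gen G (p + q).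
Proof.
move=> [s sG ->] [t tG ->]; exists (s ++ t); last by rewrite big_cat.
by move=> x; rewrite mem_cat => /orP[/sG|/tG].
Qed.

Lemma ideal_genM (G : set R) a p : ideal_gen G p -> ideal_gen G (a * p).
Proof.
move=> [s sG ->]; exists [seq (a * q.1, q.2) | q <- s].
  by move=> x /mapP[q /sG qG ->].
by rewrite big_map mulr_sumr; apply: eq_bigr => q _ /=; rewrite mulrA.
Qed.

Lemma ideal_genN (G : set R) p : ideal_gen G p -> ideal_gen G (- p).
Proof. by rewrite -mulN1r; apply: ideal_genM. Qed.

Lemma ideal_gen_sub (G : set R) p : G p -> ideal_gen G p.
Proof.
move=> Gp; exists [:: (1, p)]; last by rewrite big_seq1 mul1r.
by move=> q; rewrite inE => /eqP ->.
Qed.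

Lemma ideal_gen_sum (G : set R) (I : Type) (r : seq I) (F : I -> R) :
  (forall i, ideal_gen G (F i)) -> ideal_gen G (\sum_(i <- r) F i).
Proof.
by move=> GF; elim/big_ind: _ => //; [exact: ideal_gen0|exact: ideal_genD].
Qed.

End IdealGeneratedBy.

Section CW.
Variables (K : fieldType) (n : nat).

(* The variables are x_0, ..., x_(n-2); for n >= 2 their number n.-2.+1 is
   n - 1, written so that x_0 always exists. *)
Local Notation P := {mpoly K[n.-2.+1]}.

Definition CW_gens : set P :=
  [set p | [\/ exists i j, i != j /\ p = 'X_i * 'X_j,
               exists i j, i != j /\ p = 'X_i ^+ 2 - 'X_j ^+ 2
             | p = 'X_ord0 ^+ 3]].

Definition CW_ideal : pred P := fun p => `[< ideal_gen CW_gens p >].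

(* The coefficients of a polynomial modulo the ideal, on the basis
   1, x_0, ..., x_(n-2), x_0^2 of the quotient. *)
Definition CW_nf (p : P) : 'rV[K]_(1 + (n.-2.+1 + 1)) :=
  row_mx (p@_0%MM)%:M
    (row_mx (\row_i p@_U_(i)%MM) (\sum_i p@_(U_(i) *+ 2)%MM)%:M).

Lemma CW_nf_eq0 p : CW_nf p = 0 <->
  [/\ p@_0%MM = 0, forall i, p@_U_(i)%MM = 0
    & \sum_i p@_(U_(i) *+ 2)%MM = 0].
Proof.
rewrite /CW_nf -!row_mx0; split=> [/eq_row_mx[p0 /eq_row_mx[/rowP p1 p2]]|].
  split=> [|i|]; first by move/matrixP/(_ 0 0): p0; rewrite !mxE.
    by have := p1 i; rewrite !mxE.
  by move/matrixP/(_ 0 0): p2; rewrite !mxE.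
move=> [-> p1 ->]; congr (row_mx _ (row_mx _ _)); apply/rowP => i.
- by rewrite !mxE mul0rn.
- by rewrite !mxE.
- by rewrite !mxE mul0rn.
Qed.

Lemma CW_nf_is_linear : linear CW_nf.
Proof.
move=> c p q; rewrite /CW_nf !scale_row_mx !add_row_mx.
congr (row_mx _ (row_mx _ _)); apply/rowP => i; rewrite !mxE.
- by rewrite mcoeffD mcoeffZ !mulrnAr -mulrnDl.
- by rewrite mcoeffD mcoeffZ.
- rewrite mulrnAr -mulrnDl mulr_sumr -big_split /=; congr (_ *+ _).
  by apply: eq_bigr => j _; rewrite mcoeffD mcoeffZ.
Qed.

HB.instance Definition _ :=
  GRing.isLinear.Build K P 'rV[K]_(1 + (n.-2.+1 + 1)) _ CW_nf CW_nf_is_linear.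

Lemma mcoeff_mulX (a : P) u m :
  (a * 'X_[u])@_m = if (u <= m)%MM then a@_(m - u)%MM else 0.
Proof.
case: ifP => um; first by rewrite -{1}(submK um) addmC mcoeffMX.
rewrite [a in LHS]mpolyE mulr_suml raddf_sum big1 //= => k _.
rewrite -scalerAl mcoeffZ -mpolyXD mcoeffX; case: eqP => [km|]; last first.
  by rewrite mulr0.
by move: um; rewrite -km lem_addl.
Qed.

Lemma CW_nf_mulX (a : P) u : (1 < mdeg u)%N ->
  CW_nf (a * 'X_[u]) = 0 <-> \sum_i (a * 'X_[u])@_(U_(i) *+ 2)%MM = 0.
Proof.
move=> u1; have small m : (mdeg m <= 1)%N -> (u <= m)%MM = false.
  move=> m1; apply/negP => /mnm_lepP um.
  have : (mdeg u <= mdeg m)%N by rewrite !mdegE; apply: leq_sum.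
  by rewrite leqNgt (leq_ltn_trans m1 u1).
rewrite CW_nf_eq0; split=> [[]//|->]; split=> // [|i];
  by rewrite mcoeff_mulX small // ?mdeg0 ?mdeg1.
Qed.

Lemma CW_nf_mulX0 (a : P) u :
  (1 < mdeg u)%N -> (forall i, (u <= U_(i) *+ 2)%MM = false) ->
  CW_nf (a * 'X_[u]) = 0.
Proof.
move=> u1 uF; apply/(CW_nf_mulX _ u1); rewrite big1 // => i _.
by rewrite mcoeff_mulX uF.
Qed.

Lemma lem_mulmU2 (u : 'X_{1..n.-2.+1}) i : (1 < mdeg u)%N ->
  (u <= U_(i) *+ 2)%MM -> u = (U_(i) *+ 2)%MM.
Proof.
move=> u1 uU; have := submK uU; set v := (_ - _)%MM => vu.
suff : mdeg v == 0%N by rewrite mdeg_eq0 => /eqP v0; rewrite -vu v0 add0m.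
have := congr1 mdeg vu; rewrite mdegD mdegMn mdeg1.
by case: (mdeg v) => // k; case: (mdeg u) u1 => // -[|l] //= _; rewrite !addnS; case.
Qed.

Lemma CW_nf_sq (a : P) i : CW_nf (a * 'X_i ^+ 2) =
  row_mx 0 (row_mx 0 (a@_0%MM)%:M).
Proof.
have u1 : (1 < mdeg (U_(i) *+ 2 : 'X_{1..n.-2.+1}))%N by rewrite mdegMn mdeg1.
have sq m : (a * 'X_i ^+ 2)@_m =
    if (U_(i) *+ 2 <= m)%MM then a@_(m - U_(i) *+ 2)%MM else 0.
  by rewrite mpolyXn mcoeff_mulX.
have small m : (mdeg m <= 1)%N -> (a * 'X_i ^+ 2)@_m = 0.
  move=> m1; rewrite sq; case: ifP => // /mnm_lepP um.
  have : (mdeg (U_(i) *+ 2) <= mdeg m)%N by rewrite !mdegE; apply: leq_sum.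
  by rewrite leqNgt (leq_ltn_trans m1 u1).
rewrite /CW_nf small ?mdeg0 // (bigD1 i) //= big1 => [|j ji]; last first.
  rewrite sq; case: ifP => // /lem_mulmU2 => /(_ u1) /mnmP/(_ i).
  by rewrite !mulmnE !mnmE eqxx (negPf ji).
rewrite addr0 sq lepm_refl (_ : (_ - _)%MM = 0%MM); last first.
  by apply/mnmP => k; rewrite !mnmE subnn.
congr (row_mx _ (row_mx _ _)).
- by apply/rowP => k; rewrite !mxE mul0rn.
- by apply/rowP => k; rewrite !mxE small // mdeg1.
Qed.

Lemma CW_ideal_nf p : ideal_gen CW_gens p -> CW_nf p = 0.
Proof.
move=> [s sG ->]; rewrite raddf_sum big_seq big1 // => q /sG.
case: q => a g /= [[i [j [ij ->]]]|[i [j [ij ->]]]|->] {sG}.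
- rewrite -mpolyXD; apply: CW_nf_mulX0; first by rewrite mdegD !mdeg1.
  move=> k; apply/negP => /lem_mulmU2; rewrite mdegD !mdeg1 => /(_ isT).
  move=> /mnmP e; have := e i; have := e j; rewrite !mulmnE !mnmE !eqxx.
  rewrite (negPf ij) [j == i]eq_sym (negPf ij).
  have [->|ki] := eqVneq k i; first by rewrite (negPf ij).
  by have [|] := eqVneq k j.
- by rewrite mulrBr raddfB /= !CW_nf_sq subrr.
- rewrite exprS mulrA CW_nf_sq mcoeff_mulX ifF.
    by rewrite (raddf0 (@scalar_mx K 1)) !row_mx0.
  by apply/negP => /mnm_lepP/(_ ord0); rewrite !mnmE eqxx.
Qed.

(* The standard monomial of the class of 'X_[m], or 0. *)
Let stdmon (m : 'X_{1..n.-2.+1}) : P :=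
  (m == 0%MM)%:R + \sum_i (m == U_(i)%MM)%:R *: 'X_i
  + (\sum_i (m == (U_(i) *+ 2)%MM)%:R) *: 'X_ord0 ^+ 2.

Let stdmon3 m : (2 < mdeg m)%N -> stdmon m = 0.
Proof.
move=> m3; rewrite /stdmon !(big1 _ (fun=> true)).
- by rewrite scale0r !addr0; case: eqP m3 => // ->; rewrite mdeg0.
- by move=> i _; case: eqP m3 => // ->; rewrite mdegMn mdeg1.
- by move=> i _; case: eqP m3 => [->|]; rewrite ?mdeg1 ?scale0r.
Qed.

Let in_ij a i j : i != j -> ideal_gen CW_gens (a * ('X_i * 'X_j)).
Proof.
by move=> ij; apply: ideal_genM; apply: ideal_gen_sub; constructor 1; exists i, j.
Qed.

Let in_sq a i : ideal_gen CW_gens (a * ('X_i ^+ 2 - 'X_ord0 ^+ 2)).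
Proof.
apply: ideal_genM; have [->|i0] := eqVneq i ord0.
  by rewrite subrr; apply: ideal_gen0.
by apply: ideal_gen_sub; constructor 2; exists i, ord0.
Qed.

Let in_cube a i : ideal_gen CW_gens (a * 'X_i ^+ 3).
Proof.
apply: ideal_genM; have [->|i0] := eqVneq i ord0.
  by apply: ideal_gen_sub; constructor 3.
have -> : 'X_i ^+ 3 = 'X_i * ('X_i ^+ 2 - 'X_ord0 ^+ 2)
    + 'X_ord0 * ('X_i * 'X_ord0) :> P.
  by rewrite mulrBr -exprS [in X in _ + X]mulrCA -expr2 subrK.
by apply: ideal_genD; [apply: in_sq | apply: in_ij].
Qed.

Let stdmonP m : ideal_gen CW_gens ('X_[m] - stdmon m).
Proof.
have divU (u : 'X_{1..n.-2.+1}) : u != 0%MM ->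
    exists i, exists v, u = (U_(i) + v)%MM.
  rewrite -mdeg_eq0 mdegE sum_nat_eq0 negb_forall => /existsP[i /= ui].
  exists i, (u - U_(i))%MM; rewrite addmC submK //; apply/mnm_lepP => k.
  by rewrite mnmE; case: eqP => // <-; rewrite lt0n.
have [->|/divU[i [v ->]] {m}] := eqVneq m 0%MM.
  rewrite /stdmon eqxx !(big1 _ (fun=> true)).
  - by rewrite scale0r !addr0 mpolyX0 subrr; apply: ideal_gen0.
  - move=> i _; case: eqP => // /(congr1 mdeg).
    by rewrite mdeg0 mdegMn mdeg1.
  - move=> i _; case: eqP => [/(congr1 mdeg)|]; last by rewrite scale0r.
    by rewrite mdeg0 mdeg1.
have [->|/divU[j [w ->]] {v}] := eqVneq v 0%MM.
  rewrite addm0 /stdmon (bigD1 i) //= eqxx scale1r.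
  rewrite (negPf (_ : U_(i)%MM != 0%MM)) -?mdeg_eq0 ?mdeg1 // add0r.
  rewrite big1 => [|k ki]; last first.
    case: eqP => [/mnmP/(_ k)|]; last by rewrite scale0r.
    by rewrite !mnmE eqxx eq_sym (negPf ki).
  rewrite addr0 big1 => [|k _].
    by rewrite scale0r addr0 subrr; apply: ideal_gen0.
  by case: eqP => // /(congr1 mdeg); rewrite mdegMn !mdeg1.
have [<-{j}|ij] := eqVneq i j; last first.
  suff -> : stdmon (U_(i) + (U_(j) + w)) = 0.
    by rewrite subr0 addmA addmC mpolyXD mpolyXD; apply: in_ij.
  rewrite /stdmon !(big1 _ (fun=> true)).
  - rewrite scale0r !addr0; case: eqP => // /(congr1 mdeg).
    by rewrite !mdegD !mdeg1 mdeg0.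
  - move=> k _; case: eqP => // /mnmP e; have := e i; have := e j.
    rewrite !mulmnE !mnmE !eqxx (negPf ij) [j == i]eq_sym (negPf ij).
    have [->|ki] := eqVneq k i; first by rewrite (negPf ij).
    by have [|] := eqVneq k j.
  - move=> k _; case: eqP => [/(congr1 mdeg)|]; last by rewrite scale0r.
    by rewrite !mdegD !mdeg1.
have -> : (U_(i) + (U_(i) + w) = U_(i) *+ 2 + w)%MM.
  by apply/mnmP => l; rewrite !mnmDE addnA.
have [->|/divU[k [v ->]] {w}] := eqVneq w 0%MM.
  rewrite addm0 (_ : stdmon _ = 'X_ord0 ^+ 2) -?mpolyXn.
    by have := in_sq 1 i; rewrite mul1r.
  rewrite /stdmon big1 => [|k _]; last first.
    case: eqP => [/(congr1 mdeg)|]; last by rewrite scale0r.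
    by rewrite mdegMn !mdeg1.
  rewrite (bigD1 i) //= eqxx big1 => [|k ki]; last first.
    case: eqP => // /mnmP/(_ k).
    by rewrite !mulmnE !mnmE eqxx eq_sym (negPf ki).
  by rewrite -mdeg_eq0 mdegMn mdeg1 !(addr0, add0r) scale1r.
rewrite stdmon3 ?subr0; last by rewrite !mdegD !mdeg1.
rewrite addmA addmC !mpolyXD.
have [->|ki] := eqVneq k i; first by rewrite -expr2 -exprSr; apply: in_cube.
by rewrite -!mulrA mulrA; apply: in_ij; rewrite eq_sym.
Qed.

Lemma CW_nf_ideal p : CW_nf p = 0 -> ideal_gen CW_gens p.
Proof.
move=> /CW_nf_eq0[p0 p1 p2].
have -> : p = \sum_(m <- msupp p) p@_m *: ('X_[m] - stdmon m).
  rewrite (eq_bigr _ (fun m _ => scalerBr _ _ _)) sumrB -mpolyE.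
  suff -> : \sum_(m <- msupp p) p@_m *: stdmon m = 0 by rewrite subr0.
  have pick u : \sum_(m <- msupp p) p@_m * (m == u)%:R = p@_u.
    rewrite [in RHS](mpolyE p) raddf_sum /=; apply: eq_bigr => m _.
    by rewrite mcoeffZ mcoeffX.
  have pickZ u (q : P) :
      \sum_(m <- msupp p) p@_m *: ((m == u)%:R *: q) = p@_u *: q.
    by rewrite -pick scaler_suml; apply: eq_bigr => m _; rewrite scalerA.
  have -> : \sum_(m <- msupp p) p@_m *: stdmon m =
      p@_0%MM *: 1 + \sum_i p@_U_(i)%MM *: 'X_i
      + (\sum_i p@_(U_(i) *+ 2)%MM) *: 'X_ord0 ^+ 2.
    under eq_bigr do rewrite /stdmon !scalerDr.
    rewrite !big_split /=; congr (_ + _ + _).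
    - by rewrite -pickZ; apply: eq_bigr => m _; rewrite scaler_nat.
    - under eq_bigr do rewrite scaler_sumr.
      by rewrite exchange_big /=; apply: eq_bigr => i _; rewrite pickZ.
    - rewrite scaler_suml; under [RHS]eq_bigr do rewrite -pickZ.
      rewrite exchange_big /=; apply: eq_bigr => m _.
      by rewrite scaler_suml scaler_sumr.
  rewrite p0 p2 !scale0r add0r addr0 big1 // => i _.
  by rewrite p1 scale0r.
apply: ideal_gen_sum => m; rewrite -mul_mpolyC; apply: ideal_genM.
exact: stdmonP.
Qed.

Lemma CW_idealP p : reflect (ideal_gen CW_gens p) (p \in CW_ideal).
Proof. exact: asboolP. Qed.

Lemma CW_ideal_closed : idealr_closed CW_ideal.
Proof.
split=> [||a p q /CW_idealP pI /CW_idealP qI].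
- exact/CW_idealP/ideal_gen0.
- apply/CW_idealP => /CW_ideal_nf/CW_nf_eq0[+ _ _].
  by rewrite mcoeff1 eqxx => /eqP; rewrite oner_eq0.
- by apply/CW_idealP/ideal_genD => //; apply: ideal_genM.
Qed.

HB.instance Definition _ := isIdealr.Build P CW_ideal CW_ideal_closed.

(* The cast supplies the [idealr] structure of [CW_ideal]. *)
Local Notation Q := {ideal_quot (CW_ideal : idealr P)}.

Definition CW : Type := Q.

HB.instance Definition _ := GRing.ComNzRing.on CW.

Definition CW_pi (p : P) : CW := \pi_(Q)%qT p.

Fact CW_pi_is_zmod_morphism : zmod_morphism CW_pi.
Proof. exact: raddfB. Qed.
Fact CW_pi_is_monoid_morphism : monoid_morphism CW_pi.
Proof. by split; [exact: rmorph1 | exact: rmorphM]. Qed.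
HB.instance Definition _ :=
  GRing.isZmodMorphism.Build P CW CW_pi CW_pi_is_zmod_morphism.
HB.instance Definition _ :=
  GRing.isMonoidMorphism.Build P CW CW_pi CW_pi_is_monoid_morphism.

Lemma CW_pi_surj (x : CW) : exists p, x = CW_pi p.
Proof. by exists (repr (x : Q)); rewrite /CW_pi reprK. Qed.

Lemma CW_pi_eq0 p : CW_pi p = 0 <-> ideal_gen CW_gens p.
Proof.
split=> [|/CW_idealP pI].
  move=> p0; apply/CW_idealP; rewrite -[p]subr0 Quotient.idealrBE.
  by apply/eqP; rewrite -[RHS](rmorph0 CW_pi) in p0.
have : p - 0 \in CW_ideal by rewrite subr0.
by rewrite Quotient.idealrBE => /eqP p0; rewrite -(rmorph0 CW_pi).
Qed.

Definition CW_scale (c : K) (x : CW) : CW := CW_pi c%:MP * x.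

Fact CW_scaleA a b x : CW_scale a (CW_scale b x) = CW_scale (a * b) x.
Proof. by rewrite /CW_scale mulrA -rmorphM mpolyCM. Qed.
Fact CW_scale1 : left_id 1 CW_scale.
Proof. by move=> x; rewrite /CW_scale rmorph1 mul1r. Qed.
Fact CW_scaleDr : right_distributive CW_scale +%R.
Proof. by move=> c x y; rewrite /CW_scale mulrDr. Qed.
Fact CW_scaleDl x : {morph CW_scale^~ x : a b / a + b}.
Proof. by move=> a b; rewrite /CW_scale mpolyCD rmorphD mulrDl. Qed.
HB.instance Definition _ := GRing.Zmodule_isLmodule.Build K CW
  CW_scaleA CW_scale1 CW_scaleDr CW_scaleDl.

Fact CW_scaleAl (c : K) (x y : CW) : c *: (x * y) = (c *: x) * y.
Proof. exact: mulrA. Qed.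
HB.instance Definition _ := GRing.Lmodule_isLalgebra.Build K CW CW_scaleAl.

Fact CW_scaleAr (c : K) (x y : CW) : c *: (x * y) = x * (c *: y).
Proof. exact: mulrCA. Qed.
HB.instance Definition _ := GRing.Lalgebra_isAlgebra.Build K CW CW_scaleAr.

Fact CW_pi_is_scalable : scalable CW_pi.
Proof. by move=> c p; rewrite -mul_mpolyC rmorphM. Qed.
HB.instance Definition _ :=
  GRing.isScalable.Build K P CW *:%R CW_pi CW_pi_is_scalable.

Fact CW_vect_iso : Vector.axiom (1 + (n.-2.+1 + 1)) CW.
Proof.
pose f (x : CW) := CW_nf (repr (x : Q)).
have fpi p : f (CW_pi p) = CW_nf p.
  apply/eqP; rewrite -subr_eq0 -raddfB; apply/eqP/CW_ideal_nf/CW_pi_eq0.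
  by rewrite rmorphB /= {1}/CW_pi reprK subrr.
have flin : linear f.
  move=> c x y; have [p ->] := CW_pi_surj x; have [q ->] := CW_pi_surj y.
  by rewrite -linearP !fpi linearP.
exists f => //.
pose g (v : 'rV[K]_(1 + (n.-2.+1 + 1))) : P :=
  (lsubmx v 0 0)%:MP + \sum_i lsubmx (rsubmx v) 0 i *: 'X_i
  + rsubmx (rsubmx v) 0 0 *: 'X_ord0 ^+ 2.
have gE v m : (g v)@_m = lsubmx v 0 0 * (m == 0%MM)%:R
    + \sum_i lsubmx (rsubmx v) 0 i * (U_(i)%MM == m)%:R
    + rsubmx (rsubmx v) 0 0 * ((U_(ord0) *+ 2)%MM == m)%:R.
  rewrite !mcoeffD mcoeffC mcoeffZ mpolyXn mcoeffX raddf_sum /=.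
  by congr (_ + _ + _); apply: eq_bigr => i _; rewrite mcoeffZ mcoeffX.
have degF (m1 m2 : 'X_{1..n.-2.+1}) : mdeg m1 != mdeg m2 -> (m1 == m2) = false.
  by apply: contraNF => /eqP ->.
have fg v : CW_nf (g v) = v.
  rewrite -[RHS]hsubmxK -[X in row_mx _ X]hsubmxK.
  congr (row_mx _ (row_mx _ _)); apply/rowP => k.
  - rewrite ord1 !mxE gE eqxx degF ?mdegMn ?mdeg1 ?mdeg0 // mulr0 addr0.
    rewrite big1 => [|i _]; last by rewrite degF ?mdeg1 ?mdeg0 // mulr0.
    by rewrite mulr1 addr0 mxE.
  - rewrite mxE gE !degF ?mdegMn ?mdeg1 ?mdeg0 // !mulr0 addr0 add0r.
    rewrite (bigD1 k) //= eqxx mulr1 big1 ?addr0 // => i ik.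
    case: eqP => [/mnmP/(_ k)|]; last by rewrite mulr0.
    by rewrite !mnmE eqxx (negPf ik).
  - rewrite ord1 [LHS]mxE eqxx mulr1n (bigD1 ord0) //= gE eqxx mulr1.
    rewrite degF ?mdegMn ?mdeg1 ?mdeg0 // mulr0 add0r big1 => [|i _]; last first.
      by rewrite degF ?mdegMn ?mdeg1 // mulr0.
    rewrite add0r big1 ?addr0 // => i i0; rewrite gE.
    rewrite degF ?mdegMn ?mdeg1 ?mdeg0 // mulr0 add0r big1 => [|j _]; last first.
      by rewrite degF ?mdegMn ?mdeg1 // mulr0.
    case: eqP => [/mnmP/(_ i)|]; last by rewrite mulr0 addr0.
    by rewrite !mulmnE !mnmE eqxx eq_sym (negPf i0).
exists (CW_pi \o g) => [x|v]; last by rewrite /= fpi fg.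
have [p ->] := CW_pi_surj x; rewrite fpi /=.
apply/eqP; rewrite -subr_eq0 -rmorphB; apply/eqP/CW_pi_eq0/CW_nf_ideal.
by rewrite raddfB /= fg subrr.
Qed.
HB.instance Definition _ := Lmodule_hasFinDim.Build K CW CW_vect_iso.
HB.instance Definition _ := Algebra_isFalgebra.Build K CW.

Lemma dim_CW : (1 < n)%N -> \dim {:CW} = n.+1.
Proof. by rewrite dimvf => n2; rewrite /dim /= addn1 add1n; case: n n2 => // -[]. Qed.
End CW.

Section MultiProjective.
Variable K : fieldType.

Definition peval (T : finType) (F : {mpoly K[#|T|]}) (v : T -> K) : K :=
  F.@[fun k => v (enum_val k)].

(* P holds on a nonempty Zariski-open subset of K^T (K infinite). *)
Definition generically (T : finType) (P : (T -> K) -> Prop) : Prop :=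
  exists2 F : {mpoly K[#|T|]}, F != 0 & forall v, peval F v != 0 -> P v.

Definition pspace (T : finType) : Type :=
  {U : {vspace {ffun T -> K^o}} | \dim U == 1%N}.

Definition in_hyperplane (T : finType) (h : T -> K) (x : pspace T) : Prop :=
  forall v, v \in val x -> \sum_t h t * v t = 0.

Section Closure.
Variables (I : finType) (T : I -> finType).

Definition total_idx : finType := {i : I & T i}.

Definition homog_coords (x : forall i, pspace (T i))
    (v : forall i, {ffun T i -> K^o}) : Prop :=
  forall i, <[v i]>%VS = val (x i).

(* F need not be multihomogeneous: over an infinite field it vanishes at all
   the homogeneous coordinates of x iff its multihomogeneous components do. *)
Definition vanishes_at (F : {mpoly K[#|total_idx|]})
    (x : forall i, pspace (T i)) : Prop :=
  forall v, homog_coords x v ->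
    peval F (fun k : total_idx => v (tag k) (tagged k)) = 0.

Definition zariski_closure (Z : set (forall i, pspace (T i))) :
    set (forall i, pspace (T i)) :=
  [set x | forall F, (forall z, Z z -> vanishes_at F z) -> vanishes_at F x].

End Closure.
End MultiProjective.

Section CharacteristicNumbers.
Variables (K : fieldType) (N : nat).

(* The basis of \bigwedge^r V: increasing sequences of r indices. *)
Definition wedge_idx (r : nat) : finType :=
  {s : r.-tuple 'I_N | sorted ltn [seq val i | i <- s]}.

(* Coordinates on S^2 (\bigwedge^r V): the entries of a symmetric matrix on
   and above the diagonal. *)
Definition sym_idx (r : nat) : finType :=
  {p : wedge_idx r * wedge_idx r | (enum_rank p.1 <= enum_rank p.2)%N}.

Definition compound (r : nat) (M : 'M[K]_N) : {ffun sym_idx r -> K^o} :=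
  [ffun p => \det (mxsub (tnth (val (val p).1)) (tnth (val (val p).2)) M)].

(* The product of the P(S^2 (\bigwedge^r V)), 1 <= r <= N - 1; the index
   i : 'I_N.-1 stands for r = i.+1. *)
Definition quadric_space : Type := forall i : 'I_N.-1, pspace K (sym_idx i.+1).

Definition Phi_image (L : {vspace 'M[K]_N}) : set quadric_space :=
  [set x | exists2 M, M \in L /\ (N.-1 <= \rank M)%N
                    & forall i : 'I_N.-1, val (x i) = <[compound i.+1 M]>%VS].

Definition X_ (L : {vspace 'M[K]_N}) : set quadric_space :=
  zariski_closure (Phi_image L).

(* A choice of b_i hyperplanes in the i-th factor, for all i: the coefficients
   h (i, (j, t)), where j : 'I_(b i.+1) numbers the hyperplanes and t the
   coordinates of the factor. *)
Definition hyperplane_idx (b : nat -> nat) : finType :=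
  {i : 'I_N.-1 & ('I_(b i.+1) * sym_idx i.+1)%type}.

Definition hyperplane_section (b : nat -> nat) (h : hyperplane_idx b -> K) :
    set quadric_space :=
  [set x | forall (i : 'I_N.-1) (j : 'I_(b i.+1)),
     in_hyperplane (fun t => h (existT _ i (j, t))) (x i)].

(* c is the characteristic number c^L_(b 1, ..., b (N - 1)). The factors are
   numbered from 1, as is b, whose other values are irrelevant. *)
Definition is_char_number (L : {vspace 'M[K]_N}) (b : nat -> nat) (c : nat) :
    Prop :=
  generically (fun h : hyperplane_idx b -> K =>
    (X_ L `&` hyperplane_section h #= `I_c)%card).

End CharacteristicNumbers.

Section Algebra.
Variables (K : fieldType) (A : falgType K) (N : nat) (e : N.-tuple A).

(* The form (a, b) |-> l (a * b), in the basis e of A: an element of S^2 A^*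
   in the basis of A^* dual to e. *)
Definition mul_form (l : 'Hom(A, K^o)) : 'M[K]_N :=
  \matrix_(i, j) l (tnth e i * tnth e j).

Fact mul_form_is_linear : linear mul_form.
Proof. by move=> c l m; apply/matrixP => i j; rewrite !mxE !lfunE /= lfunE. Qed.
HB.instance Definition _ :=
  GRing.isLinear.Build K 'Hom(A, K^o) 'M[K]_N _ mul_form mul_form_is_linear.

Definition form_space : {vspace 'M[K]_N} := limg (linfun mul_form).

Lemma form_spaceP M :
  reflect (exists l, M = mul_form l) (M \in form_space).
Proof.
apply: (iffP memv_imgP) => [[l _ ->]|[l ->]].
  by exists l; rewrite lfunE.
by exists l; rewrite ?memvf ?lfunE.
Qed.

End Algebra.

(* Main.v *)
(* In the basis 1, x_0^2, x_0, ..., x_(n-2) of CW_n the form l(xy) has a Gram matrix with entries u = l(1), v_b = l(x_b) and w = l(x_0^2). On the chart w = 1 the matrix is invertible, its entries span 1, v_b, u, its n x n minors span 1, v_b, u - |v|^2, and its minors of size 1 < r < n have a span that contains 1, v_b, v_a v_b and v_a^2 - v_b^2 for a != b, and u - (v_b^2 summed over r - 1 indices b). Hence general hyperplane sections are n equations in n unknowns, and eliminating u by one of them leaves linear equations from the first and last factors and quadratic ones from the others; if both a_1 and a_n are positive, a second pivot in the last factor is needed and contributes one more quadratic equation. The formula is the Bezout number of the resulting system. That a general system has no solution at infinity and only simple solutions is an open condition, verified on a system with solutions z_j = +-2^j (z_j = 0 for the linear equations), where the z_j are isotropic linear forms in v, or v itself in the case of two pivots. Finally, a point of X_L outside the chart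 would give a solution at infinity of the eliminated system, because it satisfies the relations between the minors that hold on the chart. *)

Require Import Defs.
From HB Require Import structures.
From mathcomp Require Import all_boot all_order all_fingroup all_algebra all_field.
From mathcomp Require Import complex reals.
From mathcomp Require Import boolp classical_sets functions cardinality.
From mathcomp Require Import ssrcomplements mpoly zify ring.

Set Implicit Arguments.
Unset Strict Implicit.
Unset Printing Implicit Defensive.

Import GRing.Theory Num.Theory.

Local Open Scope ring_scope.

(** * Systems of linear and quadratic equations with as many solutions as Bezout predicts *)

(** Genericity is witnessed by a single nonzero polynomial in the hyperplane coefficients, so every
    condition is phrased as the nonvanishing of a determinant, a resultant, or a coefficient of [u]
    in a pivot. Simplicity of the solutions becomes a resultant once the sum of the unknowns
    generates the quotient algebra; powers of two are chosen because the sums of [+-2^j] are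
    pairwise distinct. The special system needs equations with a single squared unknown. The
    combinations of middle minors at hand that are free of [u] have a traceless quadratic part in
    [v], hence the isotropic forms. With pivots in both end factors, [u - |v|^2] has to be diagonal
    in the same unknowns, which isotropic forms do not allow; there [v] is kept and the trace is
    compensated by [u]. In the last factor every quadratic part is a multiple of [|v|^2]: reducing
    all its equations by a pivot of the first factor would give them the same leading form, hence
    the second pivot. When only middle factors carry equations, a point at infinity shows [v v^T]
    only up to a multiple of the identity, and a square root is adjoined to find a vector. *)

Section Theta.
Variable k : nat.

(* The matrix of the map [Theta P] below on the polynomials of degree at most [e]. *)
Definition cmx (R : comNzRingType) e (P : 'X_{1..k} -> {mpoly R[k]}) :=
  \matrix_(i, j < #|{: 'X_{1..k < e.+1}}|)
    (P (enum_val i : 'X_{1..k < e.+1}))@_(enum_val j : 'X_{1..k < e.+1}).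

Definition coefv (R : comNzRingType) e (p : {mpoly R[k]}) :=
  \row_(j < #|{: 'X_{1..k < e.+1}}|) p@_(enum_val j : 'X_{1..k < e.+1}).

Variable K : fieldType.
Implicit Types (p q r : {mpoly K[k]}) (P : 'X_{1..k} -> {mpoly K[k]}).

Definition Theta P p : {mpoly K[k]} := \sum_(m <- msupp p) p@_m *: P m.

Lemma ThetaE P p w : (msize p <= w)%N ->
  Theta P p = \sum_(m : 'X_{1..k < w}) p@_m *: P m.
Proof.
move=> pw; pose I : subFinType _ := 'X_{1..k < w}.
rewrite /Theta (big_mksub I) ?msupp_uniq //=; last first.
  by move=> x /msize_mdeg_lt /leq_trans; apply.
by rewrite big_rmcond //= => j /memN_msupp_eq0 ->; rewrite scale0r.
Qed.

Lemma Theta_is_linear P : linear (Theta P).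
Proof.
move=> c p q; set w := maxn (msize p) (maxn (msize q) (msize (c *: p + q))).
rewrite !(@ThetaE P _ w) ?leq_max ?leqnn ?orbT // scaler_sumr -big_split /=.
by apply: eq_bigr => m _; rewrite mcoeffD mcoeffZ scalerDl scalerA.
Qed.
HB.instance Definition _ P :=
  GRing.isLinear.Build K {mpoly K[k]} {mpoly K[k]} _ (Theta P) (Theta_is_linear P).

Lemma ThetaX P m : Theta P 'X_[m] = P m.
Proof. by rewrite /Theta msuppX big_seq1 mcoeffX eqxx scale1r. Qed.

Lemma coefv_Theta e P r : (msize r <= e.+1)%N ->
  coefv e (Theta P r) = coefv e r *m cmx e P.
Proof.
move=> re; apply/rowP => j; rewrite !mxE (ThetaE _ re) raddf_sum /=.
rewrite (big_enum_val (fun m : 'X_{1..k < e.+1} => (r@_m *: P m)@_(enum_val j : 'X_{1..k < e.+1}))).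
by apply: eq_bigr => i _; rewrite !mxE mcoeffZ.
Qed.

Lemma coefv_inj e p q : (msize p <= e.+1)%N -> (msize q <= e.+1)%N ->
  coefv e p = coefv e q -> p = q.
Proof.
move=> pe qe /rowP pq; apply/mpolyP => m.
have [me|me] := ltnP (mdeg m) e.+1.
  by have := pq (enum_rank (BMultinom me)); rewrite !mxE enum_rankK.
by rewrite !memN_msupp_eq0 //; apply: msize_mdeg_ge; apply: leq_trans me.
Qed.

Lemma msize_sum_le (I : Type) (s : seq I) (Q : pred I) (F : I -> {mpoly K[k]}) e :
  (forall i, Q i -> msize (F i) <= e)%N -> (msize (\sum_(i <- s | Q i) F i) <= e)%N.
Proof.
move=> Fe; elim/big_ind: _ => // [|p q pe qe]; first by rewrite msize0.
by apply: leq_trans (msizeD_le _ _) _; rewrite geq_max pe.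
Qed.

Lemma coefvK e (v : 'rV[K]_(#|{: 'X_{1..k < e.+1}}|)) :
  exists2 p, (msize p <= e.+1)%N & coefv e p = v.
Proof.
exists (\sum_(m : 'X_{1..k < e.+1}) v 0 (enum_rank m) *: 'X_[m]).
  apply: msize_sum_le => m _; apply: leq_trans (msizeZ_le _ _) _.
  by rewrite msizeX bmdeg.
apply/rowP => j; rewrite mxE raddf_sum /= (bigD1 (enum_val j)) //= big1.
  by rewrite addr0 mcoeffZ mcoeffX eqxx mulr1 enum_valK.
move=> m mj; rewrite mcoeffZ mcoeffX; case: eqP => [/val_inj E|]; last by rewrite mulr0.
by rewrite E eqxx in mj.
Qed.

Lemma Theta_surj e P : (forall m, mdeg m <= e -> msize (P m) <= e.+1)%N ->
  \det (cmx e P) != 0 ->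
  forall p, (msize p <= e.+1)%N -> exists2 r, (msize r <= e.+1)%N & p = Theta P r.
Proof.
move=> Pe; rewrite -unitfE => Cu p pe.
have [r re rE] := coefvK (coefv e p *m invmx (cmx e P)); exists r => //.
apply: (@coefv_inj e) => //; last by rewrite coefv_Theta // rE mulmxKV.
rewrite (ThetaE _ re); apply: msize_sum_le => m _.
by apply: leq_trans (msizeZ_le _ _) _; rewrite Pe // -ltnS bmdeg.
Qed.

Lemma Theta_inj e P : \det (cmx e P) != 0 ->
  forall r, (msize r <= e.+1)%N -> Theta P r = 0 -> r = 0.
Proof.
rewrite -unitfE => Cu r re r0; apply: (@coefv_inj e) => //; rewrite ?msize0 //.
rewrite -[LHS](@mulmxK _ _ _ (cmx e P)) // -coefv_Theta // r0.
by apply/rowP => j; rewrite !mxE mcoeff0 big1 // => i _; rewrite !mxE mcoeff0 mul0r.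
Qed.

Lemma cmx_surj e P :
  (forall p, (msize p <= e.+1)%N -> exists2 r, (msize r <= e.+1)%N & p = Theta P r) ->
  \det (cmx e P) != 0.
Proof.
move=> surj; rewrite -unitfE -unitmxE -row_full_unit -sub1mx.
apply/row_subP => i; have [p pe pE] := coefvK (row i 1%:M).
by have [r re rE] := surj p pe; rewrite -pE rE coefv_Theta // submxMl.
Qed.

Lemma cmx_inj e P : (forall m, mdeg m <= e -> msize (P m) <= e.+1)%N ->
  (forall r, (msize r <= e.+1)%N -> Theta P r = 0 -> r = 0) ->
  \det (cmx e P) != 0.
Proof.
move=> Pe inj; rewrite -unitfE -unitmxE -row_free_unit.
apply: inj_row_free => v v0; have [r re rE] := coefvK v.
rewrite -rE (inj r re).
  by apply/rowP => j; rewrite !mxE mcoeff0.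
apply: (@coefv_inj e); rewrite ?msize0 //; last first.
  by rewrite coefv_Theta // rE v0; apply/rowP => j; rewrite !mxE mcoeff0.
rewrite (ThetaE _ re); apply: msize_sum_le => m _.
by apply: leq_trans (msizeZ_le _ _) _; rewrite Pe // -ltnS bmdeg.
Qed.

End Theta.

Section Defs.
Variables (k : nat) (q : 'I_k -> bool).

(* The monomials of degree at most [q j] in ['X_j], a basis of the quotient by the equations [f j] of degree [(q j).+1]. *)
Definition boxl : seq 'X_{1..k} :=
  [seq [multinom (j \in s : nat) | j < k] | s : {set 'I_k} <- enum (powerset [set j | q j])].

Lemma mem_boxl m : (m \in boxl) = [forall j, (m j <= q j)%N].
Proof.
apply/mapP/forallP => [[s] | mq].
  rewrite mem_enum powersetE => /fintype.subsetP sq -> j; rewrite mnmE.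
  by case: (boolP (j \in s)) => // /sq; rewrite inE => ->.
exists [set j | m j != 0%N].
  rewrite mem_enum powersetE; apply/fintype.subsetP => j; rewrite !inE.
  by have := mq j; case: (q j) => //; rewrite leqn0 => /eqP ->.
apply/mnmP => j; rewrite mnmE inE.
by have := mq j; case: (m j) => [|[|i]] //; case: (q j).
Qed.

Lemma boxl_uniq : uniq boxl.
Proof.
rewrite map_inj_in_uniq ?enum_uniq // => s t _ _ /mnmP st.
by apply/setP => j; have := st j; rewrite !mnmE; case: (j \in s); case: (j \in t).
Qed.

Lemma size_boxl : size boxl = (2 ^ #|[set j | q j]|)%N.
Proof. by rewrite size_map -cardE card_powerset. Qed.

Lemma mdeg_boxl m : m \in boxl -> (mdeg m <= size boxl)%N.
Proof.
case/mapP => s; rewrite mem_enum powersetE => sq ->.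
apply: (@leq_trans #|[set j | q j]|); last by rewrite size_boxl ltnW // ltn_expl.
apply: leq_trans (subset_leq_card sq); rewrite mdegE -sum1_card [leqRHS]big_mkcond /=.
by apply: leq_sum => j _; rewrite mnmE; case: (j \in s).
Qed.

Lemma size_boxl_gt0 : (0 < size boxl)%N.
Proof. by rewrite size_boxl expn_gt0. Qed.

Variable R : comNzRingType.
Variable f : 'I_k -> {mpoly R[k]}.

(* ['X_[m]] with ['X_j ^+ (q j).+1] replaced by [f j]. When the [Pm m] with [mdeg m <= e] span the polynomials of degree at most [e], for all [e], the [f j] have no common zero at infinity and the box is a basis of the quotient. *)
Definition Pm (m : 'X_{1..k}) : {mpoly R[k]} :=
  \prod_j ('X_j ^+ (m j %% (q j).+1) * f j ^+ (m j %/ (q j).+1)).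

Definition linz : {mpoly R[k]} := \sum_j 'X_j.

(* The box monomials are traded for the powers of [linz]: if these still give a basis, [linz] generates the quotient. *)
Definition Pz (m : 'X_{1..k}) : {mpoly R[k]} :=
  if m \in boxl then linz ^+ index m boxl else Pm m.

(* A multiple of the minimal polynomial of [linz] modulo the [f j], by Cramer's rule; its formula is polynomial in the coefficients of the [f j]. *)
Definition chiz : {poly R} :=
  let D := size boxl in
  let C := cmx D Pz in
  \det C *: 'X^D
  - \sum_(m : 'X_{1..k < D.+1} | (m : 'X_{1..k}) \in boxl)
      (coefv D (linz ^+ D) *m \adj C) 0 (enum_rank m) *: 'X^(index (m : 'X_{1..k}) boxl).

Lemma PmD j m : Pm (m + U_(j) *+ (q j).+1) = f j * Pm m.
Proof.
rewrite /Pm (bigD1 j) //= [in RHS](bigD1 j) //= !mulrA; congr (_ * _).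
  rewrite mnmDE mulmnE mnm1E eqxx mul1n modnDr divnDr ?dvdnn // divnn /=.
  by rewrite addn1 exprS !mulrA; congr (_ * _); rewrite mulrC.
by apply: eq_bigr => i ij; rewrite mnmDE mulmnE mnm1E eq_sym (negPf ij) mul0n addn0.
Qed.

Lemma Pm_box m : m \in boxl -> Pm m = 'X_[m].
Proof.
rewrite mem_boxl => /forallP mq; rewrite mpolyXE_id; apply: eq_bigr => j _.
by rewrite modn_small ?ltnS // divn_small ?ltnS // expr0 mulr1.
Qed.

Lemma nonboxP m : m \notin boxl ->
  exists j m', m = (m' + U_(j) *+ (q j).+1)%MM.
Proof.
rewrite mem_boxl negb_forall => /existsP[j]; rewrite -ltnNge => qj.
exists j, (m - U_(j) *+ (q j).+1)%MM; rewrite submK //; apply/mnm_lepP => i.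
by rewrite mulmnE mnm1E; case: eqP => [<-|]; rewrite ?mul1n ?mul0n.
Qed.

End Defs.

Section Maps.
Variables (k : nat) (q : 'I_k -> bool) (R S : comNzRingType) (h : {rmorphism R -> S}).
Variable f : 'I_k -> {mpoly R[k]}.
Let fh j := map_mpoly h (f j).

Lemma map_Pm m : map_mpoly h (Pm q f m) = Pm q fh m.
Proof.
rewrite /Pm rmorph_prod; apply: eq_bigr => j _.
by rewrite rmorphM !rmorphXn /= map_mpolyX.
Qed.

Lemma map_linz : map_mpoly h (linz k R) = linz k S.
Proof. by rewrite /linz rmorph_sum; apply: eq_bigr => j _; rewrite /= map_mpolyX. Qed.

Lemma map_Pz m : map_mpoly h (Pz q f m) = Pz q fh m.
Proof. by rewrite /Pz; case: ifP => _; rewrite ?map_Pm // rmorphXn /= map_linz. Qed.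

Lemma map_cmx e (P : 'X_{1..k} -> {mpoly R[k]}) (Q : 'X_{1..k} -> {mpoly S[k]}) :
  (forall m, map_mpoly h (P m) = Q m) ->
  map_mx h (cmx e P) = cmx e Q.
Proof. by move=> PQ; apply/matrixP => i j; rewrite !mxE -PQ mcoeff_map_mpoly. Qed.

Lemma map_coefv e (p : {mpoly R[k]}) : map_mx h (coefv e p) = coefv e (map_mpoly h p).
Proof. by apply/rowP => j; rewrite !mxE mcoeff_map_mpoly. Qed.

Lemma map_chiz : map_poly h (chiz q f) = chiz q fh.
Proof.
rewrite /chiz rmorphB /= map_polyZ /= map_polyXn -det_map_mx.
rewrite (map_cmx _ (fun m => map_Pz m)); congr (_ - _).
rewrite rmorph_sum; apply: eq_bigr => m _ /=.
rewrite map_polyZ /= map_polyXn; congr (_ *: _).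
transitivity (map_mx h (coefv (size (boxl q)) (linz k R ^+ size (boxl q)) *m
  \adj (cmx (size (boxl q)) (Pz q f))) 0 (enum_rank m)); first by rewrite [RHS]mxE.
rewrite map_mxM /= map_mx_adj (map_cmx _ (fun m => map_Pz m)) map_coefv.
by rewrite rmorphXn /= map_linz.
Qed.

(** The Sylvester matrix keeps its shape only when [h] preserves both degrees, hence the conditions
    on the leading coefficients. *)
Lemma map_resultantW (p r : {poly R}) : h (lead_coef p) != 0 -> h (lead_coef r) != 0 ->
  h (resultant p r) = resultant (map_poly h p) (map_poly h r).
Proof.
move=> nz_p nz_r; rewrite /resultant /Sylvester_mx !size_map_poly_id0 //.
rewrite -det_map_mx /= map_col_mx; congr (\det (col_mx _ _));
  by apply: map_lin1_mx => v; rewrite map_poly_rV rmorphM /= map_rVpoly.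
Qed.

End Maps.

Lemma msizeM_leD (R : comNzRingType) (k a b : nat) (p r : {mpoly R[k]}) :
  (msize p <= a.+1 -> msize r <= b.+1 -> msize (p * r) <= (a + b).+1)%N.
Proof.
have [->|p0] := eqVneq p 0; first by rewrite mul0r msize0.
have [->|r0] := eqVneq r 0; first by rewrite mulr0 msize0.
have [->|pr0] := eqVneq (p * r) 0; first by rewrite msize0.
rewrite -!mlead_deg // !ltnS => pa rb.
by apply: leq_trans (lemc_mdeg (mleadM_le p r)) _; rewrite mdegD leq_add.
Qed.

Lemma mcoeffMX_out (R : comNzRingType) k (p : {mpoly R[k]}) u m :
  ~~ (u <= m)%MM -> (p * 'X_[u])@_m = 0.
Proof.
move=> um; rewrite [p]mpolyE mulr_suml raddf_sum big1 //= => l _.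
rewrite -scalerAl mcoeffZ -mpolyXD mcoeffX; case: eqP => [E|]; last by rewrite mulr0.
by rewrite -E lem_addl in um.
Qed.

Section Fixed.
Variables (k : nat) (q : 'I_k -> bool) (K : fieldType).
Variable f : 'I_k -> {mpoly K[k]}.
Hypothesis fdeg : forall j, (msize (f j) <= (q j).+2)%N.
Implicit Types (p r : {mpoly K[k]}).

Local Notation P := (Pm q f).
Local Notation d j := (q j).+1.

Lemma msize_expr_le p a i : (msize p <= a.+1)%N -> (msize (p ^+ i) <= (a * i).+1)%N.
Proof.
move=> pa; elim: i => [|i IH]; first by rewrite expr0 msize1.
by rewrite exprS mulnS; apply: msizeM_leD.
Qed.

Lemma msize_Pm m : (msize (P m) <= (mdeg m).+1)%N.
Proof.
rewrite /Pm mdegE; elim/big_rec2: _ => [|j a p _ pa]; first by rewrite msize1.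
apply: msizeM_leD => //; rewrite [X in (_ <= X.+1)%N](divn_eq (m j) (q j).+1) addnC.
apply: msizeM_leD; last by rewrite mulnC; apply: msize_expr_le.
by rewrite -[X in (_ <= X.+1)%N]mul1n; apply: msize_expr_le; rewrite msizeX mdeg1.
Qed.

Lemma mul_Theta j r : f j * Theta P r = Theta P (r * 'X_[U_(j) *+ d j]).
Proof.
rewrite [r in RHS]mpolyE mulr_suml linear_sum /= {1}/Theta mulr_sumr.
by apply: eq_bigr => m _; rewrite -scalerAl -mpolyXD linearZ /= ThetaX PmD scalerAr.
Qed.

(** The bound on the degree of the preimage is the point: it forbids cancellation among the leading
    forms of the [f j], which a common zero at infinity would cause. *)
Definition Sp e p := exists2 r, (msize r <= e.+1)%N & p = Theta P r.

Lemma Sp0 e : Sp e 0.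
Proof. by exists 0; rewrite ?msize0 ?linear0. Qed.

Lemma SpD e p p' : Sp e p -> Sp e p' -> Sp e (p + p').
Proof.
move=> [r re ->] [r' re' ->]; exists (r + r'); last by rewrite linearD.
by apply: leq_trans (msizeD_le _ _) _; rewrite geq_max re.
Qed.

Lemma SpZ e c p : Sp e p -> Sp e (c *: p).
Proof.
move=> [r re ->]; exists (c *: r); last by rewrite linearZ.
exact: leq_trans (msizeZ_le _ _) re.
Qed.

Lemma Sp_sum e (I : eqType) (s : seq I) (F : I -> {mpoly K[k]}) :
  (forall i, i \in s -> Sp e (F i)) -> Sp e (\sum_(i <- s) F i).
Proof.
move=> SF; rewrite big_seq; elim/big_ind: _ => //; [exact: Sp0 | exact: SpD].
Qed.

Lemma Sp_le e e' p : (e <= e')%N -> Sp e p -> Sp e' p.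
Proof. by move=> ee [r re ->]; exists r => //; apply: leq_trans re _. Qed.

Lemma Sp_mulf e j p : Sp e p -> Sp (e + d j) (f j * p).
Proof.
move=> [r re ->]; exists (r * 'X_[U_(j) *+ d j]); last by rewrite mul_Theta.
by apply: msizeM_leD => //; rewrite msizeX mdegMn mdeg1 mul1n.
Qed.

Lemma Sp_monom e : (forall m, (mdeg m <= e)%N -> Sp e 'X_[m]) ->
  forall p, (msize p <= e.+1)%N -> Sp e p.
Proof.
move=> SX p pe; rewrite [p]mpolyE; apply: Sp_sum => m /msize_mdeg_lt mp.
by apply: SpZ; apply: SX; rewrite -ltnS; apply: leq_trans mp _.
Qed.

(* Every monomial of degree above [k.+1] factors through one of degree [k.+1], hence finitely many determinants control all degrees. *)
Lemma Sp_all_det : (forall e, (e <= k.+1)%N -> \det (cmx e P) != 0) ->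
  forall e p, (msize p <= e.+1)%N -> Sp e p.
Proof.
move=> Cn; elim/ltn_ind => e IH; have [ek|ke] := leqP e k.+1.
  move=> p pe; apply: Theta_surj (Cn _ ek) _ pe => m me.
  by apply: leq_trans (msize_Pm m) _.
apply: Sp_monom => m; rewrite leq_eqVlt => /orP[/eqP me|me]; last first.
  apply: (@Sp_le e.-1); first exact: leq_pred.
  by apply: IH; [case: (e) ke|rewrite msizeX prednK //; case: (e) ke].
have [u um ud] : exists2 u : 'X_{1..k}, (u <= m)%MM & mdeg u = k.+1.
  suff : forall i, (i <= mdeg m)%N -> exists2 u : 'X_{1..k}, (u <= m)%MM & mdeg u = i.
    by apply; rewrite me ltnW.
  elim=> [_|i IHi im]; first by exists 0%MM; rewrite ?mdeg0 //; apply/mnm_lepP => j; rewrite mnm0E.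
  have [u um ui] := IHi (ltnW im).
  have : exists j, (u j < m j)%N.
    apply/existsP; apply: contraLR im; rewrite negb_exists -leqNgt => /forallP mu.
    by rewrite -ui !mdegE; apply: leq_sum => j _; rewrite leqNgt mu.
  case=> j uj; exists (u + U_(j))%MM; last by rewrite mdegD mdeg1 ui addn1.
  apply/mnm_lepP => l; rewrite mnmDE mnm1E; case: eqP => [<-|_]; rewrite ?addn1 // addn0.
  exact: (mnm_lepP um).
rewrite -(submK um) mpolyXD; set v := (m - u)%MM.
have vd : mdeg v = (e - k.+1)%N.
  by rewrite -me -(submK um) mdegD ud addnK.
have [r rk ->] : Sp k.+1 'X_[u].
  apply: Theta_surj (Cn _ (leqnn _)) _ _ => [l lk|]; last by rewrite msizeX ud.
  exact: leq_trans (msize_Pm l) _.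
rewrite /Theta mulr_sumr; apply: Sp_sum => l /msize_mdeg_lt lr.
have {lr} : (mdeg l <= k.+1)%N by rewrite -ltnS; apply: leq_trans lr _.
rewrite -scalerAr leq_eqVlt => /orP[/eqP lk|lk]; apply: SpZ; last first.
  apply: (@Sp_le (mdeg v + mdeg l)); first by rewrite vd; lia.
  by apply: IH; [rewrite vd; lia | apply: msizeM_leD; rewrite ?msizeX ?msize_Pm].
(* Box exponents are at most one, so a box monomial has degree at most [k]. *)
have lbox : l \notin boxl q.
  rewrite mem_boxl; apply/negP => /forallP lq; move: lk; rewrite mdegE => lk.
  have : (\sum_i l i <= \sum_(i < k) 1)%N.
    by apply: leq_sum => i _; apply: leq_trans (lq i) _; case: (q i).
  by rewrite lk sum1_card card_ord ltnn.
have [j [l' E]] := nonboxP lbox.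
rewrite E PmD mulrCA; apply: (@Sp_le (mdeg v + mdeg l' + d j)).
  have := congr1 mdeg E; rewrite lk mdegD mdegMn mdeg1 mul1n vd; lia.
apply: Sp_mulf; apply: IH.
  have := congr1 mdeg E; rewrite lk mdegD mdegMn mdeg1 mul1n vd; lia.
by apply: msizeM_leD; rewrite ?msizeX ?msize_Pm.
Qed.

(* The hypothesis says that the leading forms of the [f j] generate the ['X_j ^+ d j]. *)
Lemma Sp_all_lead :
  (forall j, exists2 g : 'I_k -> {mpoly K[k]},
     forall i, (msize (g i) + q i <= (q j).+1)%N
     & (msize ('X_j ^+ d j - \sum_i g i * f i) <= d j)%N) ->
  forall e p, (msize p <= e.+1)%N -> Sp e p.
Proof.
move=> H; elim/ltn_ind => e IH; apply: Sp_monom => m me.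
have [mb|mb] := boolP (m \in boxl q).
  by exists 'X_[m]; rewrite ?msizeX // ThetaX Pm_box.
have [j [u E]] := nonboxP mb; have [g gd lowd] := H j.
have ud : mdeg m = (mdeg u + d j)%N by rewrite E mdegD mdegMn mdeg1 mul1n.
rewrite E mpolyXD -mpolyXn -[X in _ * X](subrK (\sum_i g i * f i)) mulrDr; apply: SpD.
  apply: (@Sp_le (mdeg u + q j)); first by lia.
  by apply: IH; [lia | apply: msizeM_leD => //; rewrite msizeX].
rewrite mulr_sumr; apply: Sp_sum => i _; have [->|gi0] := eqVneq (g i) 0.
  by rewrite mul0r mulr0; apply: Sp0.
have : (0 < msize (g i))%N by rewrite lt0n msize_poly_eq0.
move: (gd i) => gi gp; rewrite mulrA mulrC.
apply: (@Sp_le (mdeg u + (msize (g i)).-1 + d i)); first by lia.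
apply: Sp_mulf; apply: IH; first by lia.
by apply: msizeM_leD; rewrite ?msizeX // prednK.
Qed.

Definition inI p := exists g : 'I_k -> {mpoly K[k]}, p = \sum_j g j * f j.

Lemma inI0 : inI 0.
Proof. by exists (fun=> 0); rewrite big1 // => j _; rewrite mul0r. Qed.
Lemma inID p p' : inI p -> inI p' -> inI (p + p').
Proof.
move=> [g ->] [g' ->]; exists (fun j => g j + g' j); rewrite -big_split /=.
by apply: eq_bigr => j _; rewrite mulrDl.
Qed.
Lemma inIM r p : inI p -> inI (r * p).
Proof.
move=> [g ->]; exists (fun j => r * g j); rewrite mulr_sumr.
by apply: eq_bigr => j _; rewrite mulrA.
Qed.
Lemma inIZ c p : inI p -> inI (c *: p).
Proof. by rewrite -mul_mpolyC; apply: inIM. Qed.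
Lemma inIB p p' : inI p -> inI p' -> inI (p - p').
Proof. by move=> Ip Ip'; apply: inID => //; rewrite -mulN1r; apply: inIM. Qed.
Lemma inIf j : inI (f j).
Proof.
exists (fun i => (i == j)%:R); rewrite (bigD1 j) //= eqxx mul1r big1 ?addr0 // => i ij.
by rewrite (negPf ij) mul0r.
Qed.
Lemma inI_sum (I : Type) (s : seq I) (Q : pred I) (F : I -> {mpoly K[k]}) :
  (forall i, Q i -> inI (F i)) -> inI (\sum_(i <- s | Q i) F i).
Proof. by move=> IF; elim/big_ind: _ => //; [exact: inI0 | exact: inID]. Qed.

Lemma inI_nonbox m : m \notin boxl q -> inI (P m).
Proof. by move=> /nonboxP[j [u ->]]; rewrite PmD mulrC; apply: inIM; apply: inIf. Qed.

Lemma inI_eval p y : inI p -> (forall j, (f j).@[y] = 0) -> p.@[y] = 0.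
Proof.
by move=> [g ->] fy; rewrite raddf_sum big1 // => j _ /=; rewrite mevalM fy mulr0.
Qed.

Hypothesis Sp_all : forall e p, (msize p <= e.+1)%N -> Sp e p.

Lemma det_cmx e : \det (cmx e P) != 0.
Proof. by apply: cmx_surj => p pe; apply: Sp_all. Qed.

Lemma Theta0 r : Theta P r = 0 -> r = 0.
Proof. by apply: (Theta_inj (det_cmx (msize r))); apply: leqnSn. Qed.

(** Multiplication by [f j] corresponds under [Theta] to multiplication by the [d j]-th power of
    ['X_j], and multiples of that power lie outside the box. *)
Lemma inI_Theta p : inI p -> exists2 r, p = Theta P r & forall m, m \in boxl q -> r@_m = 0.
Proof.
move=> [g ->]; elim/big_rec: _ => [|j p' _ [r -> rb]].
  by exists 0; rewrite ?linear0 // => m _; rewrite mcoeff0.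
have [s _ gs] := @Sp_all (msize (g j)) (g j) (leqnSn _).
exists (s * 'X_[U_(j) *+ d j] + r); first by rewrite linearD /= -mul_Theta -gs mulrC.
move=> m mb; rewrite mcoeffD rb // addr0 mcoeffMX_out //.
apply/negP => /mnm_lepP/(_ j); rewrite mulmnE mnm1E eqxx mul1n.
by move: mb; rewrite mem_boxl => /forallP/(_ j); rewrite ltnNge => ->.
Qed.

(** Since [Theta] is injective, the preimage without box monomials and the preimage of bounded
    degree are the same polynomial. *)
Lemma inI_Theta_le e p : (msize p <= e.+1)%N -> inI p ->
  exists2 r, p = Theta P r & (msize r <= e.+1)%N /\ forall m, m \in boxl q -> r@_m = 0.
Proof.
move=> pe /inI_Theta[r pr rb]; have [s se ps] := Sp_all pe.
have E : r = s by apply/subr0_eq/Theta0; rewrite linearB /= -pr -ps subrr.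
by exists r => //; split=> //; rewrite E.
Qed.

(* A form of degree [k.+1] is a combination of the [P m] outside the box, each of which has a factor [f j]. *)
Lemma top_zero (y : 'I_k -> K) :
  (forall j, size (mmap (@polyC K) (fun i => y i *: 'X) (f j)) <= d j)%N ->
  forall i, y i = 0.
Proof.
(* [phi] restricts to the line through the origin in the direction [y]; the hypothesis on sizes says
   that the part of degree [d j] of [f j] vanishes at [y]. *)
move=> fy i; pose phi : {rmorphism {mpoly K[k]} -> {poly K}} := mmap (@polyC K) (fun i => y i *: 'X).
have size_phi p : (size (phi p) <= msize p)%N.
  apply: leq_trans (size_sum _ _ _) _; apply/bigmax_leqP_seq => m mp _.
  rewrite mul_polyC; apply: leq_trans (size_scale_leq _ _) _.
  apply: leq_trans (msize_mdeg_lt mp); rewrite /mmap1 mdegE.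
  elim/big_rec2: _ => [|j a r _ ra]; first by rewrite size_poly1.
  apply: leq_trans (size_polyMleq _ _) _; rewrite exprZn.
  have : (size (y j ^+ m j *: 'X ^+ m j) <= (m j).+1)%N.
    by apply: leq_trans (size_scale_leq _ _) _; rewrite size_polyXn.
  by move: ra; move: (size _) (size _) => s1 s2; lia.
have Xk : (msize ('X_i ^+ k.+1 : {mpoly K[k]}) <= k.+2)%N.
  by rewrite mpolyXn msizeX mdegMn mdeg1 mul1n.
have [r rk E] := Sp_all Xk.
have phiX : phi ('X_i ^+ k.+1) = y i ^+ k.+1 *: 'X^(k.+1).
  by rewrite rmorphXn /= mmapX mmap1U exprZn.
suff : (size (phi ('X_i ^+ k.+1)) <= k.+1)%N.
  rewrite phiX; have [//|yi] := eqVneq (y i) 0.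
  by rewrite size_scale ?expf_neq0 // size_polyXn ltnn.
rewrite E /Theta raddf_sum; apply: leq_trans (size_sum _ _ _) _.
apply/bigmax_leqP_seq => m mr _ /=.
have mk : (mdeg m <= k.+1)%N by rewrite -ltnS; apply: leq_trans (msize_mdeg_lt mr) rk.
rewrite mmapZ mul_polyC; apply: leq_trans (size_scale_leq _ _) _.
move: mk; rewrite leq_eqVlt => /orP[/eqP mk|mk]; last first.
  by apply: leq_trans (size_phi _) _; apply: leq_trans (msize_Pm _) _.
have mb : m \notin boxl q.
  rewrite mem_boxl; apply/negP => /forallP mq; move: mk; rewrite mdegE => mk.
  have : (\sum_i m i <= \sum_(i < k) 1)%N.
    by apply: leq_sum => j _; apply: leq_trans (mq j) _; case: (q j).
  by rewrite mk sum1_card card_ord ltnn.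
have [j [u U]] := nonboxP mb.
rewrite U PmD (rmorphM phi); apply: leq_trans (size_polyMleq _ _) _.
have := congr1 mdeg U; rewrite mk mdegD mdegMn mdeg1 mul1n.
have := leq_trans (size_phi _) (msize_Pm u); have := fy j; rewrite -/(phi (f j)).
by move: (size _) (size _) => s1 s2; lia.
Qed.

End Fixed.

(** * Shape lemma: the unknowns as polynomials in their sum *)

Section Shape.
Variables (k : nat) (q : 'I_k -> bool) (K : fieldType).
Variable f : 'I_k -> {mpoly K[k]}.
Hypothesis fdeg : forall j, (msize (f j) <= (q j).+2)%N.
Hypothesis Sp_all : forall e p, (msize p <= e.+1)%N -> Sp q f e p.
Implicit Types (p r : {mpoly K[k]}).
Local Notation P := (Pm q f).
Local Notation Q := (Pz q f).
Local Notation D := (size (boxl q)).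
Local Notation z := (linz k K).
Local Notation inI := (inI f).

Lemma msize_linz : (msize z <= 2)%N.
Proof. by apply: msize_sum_le => j _; rewrite msizeX mdeg1. Qed.

Lemma msize_Pz m : (mdeg m <= D)%N -> (msize (Q m) <= D.+1)%N.
Proof.
move=> mD; rewrite /Pz; case: ifP => mb; last exact: leq_trans (msize_Pm fdeg m) _.
apply: leq_trans (msize_expr_le _ msize_linz) _; rewrite mul1n ltnS ltnW //.
by rewrite index_mem.
Qed.

Lemma nonbox_eq (r : {mpoly K[k]}) : (forall m, m \in boxl q -> r@_m = 0) ->
  Theta Q r = Theta P r.
Proof.
move=> rb; rewrite /Theta; apply: eq_bigr => m _; rewrite /Pz; case: ifP => // /rb ->.
by rewrite !scale0r.
Qed.

Local Notation "c %z" := (horner_alg z c) (at level 2, format "c %z").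

Lemma horner_algZ a (c : {poly K}) : (a *: c)%z = a *: c%z.
Proof. by rewrite linearZ /= mulr_algl. Qed.

Lemma horner_algE c : c%z = \sum_(i < size c) c`_i *: z ^+ i.
Proof.
rewrite -{1}(coefK c) poly_def raddf_sum /=; apply: eq_bigr => i _.
by rewrite horner_algZ rmorphXn /= horner_algX.
Qed.
Hypothesis detQ : \det (cmx D Q) != 0.

Lemma shape_span p : (msize p <= D.+1)%N ->
  exists2 c : {poly K}, (size c <= D)%N & inI (p - c%z).
Proof.
move=> pD; have [r rD ->] := Theta_surj msize_Pz detQ pD.
exists (\sum_(m : 'X_{1..k < D.+1} | (m : 'X_{1..k}) \in boxl q) r@_m *: 'X^(index (m : 'X_{1..k}) (boxl q))).
  apply: leq_trans (size_sum _ _ _) _; apply/bigmax_leqP => m mb.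
  by apply: leq_trans (size_scale_leq _ _) _; rewrite size_polyXn index_mem.
rewrite (ThetaE _ rD) (bigID (fun m : 'X_{1..k < D.+1} => (m : 'X_{1..k}) \in boxl q)) /=.
rewrite addrAC raddf_sum -sumrB big1 ?add0r => [|m mb].
  by apply: inI_sum => m mb; apply: inIZ; rewrite /Pz (negPf mb); apply: inI_nonbox.
by rewrite /Pz mb /= horner_algZ rmorphXn /= horner_algX subrr.
Qed.

(** [c%z] is [Theta Q] of a combination of box monomials and, lying in the ideal, also of a
    polynomial without box monomials. As [Theta Q] is injective up to degree [D], the two coincide,
    so the box coefficients are zero. *)
Lemma shape_free (c : {poly K}) : (size c <= D)%N -> inI (c%z) -> c = 0.
Proof.
move=> cD Ic; have cz : (msize (c%z) <= D.+1)%N.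
  rewrite horner_algE; apply: msize_sum_le => i _; apply: leq_trans (msizeZ_le _ _) _.
  apply: leq_trans (msize_expr_le _ msize_linz) _; rewrite mul1n ltnS ltnW //.
  exact: leq_trans (ltn_ord i) cD.
have [s sE [sD sb]] := inI_Theta_le Sp_all cz Ic.
pose r := \sum_(i < size c) c`_i *: 'X_[nth 0%MM (boxl q) i] - s.
have rb m : m \in boxl q -> r@_m = c`_(index m (boxl q)).
  move=> mb; rewrite mcoeffB sb // subr0 raddf_sum /=.
  have [ic|ic] := ltnP (index m (boxl q)) (size c).
    rewrite (bigD1 (Ordinal ic)) //= mcoeffZ mcoeffX nth_index // eqxx mulr1.
    rewrite big1 ?addr0 // => i; rewrite -val_eqE /= => ii.
    rewrite mcoeffZ mcoeffX; case: eqP => [E|]; last by rewrite mulr0.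
    by move: ii; rewrite -E index_uniq ?boxl_uniq ?eqxx // (leq_trans _ cD).
  rewrite nth_default // big1 // => i _; rewrite mcoeffZ mcoeffX; case: eqP => [E|]; last by rewrite mulr0.
  move: ic; rewrite -E index_uniq ?boxl_uniq // ?(leq_trans _ cD) //.
  by rewrite leqNgt ltn_ord.
suff r0 : r = 0.
  apply/polyP => i; rewrite coef0; have [iD|Di] := ltnP i D; last first.
    by rewrite nth_default // (leq_trans cD).
  by rewrite -(index_uniq 0%MM iD (boxl_uniq q)) -rb ?mem_nth // r0 mcoeff0.
apply: (Theta_inj detQ).
  apply: leq_trans (msizeD_le _ _) _; rewrite geq_max msizeN sD andbT.
  apply: msize_sum_le => i _; apply: leq_trans (msizeZ_le _ _) _; rewrite msizeX ltnS.
  by apply/mdeg_boxl/mem_nth/(leq_trans (ltn_ord i) cD).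
rewrite linearB /= (nonbox_eq sb) -sE; apply/eqP; rewrite subr_eq0 horner_algE raddf_sum /=.
apply/eqP/eq_bigr => i _; have iD : (i < D)%N by apply: leq_trans (ltn_ord i) cD.
by rewrite linearZ /= ThetaX /Pz mem_nth // index_uniq ?boxl_uniq.
Qed.

Local Notation chi := (chiz q f).

Lemma chi_coef : [/\ (size (chi - \det (cmx D Q) *: 'X^D)%R <= D)%N, size chi = D.+1 & lead_coef chi = \det (cmx D Q)].
Proof.
set c := _ *: _; have sc : size c = D.+1 by rewrite size_scale // size_polyXn.
have low : (size (chi - c)%R <= D)%N.
  rewrite /chiz -/c addrC addKr size_polyN.
  apply: leq_trans (size_sum _ _ _) _; apply/bigmax_leqP => m mb.
  by apply: leq_trans (size_scale_leq _ _) _; rewrite size_polyXn index_mem.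
have E : chi = c + (chi - c) by rewrite addrC subrK.
split; [by [] | by rewrite E size_polyDl ?sc | rewrite E lead_coefDl ?sc //].
by rewrite /c lead_coefZ lead_coefXn mulr1.
Qed.

(** Cramer's rule expands [\det C *: z ^+ D] in the [Q m]. The box terms of this expansion are
    powers of [z], which [chi] subtracts; the remaining [Q m] are [P m] outside the box and lie in
    the ideal. *)
Lemma inI_chi : inI (chi%z).
Proof.
rewrite /chiz; set ct := coefv _ _ *m _.
have [r rD rE] := coefvK ct.
have E : \det (cmx D Q) *: z ^+ D = Theta Q r.
  apply: (@coefv_inj _ _ D).
  - apply: leq_trans (msizeZ_le _ _) _; apply: leq_trans (msize_expr_le _ msize_linz) _.
    by rewrite mul1n.
  - rewrite (ThetaE _ rD); apply: msize_sum_le => m _; apply: leq_trans (msizeZ_le _ _) _.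
    by rewrite msize_Pz // -ltnS bmdeg.
  rewrite coefv_Theta // rE /ct -mulmxA mul_adj_mx mul_mx_scalar.
  by apply/rowP => j; rewrite !mxE mcoeffZ.
rewrite rmorphB /= horner_algZ rmorphXn /= horner_algX E (ThetaE _ rD) raddf_sum /=.
rewrite (bigID (fun m : 'X_{1..k < D.+1} => (m : 'X_{1..k}) \in boxl q)) /= addrAC -sumrB big1 ?add0r => [|m mb].
  by apply: inI_sum => m mb; apply: inIZ; rewrite /Pz (negPf mb); apply: inI_nonbox.
rewrite /= horner_algZ rmorphXn /= horner_algX /Pz mb -scalerBl -rE mxE enum_rankK subrr.
by rewrite scale0r.
Qed.

Lemma inI_dvd (c : {poly K}) : inI (c%z) -> chi %| c.
Proof.
move=> Ic; have [_ sc _] := chi_coef.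
have chi0 : chi != 0 by rewrite -size_poly_eq0 sc.
rewrite /dvdp; apply/eqP; apply: shape_free.
  by rewrite -ltnS -sc ltn_modp.
have -> : c %% chi = c - c %/ chi * chi by rewrite {2}(divp_eq c chi) addrC addKr.
by rewrite rmorphB rmorphM; apply: inIB => //; apply: inIM; apply: inI_chi.
Qed.

Lemma meval_horner_alg (c : {poly K}) y : (c%z).@[y] = c.[\sum_j y j].
Proof.
rewrite horner_algE raddf_sum horner_coef; apply: eq_bigr => i _ /=.
rewrite mevalZ rmorphXn /=; congr (_ * _ ^+ _).
by rewrite /linz raddf_sum; apply: eq_bigr => j _ /=; rewrite mevalXU.
Qed.

Lemma zero_root y : (forall j, (f j).@[y] = 0) -> root chi (\sum_j y j).
Proof. by move=> fy; rewrite /root -meval_horner_alg (inI_eval inI_chi). Qed.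

(** Modulo the ideal each unknown is a polynomial [r i] in the sum of the unknowns, and a polynomial
    in this sum lies in the ideal only if [chi] divides it. Thus substituting [r] turns membership
    in the ideal into vanishing at the roots of [chi]. *)
Lemma shape_coords : exists r : 'I_k -> {poly K},
  [/\ forall x, root chi x -> forall j, (f j).@[fun i => (r i).[x]] = 0,
      forall x, root chi x -> \sum_i (r i).[x] = x
    & forall y, (forall j, (f j).@[y] = 0) -> forall i, y i = (r i).[\sum_j y j]].
Proof.
have D0 := size_boxl_gt0 q.
have /fin_all_exists2[r _ rI] (i : 'I_k) : exists2 c : {poly K}, (size c <= D)%N & inI ('X_i - c%z).
  by apply: shape_span; rewrite msizeX mdeg1.
exists r; pose phi : {rmorphism {mpoly K[k]} -> {poly K}} := mmap (@polyC K) r.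
have phiI p : inI (p - (phi p)%z).
  elim/mpolyind: p => [|c m p _ _ IH]; first by rewrite !rmorph0 subr0; apply: inI0.
  have X : inI ('X_[m] - (phi 'X_[m])%z).
    rewrite mpolyXE_id; elim/big_rec: _ => [|j u _ uI].
      by rewrite !rmorph1 subrr; apply: inI0.
    have [a ->] : exists a, m j = a by exists (m j).
    elim: a => [|a IHa]; first by rewrite expr0 mul1r.
    rewrite exprS -mulrA rmorphM rmorphM /=; set v := _ * u.
    have -> : mmap (@polyC K) r 'X_j = r j by rewrite mmapX mmap1U.
    have -> : 'X_j * v - (r j)%z * (phi v)%z = v * ('X_j - (r j)%z) + (r j)%z * (v - (phi v)%z).
      by ring.
    by apply: inID; apply: inIM.
  rewrite !rmorphD /= opprD addrACA; apply: inID => //.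
  by rewrite mmapZ mul_polyC horner_algZ -scalerBr; apply: inIZ.
have phiE p x : (phi p).[x] = p.@[fun i => (r i).[x]].
  rewrite mevalE /phi /= /mmap horner_sum; apply: eq_bigr => m _.
  by rewrite hornerM hornerC horner_prod; congr (_ * _); apply: eq_bigr => j _; rewrite horner_exp.
have root_phi (c : {poly K}) x : root chi x -> inI (c%z) -> c.[x] = 0.
  by move=> /eqP xr /inI_dvd/dvdpP[u ->]; rewrite hornerM xr mulr0.
split=> [x xr j|x xr|y fy i].
- rewrite -phiE; apply: (root_phi) xr _.
  by rewrite -[X in inI X](subKr (f j)); apply: inIB; [apply: inIf|apply: phiI].
- have := root_phi (phi z - 'X) x xr; rewrite hornerD hornerN hornerX phiE => H.
  have -> : \sum_i (r i).[x] = z.@[fun i => (r i).[x]].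
    by rewrite /linz raddf_sum; apply: eq_bigr => j _ /=; rewrite mevalXU.
  apply/eqP; rewrite -subr_eq0; apply/eqP/H.
  rewrite rmorphB /= horner_algX -opprB -mulN1r; apply: inIM; exact: phiI.
- have := inI_eval (rI i) fy; rewrite mevalB mevalXU meval_horner_alg.
  by move/eqP; rewrite subr_eq0 => /eqP.
Qed.

End Shape.

(** * The special solutions *)

Lemma binary_inj k (b c : 'I_k -> bool) :
  (\sum_j b j * 2 ^ j = \sum_j c j * 2 ^ j)%N -> b =1 c.
Proof.
elim: k b c => [|k IH] b c; first by move=> _ [].
rewrite !big_ord_recl !expn0 !muln1.
have E (d : 'I_k.+1 -> bool) :
    (\sum_(i < k) d (lift ord0 i) * 2 ^ lift ord0 i = (\sum_(i < k) d (lift ord0 i) * 2 ^ i).*2)%N.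
  rewrite -muln2 big_distrl /=; apply: eq_bigr => i _.
  by rewrite /bump /= add1n expnSr mulnA.
rewrite !E => H; have b0 : b ord0 = c ord0.
  by have := congr1 odd H; rewrite !oddD !odd_double !addbF !oddb.
move=> j; case: (unliftP ord0 j) => [i ->|->] //.
apply: (IH (fun i => b (lift ord0 i)) (fun i => c (lift ord0 i))).
by apply: double_inj; move: H; rewrite b0 => /addnI.
Qed.

Section SpecialPoints.
Variables (k : nat) (q : 'I_k -> bool) (K : numFieldType).

(* The solutions of X_j^2 = 4^j for [q j] and X_j = 0 otherwise: the sum of the coordinates separates them. *)
Definition spt (s : {set 'I_k}) (j : 'I_k) : K :=
  if q j then (if j \in s then 2 ^+ j else - 2 ^+ j) else 0.

Lemma sum_spt_inj (s t : {set 'I_k}) : s \subset [set j | q j] -> t \subset [set j | q j] ->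
  \sum_j spt s j = \sum_j spt t j -> s = t.
Proof.
(* Writing the sign as 2 [j in u] - 1 turns the sum into twice a binary expansion minus a
   constant. *)
move=> sq tq; have E (u : {set 'I_k}) : u \subset [set j | q j] ->
    \sum_j spt u j = ((\sum_j (j \in u) * 2 ^ j)%N%:R) *+ 2 - \sum_(j | q j) 2 ^+ j.
  move=> /fintype.subsetP uq; rewrite natr_sum -sumrMnl [X in _ - X]big_mkcond -sumrB.
  apply: eq_bigr => j _; rewrite /spt natrM natrX; case: ifP => qj.
    by case: (j \in u); rewrite ?mul1r ?mul0r ?mul0rn ?sub0r // mulr2n addrK.
  case: (boolP (j \in u)) => [/uq|_]; first by rewrite inE qj.
  by rewrite mul0r mul0rn subrr.
rewrite !E // => /addIr/eqP; rewrite eqrMn2r // eqr_nat => /eqP/binary_inj st.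
by apply/setP.
Qed.

Definition spts : seq K := [seq \sum_j spt s j | s : {set 'I_k} <- enum (powerset [set j | q j])].

Lemma spts_uniq : uniq spts.
Proof.
rewrite map_inj_in_uniq ?enum_uniq // => s t.
by rewrite !mem_enum !powersetE; apply: sum_spt_inj.
Qed.

Lemma size_spts : size spts = size (boxl q).
Proof. by rewrite !size_map. Qed.

Variable f : 'I_k -> {mpoly K[k]}.
Hypothesis fdeg : forall j, (msize (f j) <= (q j).+2)%N.
Hypothesis Sp_all : forall e p, (msize p <= e.+1)%N -> Sp q f e p.
Hypothesis f_spt : forall (s : {set 'I_k}) j, (f j).@[spt s] = 0.

(** If [Theta Q r = 0], the box part of [r] yields a polynomial of degree below [D] that vanishes at
    the [D] distinct sums of coordinates of the special points, so it is zero. Then [Q] may be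
    replaced by [P], whose [Theta] is injective. *)
Lemma spt_det : \det (cmx (size (boxl q)) (Pz q f)) != 0.
Proof.
apply: cmx_inj; first exact: msize_Pz.
move=> r rD r0; apply: (Theta0 Sp_all); rewrite -nonbox_eq //.
pose c := \sum_(m : 'X_{1..k < (size (boxl q)).+1} | (m : 'X_{1..k}) \in boxl q)
  r@_m *: 'X^(index (m : 'X_{1..k}) (boxl q)).
suff c0 : c = 0.
  move=> m mb; have mD : (mdeg m < (size (boxl q)).+1)%N by rewrite ltnS mdeg_boxl.
  have : c`_(index m (boxl q)) = 0 by rewrite c0 coef0.
  rewrite coef_sum (bigD1 (BMultinom mD)) //= coefZ coefXn eqxx mulr1 big1 ?addr0 // => l /andP[lb lm].
  rewrite coefZ coefXn; case: eqP => [E|]; last by rewrite mulr0.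
  case/eqP: lm; apply: val_inj => /=.
  by rewrite -(nth_index 0%MM mb) E nth_index.
apply: (@roots_geq_poly_eq0 _ _ spts) spts_uniq _; last first.
  rewrite size_spts; apply: leq_trans (size_sum _ _ _) _; apply/bigmax_leqP => m mb.
  by apply: leq_trans (size_scale_leq _ _) _; rewrite size_polyXn index_mem.
apply/allP => _ /mapP[s _ ->]; apply/eqP; have := congr1 (meval (spt s)) r0.
rewrite meval0 (ThetaE _ rD) raddf_sum /= => H; rewrite -[RHS]H.
rewrite horner_sum big_mkcond; apply: eq_bigr => m _ /=.
rewrite mevalZ; case: ifPn => mb; last first.
  rewrite /Pz (negPf mb) (inI_eval _ (f_spt s)) ?mulr0 //; exact: inI_nonbox.
rewrite hornerZ hornerXn /Pz mb rmorphXn /=; congr (_ * _ ^+ _).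
by rewrite /linz raddf_sum; apply: eq_bigr => j _; rewrite /= mevalXU.
Qed.

Lemma spt_separable : separable_poly (chiz q f).
Proof.
have [_ sc lc] := chi_coef spt_det.
rewrite (@all_roots_prod_XsubC _ (chiz q f) spts) ?size_spts ?uniq_rootsE ?spts_uniq ?sc //.
  by rewrite (eqp_separable (eqp_scale _ _)) ?separable_prod_XsubC ?spts_uniq // lc spt_det.
by apply/allP => _ /mapP[s _ ->]; apply: zero_root => //; apply: spt_det.
Qed.

End SpecialPoints.

Lemma chiz_top k (q : 'I_k -> bool) (R : comNzRingType) (f : 'I_k -> {mpoly R[k]}) :
  (size (chiz q f) <= (size (boxl q)).+1)%N /\
  (chiz q f)`_(size (boxl q)) = \det (cmx (size (boxl q)) (Pz q f)).
Proof.
rewrite /chiz; set D := size (boxl q); set s := \sum_(_ | _) _.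
have sD : (size s <= D)%N.
  apply: leq_trans (size_sum _ _ _) _; apply/bigmax_leqP => m mb.
  by apply: leq_trans (size_scale_leq _ _) _; rewrite size_polyXn index_mem.
split; last by rewrite coefB coefZ coefXn eqxx mulr1 [s`_D]nth_default ?subr0.
apply: leq_trans (size_polyD _ _) _; rewrite geq_max size_polyN (leqW sD) andbT.
by apply: leq_trans (size_scale_leq _ _) _; rewrite size_polyXn.
Qed.

(** * Systems with parameters *)

Section Generic.
Variables (k : nat) (q : 'I_k -> bool) (K : numClosedFieldType) (R : comNzRingType).
Variable f : 'I_k -> {mpoly R[k]}.
Variable h0 : {rmorphism R -> K}.
Local Notation fh h := (fun j => map_mpoly h (f j)).
Hypothesis fdeg : forall j, (msize (f j) <= (q j).+2)%N.
Hypothesis f_lead : forall j, exists2 g : 'I_k -> {mpoly K[k]},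
     forall i, (msize (g i) + q i <= (q j).+1)%N
     & (msize ('X_j ^+ (q j).+1 - \sum_i g i * fh h0 i) <= (q j).+1)%N.
Hypothesis f_spt : forall (s : {set 'I_k}) j, mmap h0 (spt q K s) (f j) = 0.

Lemma meval_map (h : {rmorphism R -> K}) (p : {mpoly R[k]}) y :
  (map_mpoly h p).@[y] = mmap h y p.
Proof.
elim/mpolyind: p => [|c m p _ _ IH]; first by rewrite !raddf0.
by rewrite !rmorphD /= IH map_mpolyZ map_mpolyX mevalZ mmapZ mmapX mevalX.
Qed.

Lemma mmap_map (h : {rmorphism R -> K}) (p : {mpoly R[k]}) (y : 'I_k -> {poly K}) :
  mmap (@polyC K) y (map_mpoly h p) = mmap (@polyC K \o h) y p.
Proof.
elim/mpolyind: p => [|c m p _ _ IH]; first by rewrite !raddf0.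
by rewrite !rmorphD /= IH map_mpolyZ map_mpolyX !mmapZ !mmapX.
Qed.

Lemma msize_map (h : {rmorphism R -> K}) (p : {mpoly R[k]}) e :
  (msize p <= e)%N -> (msize (map_mpoly h p) <= e)%N.
Proof.
move=> pe; rewrite msizeE; apply/bigmax_leqP_seq => m mp _.
have : m \in msupp p by apply: contraLR mp; rewrite -!mcoeff_eq0 mcoeff_map_mpoly => /eqP->; rewrite raddf0.
by move/msize_mdeg_lt => /leq_trans; apply.
Qed.

(* [h0] specializes the parameters to a system with the solutions [spt]. *)
Theorem generic_bezout : exists2 G : R, h0 G != 0 &
  forall h : {rmorphism R -> K}, h G != 0 ->
    (exists2 S : seq {ffun 'I_k -> K},
       uniq S /\ size S = (2 ^ #|[set j | q j]|)%N
       & forall y, y \in S <-> forall j, mmap h y (f j) = 0)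
    /\ (forall y : 'I_k -> K,
        (forall j, size (mmap (@polyC K \o h) (fun i => y i *: 'X) (f j)) <= (q j).+1)%N ->
        forall i, y i = 0).
Proof.
have deg (h : {rmorphism R -> K}) j : (msize (fh h j) <= (q j).+2)%N by apply: msize_map.
have Sp0 := Sp_all_lead f_lead.
have spt0 (s : {set 'I_k}) j : (fh h0 j).@[spt q K s] = 0 by rewrite meval_map.
pose D := size (boxl q).
pose dC e := \det (cmx e (Pm q f)).
pose dQ := \det (cmx D (Pz q f)).
pose chi := chiz q f.
have dCE (h : {rmorphism R -> K}) e : h (dC e) = \det (cmx e (Pm q (fh h))).
  by rewrite -det_map_mx (map_cmx (h := h) _ (fun m => map_Pm q h f m)).
have dQE (h : {rmorphism R -> K}) : h dQ = \det (cmx D (Pz q (fh h))).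
  by rewrite -det_map_mx (map_cmx (h := h) _ (fun m => map_Pz q h f m)).
have dQ0 : h0 dQ != 0 by rewrite dQE; apply: spt_det.
have hchi (h : {rmorphism R -> K}) : h dQ != 0 ->
    h (resultant chi chi^`()) = resultant (chiz q (fh h)) (chiz q (fh h))^`().
  move=> hQ; have [sD cD] := chiz_top q f; rewrite -/chi -/D -/dQ in sD cD.
  (* Over [R] the degrees are known only up to a bound; a coefficient at the bound with nonzero
     image must be the leading one. *)
  have lead (p : {poly R}) i : (size p <= i.+1)%N -> h p`_i != 0 -> lead_coef p = p`_i.
    move=> si hi; rewrite lead_coefE (_ : size p = i.+1) //; apply/eqP.
    rewrite eqn_leq si ltnNge; apply: contraNN hi => /leq_sizeP-> //.
    by rewrite rmorph0.
  rewrite map_resultantW; first by rewrite -deriv_map /chi map_chiz.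
    by rewrite (lead _ D) ?cD.
  have D0 : (0 < D)%N := size_boxl_gt0 q.
  have hd : h chi^`()`_D.-1 != 0.
    by rewrite coef_deriv prednK // cD rmorphMn mulrn_eq0 negb_or -lt0n D0.
  rewrite (lead _ D.-1) ?prednK //; apply/leq_sizeP => j Dj.
  by rewrite coef_deriv nth_default ?mul0rn // (leq_trans sD).
(* The first factor excludes zeros at infinity, degrees up to [k.+1] being enough; the second makes
   the powers of the sum of the unknowns a basis of the quotient; the third makes the roots of [chi]
   simple. *)
exists ((\prod_(e < k.+2) dC e) * dQ * resultant chi chi^`()).
  rewrite !rmorphM rmorph_prod /= !mulf_neq0 ?dQ0 ?hchi //.
    by apply/prodf_neq0 => e _; rewrite dCE; apply: det_cmx.
  rewrite resultant_eq0 -leqNgt; have := spt_separable (deg h0) Sp0 spt0.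
  by rewrite unlock coprimep_def => /eqP ->.
move=> h; rewrite !rmorphM rmorph_prod /= !mulf_eq0 !negb_or => /andP[/andP[C0 Q0] r0].
have Sph : forall e p, (msize p <= e.+1)%N -> Sp q (fh h) e p.
  apply: Sp_all_det => // e ek; have /prodf_neq0/(_ (Ordinal (ek : e < k.+2)%N) isT) := C0.
  by rewrite dCE.
split; last first.
  move=> y fy; apply: (top_zero (deg h) Sph) => j; rewrite mmap_map; exact: fy.
have Qh : \det (cmx D (Pz q (fh h))) != 0 by rewrite -dQE.
have [_ sc lc] := chi_coef Qh.
have [rs rsE] := closed_field_poly_normal (chiz q (fh h)).
have rs_uniq : uniq rs.
  rewrite -separable_prod_XsubC -(@eqp_separable _ (chiz q (fh h))).
    rewrite unlock coprimep_def eqn_leq; apply/andP; split.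
      by rewrite leqNgt -resultant_eq0 -hchi.
    by rewrite size_poly_gt0 gcdp_eq0 negb_and -size_poly_eq0 sc.
  by rewrite {1}rsE; apply: eqp_scale; rewrite lc.
have rootE x : root (chiz q (fh h)) x = (x \in rs).
  by rewrite rsE rootZ ?lc // root_prod_XsubC.
have size_rs : size rs = size (boxl q).
  by move: sc; rewrite rsE lc size_scale // size_prod_XsubC => -[].
have [r [r1 r2 r3]] := shape_coords (deg h) Sph Qh.
exists [seq [ffun i => (r i).[x]] | x <- rs]; first split.
- rewrite map_inj_in_uniq // => x y xr yr /ffunP xy.
  rewrite -rootE in xr; rewrite -rootE in yr.
  by rewrite -(r2 x xr) -(r2 y yr); apply: eq_bigr => i _; have := xy i; rewrite !ffunE.
- by rewrite size_map size_rs size_boxl.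
move=> y; split=> [/mapP[x xr ->] j|fy].
  rewrite -rootE in xr; rewrite -meval_map -[RHS](r1 x xr j).
  by apply: meval_eq => i; rewrite ffunE.
have fy' j : (fh h j).@[y] = 0 by rewrite meval_map.
apply/mapP; exists (\sum_j y j); first by rewrite -rootE; apply: zero_root.
by apply/ffunP => i; rewrite ffunE; apply: r3.
Qed.
End Generic.

(** * Quadratic functions of the coordinates of the affine chart *)

(** Encodes [q0 + \sum_b q1 b v_b + qu u + \sum_(a, b) q2 a b v_a v_b], of degree two in [v] and one
    in [u]. The matrix [q2] may be asymmetric, so different records can denote the same function. *)
Record quad (m : nat) (R : Type) := Quad {
  q0 : R; q1 : 'I_m -> R; qu : R; q2 : 'I_m -> 'I_m -> R }.

Section Moments.
Variables (m : nat) (R : comNzRingType).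
Implicit Types (d : quad m R) (u w r : R) (v : 'I_m -> R).

Definition quadpart d v := \sum_a \sum_b q2 d a b * v a * v b.
Definition linpart d v := \sum_b q1 d b * v b.

(* The linear form [d] at the vector of moments [S, kk, n, w], which is proportional to [u, v v^T, v, 1] at a point of the chart. *)
Definition mom d S (kk : 'I_m -> 'I_m -> R) (n : 'I_m -> R) w :=
  qu d * S + \sum_a \sum_b q2 d a b * kk a b + linpart d n + q0 d * w.
Definition qval d u v := mom d u (fun a b => v a * v b) v 1.

Lemma quadpartE d v : \sum_a \sum_b q2 d a b * (v a * v b) = quadpart d v.
Proof. by rewrite /quadpart; do 2!apply: eq_bigr => ? _; rewrite mulrA. Qed.

Lemma quadpart_scale d r v : quadpart d (fun a => r * v a) = r * r * quadpart d v.
Proof.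
rewrite /quadpart mulr_sumr; apply: eq_bigr => a _; rewrite mulr_sumr.
by apply: eq_bigr => b _; ring.
Qed.

Lemma linpart_scale d r v : linpart d (fun a => r * v a) = r * linpart d v.
Proof. by rewrite /linpart mulr_sumr; apply: eq_bigr => a _; rewrite mulrCA. Qed.

Lemma eq_mom d S kk n w S' kk' n' w' : S = S' -> (forall a b, kk a b = kk' a b) ->
  n =1 n' -> w = w' -> mom d S kk n w = mom d S' kk' n' w'.
Proof.
move=> -> kkE nE ->; rewrite /mom /linpart; congr (_ + _ + _ + _).
  by do 2!apply: eq_bigr => ? _; rewrite kkE.
by apply: eq_bigr => ? _; rewrite nE.
Qed.

Lemma mom_scale d r S kk n w :
  mom d (r * S) (fun a b => r * kk a b) (fun a => r * n a) (r * w) = r * mom d S kk n w.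
Proof.
rewrite /mom linpart_scale !mulrDr [r * \sum_a _]mulr_sumr.
congr (_ + _ + _ + _); [ring| |ring].
by apply: eq_bigr => a _; rewrite mulr_sumr; apply: eq_bigr => b _; ring.
Qed.

Lemma qvalE d u v : qval d u v = qu d * u + quadpart d v + linpart d v + q0 d.
Proof. by rewrite /qval /mom quadpartE !mulr1. Qed.

Lemma mom0 d S v : mom d S (fun a b => v a * v b) (fun=> 0) 0 = qu d * S + quadpart d v.
Proof.
by rewrite /mom quadpartE /linpart big1 ?mulr0 ?addr0 // => b _; rewrite mulr0.
Qed.

Lemma eq_quadpart d v v' : v =1 v' -> quadpart d v = quadpart d v'.
Proof. by move=> vv; rewrite /quadpart; do 2!apply: eq_bigr => ? _; rewrite !vv. Qed.

Lemma eq_linpart d v v' : v =1 v' -> linpart d v = linpart d v'.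
Proof. by move=> vv; rewrite /linpart; apply: eq_bigr => a _; rewrite vv. Qed.

Definition qlin (I : finType) (h : I -> R) (D : I -> quad m R) : quad m R :=
  Quad (\sum_t h t * q0 (D t)) (fun b => \sum_t h t * q1 (D t) b)
       (\sum_t h t * qu (D t)) (fun a b => \sum_t h t * q2 (D t) a b).

Lemma quadpart_qlin (I : finType) (h : I -> R) (D : I -> quad m R) v :
  quadpart (qlin h D) v = \sum_t h t * quadpart (D t) v.
Proof.
rewrite /quadpart /=.
under [RHS]eq_bigr do rewrite mulr_sumr; rewrite [RHS]exchange_big /=; apply: eq_bigr => a _.
under [RHS]eq_bigr do rewrite mulr_sumr; rewrite [RHS]exchange_big /=; apply: eq_bigr => b _.
by rewrite !mulr_suml; apply: eq_bigr => t _; rewrite !mulrA.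
Qed.

Lemma linpart_qlin (I : finType) (h : I -> R) (D : I -> quad m R) v :
  linpart (qlin h D) v = \sum_t h t * linpart (D t) v.
Proof.
rewrite /linpart /=.
under [RHS]eq_bigr do rewrite mulr_sumr; rewrite [RHS]exchange_big /=; apply: eq_bigr => b _.
by rewrite mulr_suml; apply: eq_bigr => t _; rewrite !mulrA.
Qed.

Lemma qval_qlin (I : finType) (h : I -> R) (D : I -> quad m R) u v :
  qval (qlin h D) u v = \sum_t h t * qval (D t) u v.
Proof.
rewrite qvalE quadpart_qlin linpart_qlin /= mulr_suml -!big_split /=.
by apply: eq_bigr => t _; rewrite qvalE; ring.
Qed.

End Moments.

(* Evaluating at [v] and [- v] separates the linear from the quadratic part. *)
Lemma qval_eq m (K : numFieldType) (d e : quad m K) :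
  (forall u v, qval d u v = qval e u v) ->
  [/\ qu d = qu e, q0 d = q0 e, (forall v, quadpart d v = quadpart e v)
    & forall v, linpart d v = linpart e v].
Proof.
move=> de; have z (c : quad m K) : quadpart c (fun=> 0) = 0 /\ linpart c (fun=> 0) = 0.
  by split; rewrite /quadpart /linpart big1 // => a _; rewrite ?big1 ?mulr0 // => b _; rewrite mulr0.
have E0 : q0 d = q0 e.
  by have := de 0 (fun=> 0); rewrite !qvalE !mulr0 !(z _).1 !(z _).2 !add0r.
have Eu : qu d = qu e.
  have := de 1 (fun=> 0); rewrite !qvalE !mulr1 !(z _).1 !(z _).2 !addr0 E0.
  exact: addIr.
have E v : quadpart d v + linpart d v = quadpart e v + linpart e v.
  by have := de 0 v; rewrite !qvalE !mulr0 !add0r E0 => /addIr.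
have E' v : quadpart d v - linpart d v = quadpart e v - linpart e v.
  have N (c : quad m K) : quadpart c v = quadpart c (fun a => -1 * v a)
      /\ - linpart c v = linpart c (fun a => -1 * v a).
    by rewrite quadpart_scale linpart_scale mulrNN !mul1r mulN1r.
  by rewrite !(N _).1 !(N _).2 E.
have half (a b : K) : a + a = b + b -> a = b.
  by rewrite -!mulr2n => /eqP; rewrite eqrMn2r // => /eqP.
split=> // v; apply: half.
- transitivity ((quadpart d v + linpart d v) + (quadpart d v - linpart d v)); first ring.
  by rewrite E E'; ring.
- transitivity ((quadpart d v + linpart d v) - (quadpart d v - linpart d v)); first ring.
  by rewrite E E'; ring.
Qed.

(** * Polynomial functions on the product of the ambient spaces *)

Section PF.
Variables (K : fieldType) (I : finType) (T : I -> finType).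
Let Y := forall i, T i -> K.
Implicit Types (f g : Y -> K).

Definition PF f := exists F : {mpoly K[#|total_idx T|]},
  forall y : Y, peval F (fun k : total_idx T => y (tag k) (tagged k)) = f y.

Lemma PF_ext f g : f =1 g -> PF f -> PF g.
Proof. by move=> fg [F FE]; exists F => y; rewrite FE. Qed.
Lemma PFc c : PF (fun=> c).
Proof. by exists c%:MP => y; rewrite /peval mevalC. Qed.
Lemma PFy i t : PF (fun y => y i t).
Proof.
exists 'X_(enum_rank (existT (fun i => T i) i t : total_idx T)) => y.
by rewrite /peval mevalXU enum_rankK.
Qed.
Lemma PFD f g : PF f -> PF g -> PF (fun y => f y + g y).
Proof. by move=> [F FE] [G GE]; exists (F + G) => y; rewrite /peval mevalD -FE -GE. Qed.
Lemma PFM f g : PF f -> PF g -> PF (fun y => f y * g y).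
Proof. by move=> [F FE] [G GE]; exists (F * G) => y; rewrite /peval mevalM -FE -GE. Qed.
Lemma PFN f : PF f -> PF (fun y => - f y).
Proof. by move=> [F FE]; exists (- F) => y; rewrite /peval mevalN -FE. Qed.
Lemma PFB f g : PF f -> PF g -> PF (fun y => f y - g y).
Proof. by move=> pf pg; apply: PFD => //; apply: PFN. Qed.
Lemma PF_sum (J : Type) (r : seq J) (P : pred J) (f : J -> Y -> K) :
  (forall j, PF (f j)) -> PF (fun y => \sum_(j <- r | P j) f j y).
Proof.
move=> pf; elim: r => [|j r IH].
  by apply: PF_ext (PFc 0) => y; rewrite big_nil.
case Pj : (P j).
  by apply: PF_ext (PFD (pf j) IH) => y; rewrite big_cons Pj.
by apply: PF_ext IH => y; rewrite big_cons Pj.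
Qed.
Lemma PF_mom m (d : quad m K) S (kk : 'I_m -> 'I_m -> Y -> K) (n : 'I_m -> Y -> K) w :
  PF S -> (forall a b, PF (kk a b)) -> (forall a, PF (n a)) -> PF w ->
  PF (fun y => mom d (S y) (fun a b => kk a b y) (fun a => n a y) (w y)).
Proof.
move=> pS pk pn pw; apply: PFD; [apply: PFD; [apply: PFD|]|].
- by apply: PFM => //; apply: PFc.
- by apply: PF_sum => a; apply: PF_sum => b; apply: PFM => //; apply: PFc.
- by apply: PF_sum => b; apply: PFM => //; apply: PFc.
- by apply: PFM => //; apply: PFc.
Qed.
Lemma PF_lam i (h : T i -> K) : PF (fun y => \sum_t h t * y i t).
Proof. by apply: PF_sum => t; apply: PFM; [apply: PFc | apply: PFy]. Qed.

End PF.

Section SpecialQuads.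
Variables (m : nat) (R : comNzRingType).

Definition e1 : quad m R := Quad 1 (fun=> 0) 0 (fun _ _ => 0).
Definition ev (b : 'I_m) : quad m R := Quad 0 (fun c => (c == b)%:R) 0 (fun _ _ => 0).
Definition eu : quad m R := Quad 0 (fun=> 0) 1 (fun _ _ => 0).
Definition ekk (a b : 'I_m) : quad m R :=
  Quad 0 (fun=> 0) 0 (fun c d => ((c == a) && (d == b))%:R).
Definition ediag (u : R) (s : 'I_m -> R) : quad m R :=
  Quad 0 (fun=> 0) u (fun c d => s c *+ (c == d)).

Implicit Types (v : 'I_m -> R) (u : R).

Lemma linpart0 (d : quad m R) v : (forall b, q1 d b = 0) -> linpart d v = 0.
Proof. by move=> d0; rewrite /linpart big1 // => b _; rewrite d0 mul0r. Qed.
Lemma quadpart0 (d : quad m R) v : (forall a b, q2 d a b = 0) -> quadpart d v = 0.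
Proof. by move=> d0; rewrite /quadpart big1 // => b _; rewrite big1 // => a _; rewrite d0 !mul0r. Qed.

Lemma linpart_ev b v : linpart (ev b) v = v b.
Proof.
rewrite /linpart (bigD1 b) //= eqxx mul1r big1 ?addr0 // => c cb.
by rewrite (negPf cb) mul0r.
Qed.

Lemma quadpart_ekk a b v : quadpart (ekk a b) v = v a * v b.
Proof.
rewrite /quadpart (bigD1 a) //= (bigD1 b) //= !eqxx mul1r !big1 ?addr0 // => c cb.
  by rewrite big1 // => d _; rewrite (negPf cb) !mul0r.
by rewrite (negPf cb) !mul0r.
Qed.

Lemma quadpart_ediag u s v : quadpart (ediag u s) v = \sum_a s a * (v a * v a).
Proof.
rewrite /quadpart; apply: eq_bigr => a _; rewrite (bigD1 a) //= eqxx mulr1n mulrA.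
by rewrite big1 ?addr0 // => b; rewrite eq_sym => /negPf ->; rewrite mulr0n !mul0r.
Qed.

Lemma qval_e1 u v : qval e1 u v = 1.
Proof. by rewrite qvalE linpart0 // quadpart0 // mul0r !add0r. Qed.
Lemma qval_ev b u v : qval (ev b) u v = v b.
Proof. by rewrite qvalE linpart_ev quadpart0 // mul0r !add0r addr0. Qed.
Lemma qval_eu u v : qval eu u v = u.
Proof. by rewrite qvalE linpart0 // quadpart0 // mul1r !addr0. Qed.
Lemma qval_ekk a b u v : qval (ekk a b) u v = v a * v b.
Proof. by rewrite qvalE linpart0 // quadpart_ekk mul0r add0r !addr0. Qed.
Lemma qval_ediag c s u v : qval (ediag c s) u v = c * u + \sum_a s a * (v a * v a).
Proof. by rewrite qvalE linpart0 // quadpart_ediag !addr0. Qed.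
End SpecialQuads.

(* [K^m]-coordinates [v_b] and the coordinate [u] on the chart; index [i] of a factor stands for the minors of size [i + 1], so that [0 < i < m] are the factors strictly between the first and the last one. *)
Record cone (K : fieldType) (m : nat) (T : 'I_m.+1 -> finType) (D : forall i, T i -> quad m K) := Cone {
  h1 : forall i, T i -> K;
  hv : forall i, 'I_m -> T i -> K;
  hu : T ord0 -> K;
  ht : T ord_max -> K;
  hk : forall i, 'I_m -> 'I_m -> T i -> K;
  hd : forall i, 'I_m -> 'I_m -> T i -> K;
  hA : forall i, T i -> K;
  A : 'I_m.+1 -> {set 'I_m};
  h1E : forall i u v, qval (qlin (@h1 i) (@D i)) u v = 1;
  hvE : forall i b u v, qval (qlin (@hv i b) (@D i)) u v = v b;
  huE : forall u v, qval (qlin hu (@D ord0)) u v = u;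
  htE : forall u v, qval (qlin ht (@D ord_max)) u v = u - \sum_b v b * v b;
  hkE : forall (i : 'I_m.+1) a b, (0 < i < m)%N -> a != b ->
    forall u v, qval (qlin (@hk i a b) (@D i)) u v = v a * v b;
  hdE : forall (i : 'I_m.+1) a b, (0 < i < m)%N ->
    forall u v, qval (qlin (@hd i a b) (@D i)) u v = v a * v a - v b * v b;
  cardA : forall i : 'I_m.+1, (0 < i < m)%N -> #|A i| = i :> nat;
  hAE : forall i : 'I_m.+1, (0 < i < m)%N ->
    forall u v, qval (qlin (@hA i) (@D i)) u v = u - \sum_(b in A i) v b * v b;
  q2_0 : forall t a b, q2 (@D ord0 t) a b = 0;
  q2_max : forall t a b, q2 (@D ord_max t) a b = - qu (D ord_max t) *+ (a == b)
}.

Arguments h1 {K m T D} c i _.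
Arguments hv {K m T D} c i _ _.
Arguments hk {K m T D} c i _ _ _.
Arguments hd {K m T D} c i _ _ _.
Arguments hA {K m T D} c i _.
Arguments A {K m T D} c i.

(** * Points of the closure, inside and outside the chart *)

Section Closure.
Variables (K : numClosedFieldType) (m : nat) (T : 'I_m.+1 -> finType).
Variables (D : forall i, T i -> quad m K) (c : cone D).
Hypothesis m_gt0 : (0 < m)%N.
Local Notation Y := (forall i, T i -> K).
Implicit Types (i : 'I_m.+1) (a b : 'I_m) (u : K) (v : 'I_m -> K) (rho : 'I_m.+1 -> K).

(** The scalars [rho i] are independent of each other: they stand for the choice of homogeneous
    coordinates in each factor. *)
Definition chart rho u v : Y := fun i t => rho i * qval (D t) u v.
Definition lam i (h : T i -> K) (y : Y) := \sum_t h t * y i t.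

Lemma lam_chart i (h : T i -> K) rho u v :
  lam h (chart rho u v) = rho i * qval (qlin h (@D i)) u v.
Proof. by rewrite qval_qlin mulr_sumr; apply: eq_bigr => t _; rewrite mulrCA. Qed.

Lemma PFlam i (h : T i -> K) : PF (lam h).
Proof. exact: PF_lam. Qed.

Variable y : Y.
Arguments y : clear implicits.
Hypothesis y_nz : forall i, exists t, y i t != 0.
Hypothesis y_closure : forall f, PF f -> (forall rho u v, f (chart rho u v) = 0) -> f y = 0.

Lemma closure_eq f g : PF f -> PF g ->
  (forall rho u v, f (chart rho u v) = g (chart rho u v)) -> f y = g y.
Proof.
move=> pf pg fg; apply/eqP; rewrite -subr_eq0; apply/eqP.
by apply: (y_closure (PFB pf pg)) => rho u v; rewrite fg subrr.
Qed.

(** The hypothesis passes to every form spanned by the factor. From [v_a v_b] and [v_a^2 - v_b^2],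
    with at least two indices since [0 < i < m], all [v_a] vanish; then the form with leading part
    [u] gives [S = 0]. *)
Lemma mid_eq0 i S v : (0 < i < m)%N ->
  (forall t, qu (@D i t) * S + quadpart (@D i t) v = 0) -> S = 0 /\ forall a, v a = 0.
Proof.
move=> im dS.
have H (h : T i -> K) e : (forall u v, qval (qlin h (@D i)) u v = qval e u v) ->
    qu e * S + quadpart e v = 0.
  move=> /qval_eq[<- _ <- _]; rewrite quadpart_qlin /= mulr_suml -big_split /= big1 // => t _.
  by rewrite -mulrA -mulrDr dS mulr0.
have kk a b : a != b -> v a * v b = 0.
  move=> ab; have := H (hk c i a b) (ekk K a b) _; rewrite quadpart_ekk mul0r add0r; apply=> u v'.
  by rewrite hkE // qval_ekk.
have dd a b : v a * v a = v b * v b.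
  pose e := ediag 0 (fun d => (d == a)%:R - (d == b)%:R : K).
  have qe w : \sum_d ((d == a)%:R - (d == b)%:R) * (w d * w d) = w a * w a - w b * w b :> K.
    under eq_bigr do rewrite mulrBl; rewrite sumrB (bigD1 a) //= [X in _ - X](bigD1 b) //= !eqxx !mul1r.
    by rewrite !big1 ?addr0 // => d /negPf ->; rewrite mul0r.
  apply/eqP; rewrite -subr_eq0 -qe -(quadpart_ediag 0); apply/eqP.
  have := H (hd c i a b) e _; rewrite mul0r add0r; apply=> u w.
  by rewrite hdE // qval_ediag qe mul0r add0r.
have v0 a : v a = 0.
  apply/eqP; apply: contraT => va.
  have [b ba] : exists b, b != a.
    have m2 : (1 < m)%N by lia.
    have [E|E] := eqVneq a (Ordinal m_gt0); last by exists (Ordinal m_gt0); rewrite eq_sym.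
    by exists (Ordinal m2); rewrite E.
  have : v b * v b * (v a * v a) != 0 by rewrite (dd b a) !mulf_neq0.
  by rewrite mulrACA (kk b a ba) mul0r eqxx.
split=> //; pose e := ediag 1 (fun d => - (d \in A c i)%:R : K).
have := H (hA c i) e; rewrite quadpart_ediag mul1r big1 ?addr0 => [|a _]; last by rewrite v0 mul0r mulr0.
apply=> u w; rewrite hAE // qval_ediag mul1r -sumrN big_mkcond /=; congr (_ + _).
by apply: eq_bigr => a _; case: (a \in A c i); rewrite ?mulN1r // oppr0 mul0r.
Qed.

Lemma proportional i (z : T i -> K) : (forall s t, z s * y i t = z t * y i s) ->
  (exists s, z s != 0) -> exists2 r, r != 0 & forall t, y i t = r * z t.
Proof.
move=> zy [s zs]; exists (y i s / z s); last first.
  by move=> t; rewrite mulrAC [y i s * _]mulrC -zy mulrAC divff // mul1r.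
have [t yt] := y_nz i; rewrite mulf_neq0 ?invr_neq0 //; apply: contraNneq yt => ys.
have /eqP := zy s t; rewrite ys mulr0 mulf_eq0 (negPf zs) => /eqP ->; exact: eqxx.
Qed.

Lemma mid_proportional i S v : (0 < i < m)%N -> (S != 0) || [exists a, v a != 0] ->
  (forall s t, (qu (@D i s) * S + quadpart (@D i s) v) * y i t =
               (qu (@D i t) * S + quadpart (@D i t) v) * y i s) ->
  exists2 r, r != 0 & forall t, y i t = r * (qu (@D i t) * S + quadpart (@D i t) v).
Proof.
move=> im nz zy; apply: proportional zy _.
apply: contrapT => H; have /(mid_eq0 im)[S0 v0] t : qu (@D i t) * S + quadpart (@D i t) v = 0.
  by apply/eqP; apply: contrapT => /negP Ht; apply: H; exists t.
by move: nz; rewrite S0 eqxx => /existsP[a]; rewrite v0 eqxx.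
Qed.

(** On the chart each block [y i] is proportional to the values of the forms [D i] at the moments
    [(u, v v^T, v, 1)]. Cross-multiplication makes this a polynomial identity, which survives on the
    closure even where the common factor [r] would vanish. *)
Lemma moment_relation S (kk : 'I_m -> 'I_m -> Y -> K) (n : 'I_m -> Y -> K) w :
  PF S -> (forall a b, PF (kk a b)) -> (forall a, PF (n a)) -> PF w ->
  (forall rho u v, let z := chart rho u v in exists r,
     [/\ S z = r * u, forall a b, kk a b z = r * (v a * v b),
         forall a, n a z = r * v a & w z = r * 1]) ->
  forall i s t,
    mom (@D i s) (S y) (fun a b => kk a b y) (fun a => n a y) (w y) * y i t =
    mom (@D i t) (S y) (fun a b => kk a b y) (fun a => n a y) (w y) * y i s.
Proof.
move=> pS pk pn pw H i s t.
apply: (@closure_eq (fun y => mom (@D i s) (S y) (fun a b => kk a b y) (fun a => n a y) (w y) * y i t)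
  (fun y => mom (@D i t) (S y) (fun a b => kk a b y) (fun a => n a y) (w y) * y i s)).
- by apply: PFM; [apply: PF_mom | apply: PFy].
- by apply: PFM; [apply: PF_mom | apply: PFy].
move=> rho u v; have [r [ES Ek En Ew]] := H rho u v.
rewrite !(@eq_mom _ _ _ _ _ _ _ _ _ _ _ ES Ek En Ew) !mom_scale -!/(qval _ _ _) /chart; ring.
Qed.

Definition cW i := lam (h1 c i).
Definition cV i b := lam (hv c i b).
Definition cU := lam (hu c).
Definition cT := lam (ht c).

Lemma cW_chart i rho u v : cW i (chart rho u v) = rho i * 1.
Proof. by rewrite /cW lam_chart h1E. Qed.
Lemma cV_chart i b rho u v : cV i b (chart rho u v) = rho i * v b.
Proof. by rewrite /cV lam_chart hvE. Qed.
Lemma cU_chart rho u v : cU (chart rho u v) = rho ord0 * u.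
Proof. by rewrite /cU lam_chart huE. Qed.
Lemma cT_chart rho u v : cT (chart rho u v) = rho ord_max * (u - \sum_b v b * v b).
Proof. by rewrite /cT lam_chart htE. Qed.

(** The forms of the first factor have no quadratic part, so its coordinates are linear in [cU],
    [cV] and [cW], which therefore cannot all vanish. In the last factor the same holds with [cT],
    standing for [u - |v|^2], in place of [cU]. *)
Lemma y_first t : y ord0 t = qu (@D ord0 t) * cU y + linpart (@D ord0 t) (fun b => cV ord0 b y) + q0 (@D ord0 t) * cW ord0 y.
Proof.
apply: (@closure_eq (fun y => y ord0 t) (fun y => qu (@D ord0 t) * cU y + linpart (@D ord0 t) (fun b => cV ord0 b y) + q0 (@D ord0 t) * cW ord0 y)).
- exact: PFy.
- apply: PFD; last by apply: PFM; [apply: PFc | apply: PFlam].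
  apply: PFD; first by apply: PFM; [apply: PFc | apply: PFlam].
  by apply: PF_sum => b; apply: PFM; [apply: PFc | apply: PFlam].
move=> rho u v; rewrite (eq_linpart _ (fun b => cV_chart ord0 b rho u v)) linpart_scale cU_chart cW_chart.
rewrite /chart qvalE quadpart0; last exact: (q2_0 c).
by ring.
Qed.

Lemma y_last t : y ord_max t = qu (@D ord_max t) * cT y + linpart (@D ord_max t) (fun b => cV ord_max b y) + q0 (@D ord_max t) * cW ord_max y.
Proof.
apply: (@closure_eq (fun y => y ord_max t) (fun y => qu (@D ord_max t) * cT y + linpart (@D ord_max t) (fun b => cV ord_max b y) + q0 (@D ord_max t) * cW ord_max y)).
- exact: PFy.
- apply: PFD; last by apply: PFM; [apply: PFc | apply: PFlam].
  apply: PFD; first by apply: PFM; [apply: PFc | apply: PFlam].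
  by apply: PF_sum => b; apply: PFM; [apply: PFc | apply: PFlam].
move=> rho u v; rewrite (eq_linpart _ (fun b => cV_chart ord_max b rho u v)) linpart_scale cT_chart cW_chart.
rewrite /chart qvalE (_ : quadpart _ _ = - qu (D t) * \sum_b v b * v b); first by ring.
rewrite mulr_sumr /quadpart; apply: eq_bigr => a _; rewrite (bigD1 a) //= (q2_max c) eqxx mulr1n mulrA.
by rewrite big1 ?addr0 // => b; rewrite eq_sym => ab; rewrite (q2_max c) (negPf ab) mulr0n !mul0r.
Qed.

(** The moments, multiplied by the square of [rho ord0], become quadratic in the coordinates of the
    first factor; in this form they make sense when [cW] vanishes. *)
Lemma first_relation i s t :
  let M t := mom (@D i t) (cU y * cW ord0 y) (fun a b => cV ord0 a y * cV ord0 b y)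
    (fun a => cV ord0 a y * cW ord0 y) (cW ord0 y * cW ord0 y) in
  M s * y i t = M t * y i s.
Proof.
apply: (@moment_relation (fun y => cU y * cW ord0 y) (fun a b y => cV ord0 a y * cV ord0 b y)
    (fun a y => cV ord0 a y * cW ord0 y) (fun y => cW ord0 y * cW ord0 y)).
- by apply: PFM; apply: PFlam.
- by move=> a b; apply: PFM; apply: PFlam.
- by move=> a; apply: PFM; apply: PFlam.
- by apply: PFM; apply: PFlam.
move=> rho u v z; exists (rho ord0 * rho ord0); rewrite /z.
split=> [|a b|a|]; rewrite ?cU_chart ?cW_chart ?cV_chart; ring.
Qed.

Lemma finite_point : cW ord0 y != 0 -> exists u v,
  forall i, exists2 r, r != 0 & forall t, y i t = r * qval (@D i t) u v.
Proof.
move=> W0; set W := cW ord0 y in W0; exists (cU y / W), (fun b => cV ord0 b y / W) => i.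
have E t : mom (@D i t) (cU y * W) (fun a b => cV ord0 a y * cV ord0 b y)
    (fun a => cV ord0 a y * W) (W * W) = W * W * qval (@D i t) (cU y / W) (fun b => cV ord0 b y / W).
  by rewrite -mom_scale; apply: eq_mom => [|a b|a|]; field.
apply: proportional.
  move=> s t; have := first_relation s t => /=; rewrite -/W !E -!mulrA.
  by do 2!move/(mulfI W0).
apply: contrapT => H; have := h1E c i (cU y / W) (fun b => cV ord0 b y / W).
rewrite qval_qlin big1 => [/eqP|t _]; first by rewrite eq_sym oner_eq0.
have [->|nz] := eqVneq (qval (D t) (cU y / W) (fun b => cV ord0 b y / W)) 0; first by rewrite mulr0.
by case: H; exists t.
Qed.

Lemma lam_first (h : T ord0 -> K) : lam h y =
  qu (qlin h (@D ord0)) * cU y + linpart (qlin h (@D ord0)) (fun b => cV ord0 b y)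
  + q0 (qlin h (@D ord0)) * cW ord0 y.
Proof.
rewrite linpart_qlin /= !mulr_suml -!big_split /=; apply: eq_bigr => t _.
by rewrite y_first; ring.
Qed.

Lemma lam_last (h : T ord_max -> K) : lam h y =
  qu (qlin h (@D ord_max)) * cT y + linpart (qlin h (@D ord_max)) (fun b => cV ord_max b y)
  + q0 (qlin h (@D ord_max)) * cW ord_max y.
Proof.
rewrite linpart_qlin /= !mulr_suml -!big_split /=; apply: eq_bigr => t _.
by rewrite y_last; ring.
Qed.

(** The last factor sees [cT] instead of [u]; adding the squares of its [cV] to [cT * cW] restores
    the moment of [u]. *)
Lemma last_relation i s t :
  let M t := mom (@D i t) (cT y * cW ord_max y + \sum_b cV ord_max b y * cV ord_max b y)
    (fun a b => cV ord_max a y * cV ord_max b y)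
    (fun a => cV ord_max a y * cW ord_max y) (cW ord_max y * cW ord_max y) in
  M s * y i t = M t * y i s.
Proof.
apply: (@moment_relation (fun y => cT y * cW ord_max y + \sum_b cV ord_max b y * cV ord_max b y)
    (fun a b y => cV ord_max a y * cV ord_max b y)
    (fun a y => cV ord_max a y * cW ord_max y) (fun y => cW ord_max y * cW ord_max y)).
- apply: PFD; first by apply: PFM; apply: PFlam.
  by apply: PF_sum => b; apply: PFM; apply: PFlam.
- by move=> a b; apply: PFM; apply: PFlam.
- by move=> a; apply: PFM; apply: PFlam.
- by apply: PFM; apply: PFlam.
move=> rho u v z; exists (rho ord_max * rho ord_max); rewrite /z.
split=> [|a b|a|]; rewrite ?cT_chart ?cW_chart ?cV_chart; try ring.
have -> : \sum_b cV ord_max b (chart rho u v) * cV ord_max b (chart rho u v) =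
    rho ord_max * rho ord_max * \sum_b v b * v b.
  by rewrite mulr_sumr; apply: eq_bigr => b _; rewrite cV_chart; ring.
ring.
Qed.

Lemma first_V_W i b : cW ord0 y * cV i b y = cV ord0 b y * cW i y.
Proof.
apply: (@closure_eq (fun y => cW ord0 y * cV i b y) (fun y => cV ord0 b y * cW i y)).
- by apply: PFM; apply: PFlam.
- by apply: PFM; apply: PFlam.
by move=> rho u v; rewrite !cV_chart !cW_chart; ring.
Qed.

Lemma first_V_V i a b : cV ord0 a y * cV i b y = cV ord0 b y * cV i a y.
Proof.
apply: (@closure_eq (fun y => cV ord0 a y * cV i b y) (fun y => cV ord0 b y * cV i a y)).
- by apply: PFM; apply: PFlam.
- by apply: PFM; apply: PFlam.
by move=> rho u v; rewrite !cV_chart; ring.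
Qed.

Lemma first_U_last : cW ord0 y * cT y =
  cU y * cW ord_max y - \sum_b cV ord0 b y * cV ord_max b y.
Proof.
apply: (@closure_eq (fun y => cW ord0 y * cT y)
  (fun y => cU y * cW ord_max y - \sum_b cV ord0 b y * cV ord_max b y)).
- by apply: PFM; apply: PFlam.
- apply: PFB; first by apply: PFM; apply: PFlam.
  by apply: PF_sum => b; apply: PFM; apply: PFlam.
move=> rho u v; rewrite !cU_chart !cW_chart !cT_chart.
have -> : \sum_b cV ord0 b (chart rho u v) * cV ord_max b (chart rho u v) =
    rho ord0 * rho ord_max * \sum_b v b * v b.
  by rewrite mulr_sumr; apply: eq_bigr => b _; rewrite !cV_chart; ring.
ring.
Qed.

Lemma first_U_mid i : (0 < i < m)%N -> cW ord0 y * lam (hA c i) y =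
  cU y * cW i y - \sum_(b in A c i) cV ord0 b y * cV i b y.
Proof.
move=> im; apply: (@closure_eq (fun y => cW ord0 y * lam (hA c i) y)
  (fun y => cU y * cW i y - \sum_(b in A c i) cV ord0 b y * cV i b y)).
- by apply: PFM; apply: PFlam.
- apply: PFB; first by apply: PFM; apply: PFlam.
  by apply: PF_sum => b; apply: PFM; apply: PFlam.
move=> rho u v; rewrite !cU_chart !cW_chart lam_chart hAE //.
have -> : \sum_(b in A c i) cV ord0 b (chart rho u v) * cV i b (chart rho u v) =
    rho ord0 * rho i * \sum_(b in A c i) v b * v b.
  by rewrite mulr_sumr; apply: eq_bigr => b _; rewrite !cV_chart; ring.
ring.
Qed.

Section AtInfinity.
Hypothesis W0 : cW ord0 y = 0.

Lemma first_nz : (exists a, cV ord0 a y != 0) \/ (cU y != 0 /\ forall a, cV ord0 a y = 0).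
Proof.
have [/existsP H|H] := boolP [exists a, cV ord0 a y != 0]; [by left | right].
have V0 a : cV ord0 a y = 0.
  by apply/eqP; move: H; rewrite negb_exists => /forallP/(_ a); rewrite negbK.
split=> //; have [t] := y_nz ord0; apply: contraNneq => U0.
rewrite y_first U0 W0 !mulr0 addr0 add0r /linpart big1 // => b _.
by rewrite V0 mulr0.
Qed.

Lemma mid_W0 i : (0 < i < m)%N -> cW i y = 0.
Proof.
move=> im; have [[a Va]|[U0 V0]] := first_nz.
  have /eqP := first_V_W i a; rewrite W0 mul0r eq_sym mulf_eq0 (negPf Va) => /eqP; exact.
have /eqP := first_U_mid im; rewrite W0 mul0r big1 ?subr0; last by move=> b _; rewrite V0 mul0r.
by rewrite eq_sym mulf_eq0 (negPf U0) => /eqP.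
Qed.

Lemma last_W0 : cW ord_max y = 0.
Proof.
have [[a Va]|[U0 V0]] := first_nz.
  have /eqP := first_V_W ord_max a; rewrite W0 mul0r eq_sym mulf_eq0 (negPf Va) => /eqP; exact.
have /eqP := first_U_last; rewrite W0 mul0r big1 ?subr0; last by move=> b _; rewrite V0 mul0r.
by rewrite eq_sym mulf_eq0 (negPf U0) => /eqP.
Qed.

Lemma mid_equation i S v r (h : T i -> K) : r != 0 ->
  (forall t, y i t = r * (qu (@D i t) * S + quadpart (@D i t) v)) -> lam h y = 0 ->
  qu (qlin h (@D i)) * S + quadpart (qlin h (@D i)) v = 0.
Proof.
move=> r0 yE hy; apply: (mulfI r0); rewrite mulr0 -[RHS]hy /lam quadpart_qlin /=.
rewrite mulr_suml -big_split /= mulr_sumr; apply: eq_bigr => t _; rewrite yE; ring.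
Qed.

(** At [W = 0] the moments of the first factor reduce to [(0, z z^T, 0, 0)], where [z] consists of
    its [cV]. The pivot ensures [z != 0]: otherwise its equation would force [cU = 0] as well. A
    pivot in the last factor makes the [cV] of that factor nonzero, hence proportional to [z], and
    then the relation between [u] and [u - |v|^2] makes [z] isotropic. *)
Lemma boundary_first (p : T ord0 -> K) : lam p y = 0 -> qu (qlin p (@D ord0)) != 0 ->
  exists2 z : 'I_m -> K, exists a, z a != 0 & [/\
    forall i (h : T i -> K), (0 < i < m)%N -> lam h y = 0 -> quadpart (qlin h (@D i)) z = 0,
    forall h : T ord0 -> K, lam h y = 0 ->
      qu (qlin p (@D ord0)) * linpart (qlin h (@D ord0)) z =
      qu (qlin h (@D ord0)) * linpart (qlin p (@D ord0)) z
    & forall p' : T ord_max -> K, lam p' y = 0 -> qu (qlin p' (@D ord_max)) != 0 ->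
      \sum_b z b * z b = 0 /\ forall h : T ord_max -> K, lam h y = 0 ->
      qu (qlin p' (@D ord_max)) * linpart (qlin h (@D ord_max)) z =
      qu (qlin h (@D ord_max)) * linpart (qlin p' (@D ord_max)) z].
Proof.
move=> py p0; pose z b := cV ord0 b y.
have [a za] : exists a, z a != 0.
  have [//|[U0 V0]] := first_nz; move/eqP: py; rewrite lam_first W0 mulr0 addr0.
  by rewrite /linpart big1 ?addr0 => [|b _]; rewrite ?V0 ?mulr0 // mulf_eq0 (negPf p0) (negPf U0).
have zlin (h : T ord0 -> K) : lam h y = 0 -> linpart (qlin h (@D ord0)) z = - (qu (qlin h (@D ord0)) * cU y).
  by rewrite lam_first W0 mulr0 addr0 => /eqP; rewrite addrC addr_eq0 => /eqP.
exists z; first by exists a.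
split=> [i h im hy|h hy|p' py' p0'].
- have [||r r0 rE] := @mid_proportional i 0 z im.
  + by apply/orP; right; apply/existsP; exists a.
  + move=> s t; have := first_relation s t => /=; rewrite W0 !mulr0.
    have E : (fun a : 'I_m => cV ord0 a y * 0) =1 (fun=> 0) by move=> b; rewrite mulr0.
    rewrite !(@eq_mom _ _ _ _ _ _ _ _ _ _ _ (erefl 0) (fun _ _ => erefl _) E (erefl 0)) !mom0 !mulr0; exact.
  by have := mid_equation r0 rE hy; rewrite mulr0 add0r.
- by rewrite !zlin // !mulrN mulrCA.
have Wn := last_W0.
have [b nb] : exists b, cV ord_max b y != 0.
  apply: contrapT => H; have N0 b : cV ord_max b y = 0.
    by apply/eqP; apply: contrapT => /negP Hb; apply: H; exists b.
  have T0 : cT y = 0.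
    move/eqP: py'; rewrite lam_last Wn mulr0 addr0 /linpart big1 ?addr0 => [|b _]; last by rewrite N0 mulr0.
    by rewrite mulf_eq0 (negPf p0') => /eqP.
  have [t] := y_nz ord_max; rewrite y_last T0 Wn !mulr0 addr0 add0r /linpart big1 ?eqxx // => b _.
  by rewrite N0 mulr0.
have zn e : cV ord_max e y = cV ord_max a y / z a * z e.
  by rewrite mulrAC; apply: (mulIf za); rewrite mulfVK // mulrC first_V_V mulrC.
set r := _ / _ in zn; have r0 : r != 0.
  by apply: contraNneq nb => r0; rewrite zn r0 mul0r.
have zlin' (h : T ord_max -> K) : lam h y = 0 ->
    r * linpart (qlin h (@D ord_max)) z = - (qu (qlin h (@D ord_max)) * cT y).
  rewrite -linpart_scale lam_last Wn mulr0 addr0 (eq_linpart _ zn) => /eqP.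
  by rewrite addrC addr_eq0 => /eqP.
split.
  have := first_U_last; rewrite W0 Wn mul0r mulr0 sub0r => /eqP; rewrite eq_sym oppr_eq0 => /eqP.
  under eq_bigr do rewrite zn mulrCA.
  by rewrite -mulr_sumr => /eqP; rewrite mulf_eq0 (negPf r0) => /eqP.
move=> h hy; apply: (mulfI r0); rewrite mulrCA [RHS]mulrCA !zlin' // !mulrN mulrCA //.
Qed.

(** Here [z] comes from the last factor, whose moments at [W = 0] are [(|z|^2, z z^T, 0, 0)]: the
    leading part of [u - |v|^2] vanishes, so [u] contributes [|z|^2]. *)
Lemma boundary_last (p : T ord_max -> K) : lam p y = 0 -> qu (qlin p (@D ord_max)) != 0 ->
  exists2 z : 'I_m -> K, exists a, z a != 0 & 
    (forall i (h : T i -> K), (0 < i < m)%N -> lam h y = 0 ->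
      qu (qlin h (@D i)) * (\sum_b z b * z b) + quadpart (qlin h (@D i)) z = 0) /\
    (forall h : T ord_max -> K, lam h y = 0 ->
      qu (qlin p (@D ord_max)) * linpart (qlin h (@D ord_max)) z =
      qu (qlin h (@D ord_max)) * linpart (qlin p (@D ord_max)) z).
Proof.
move=> py p0; pose z b := cV ord_max b y; have Wn := last_W0.
have [a za] : exists a, z a != 0.
  apply: contrapT => H; have N0 b : cV ord_max b y = 0.
    by apply/eqP; apply: contrapT => /negP Hb; apply: H; exists b.
  have T0 : cT y = 0.
    move/eqP: py; rewrite lam_last Wn mulr0 addr0 /linpart big1 ?addr0 => [|b _]; last by rewrite N0 mulr0.
    by rewrite mulf_eq0 (negPf p0) => /eqP.
  have [t] := y_nz ord_max; rewrite y_last T0 Wn !mulr0 addr0 add0r /linpart big1 ?eqxx // => b _.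
  by rewrite N0 mulr0.
have zlin (h : T ord_max -> K) : lam h y = 0 ->
    linpart (qlin h (@D ord_max)) z = - (qu (qlin h (@D ord_max)) * cT y).
  by rewrite lam_last Wn mulr0 addr0 => /eqP; rewrite addrC addr_eq0 => /eqP.
exists z; first by exists a.
split=> [i h im hy|h hy]; last by rewrite !zlin // !mulrN mulrCA.
have [||r r0 rE] := @mid_proportional i (\sum_b z b * z b) z im.
- by apply/orP; right; apply/existsP; exists a.
- move=> s t; have := last_relation s t => /=; rewrite Wn !mulr0 add0r.
  have E : (fun a : 'I_m => cV ord_max a y * 0) =1 (fun=> 0) by move=> b; rewrite mulr0.
  by rewrite !(@eq_mom _ _ _ _ _ _ _ _ _ _ _ (erefl _) (fun _ _ => erefl _) E (erefl 0)) !mom0.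
exact: mid_equation r0 rE hy.
Qed.

End AtInfinity.
End Closure.

(** * Lifting a point of the closure to a quadratic extension *)

Section QuadraticExtension.
Variables (K : numClosedFieldType) (I : finType) (T : I -> finType).
Local Notation Y := (forall i, T i -> K).
Variables (del kap : Y -> K).
Hypotheses (pdel : PF del) (pkap : PF kap).

(** Normal forms [A + B X] in a quadratic extension of the ring [PF]. The identity is asked only
    where [X] satisfies its equation, so that products can be reduced. *)
Definition PFX (f : Y -> K -> K) := exists AB : (Y -> K) * (Y -> K),
  [/\ PF AB.1, PF AB.2 & forall y X, X * X = del y * X + kap y -> f y X = AB.1 y + AB.2 y * X].

Lemma PFX_ext f g : (forall y X, f y X = g y X) -> PFX f -> PFX g.
Proof. by move=> fg [AB [pA pB E]]; exists AB; split=> // y X /E <-. Qed.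
Lemma PFXy f : PF f -> PFX (fun y _ => f y).
Proof.
move=> pf; exists (f, fun=> 0); split=> //; first exact: PFc.
by move=> y X _ /=; rewrite mul0r addr0.
Qed.
Lemma PFXX : PFX (fun _ X => X).
Proof.
exists (fun=> 0, fun=> 1); split; try exact: PFc.
by move=> y X _ /=; rewrite mul1r add0r.
Qed.
Lemma PFXD f g : PFX f -> PFX g -> PFX (fun y X => f y X + g y X).
Proof.
move=> [[A B] [pA pB E]] [[A' B'] [pA' pB' E']].
exists (fun y => A y + A' y, fun y => B y + B' y); split; try exact: PFD.
by move=> y X H /=; rewrite E // E' //= mulrDl addrACA.
Qed.
Lemma PFXM f g : PFX f -> PFX g -> PFX (fun y X => f y X * g y X).
Proof.
move=> [[A B] [pA pB E]] [[A' B'] [pA' pB' E']].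
exists (fun y => A y * A' y + B y * B' y * kap y,
        fun y => A y * B' y + B y * A' y + B y * B' y * del y); split=> /=.
- by apply: PFD; repeat apply: PFM.
- by apply: PFD; [apply: PFD | ]; repeat apply: PFM.
move=> y X H; rewrite E // E' //=.
transitivity (A y * A' y + (A y * B' y + B y * A' y) * X + B y * B' y * (X * X)); first ring.
by rewrite H; ring.
Qed.
Lemma PFXB f g : PFX f -> PFX g -> PFX (fun y X => f y X - g y X).
Proof.
move=> pf pg; apply: PFX_ext (PFXD pf (PFXM (PFXy (PFc T (-1))) pg)) => y X.
by rewrite mulN1r.
Qed.
Lemma PFX_sum (J : Type) (r : seq J) (P : pred J) (f : J -> Y -> K -> K) :
  (forall j, PFX (f j)) -> PFX (fun y X => \sum_(j <- r | P j) f j y X).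
Proof.
move=> pf; elim: r => [|j r IH].
  by apply: PFX_ext (PFXy (PFc T 0)) => y X; rewrite big_nil.
case Pj : (P j).
  by apply: PFX_ext (PFXD (pf j) IH) => y X; rewrite big_cons Pj.
by apply: PFX_ext IH => y X; rewrite big_cons Pj.
Qed.
Lemma PFX_mom m (d : quad m K) S (kk : 'I_m -> 'I_m -> Y -> K -> K) (n : 'I_m -> Y -> K -> K) w :
  PFX S -> (forall a b, PFX (kk a b)) -> (forall a, PFX (n a)) -> PFX w ->
  PFX (fun y X => mom d (S y X) (fun a b => kk a b y X) (fun a => n a y X) (w y X)).
Proof.
move=> pS pk pn pw; apply: PFXD; [apply: PFXD; [apply: PFXD|]|].
- by apply: PFXM => //; apply/PFXy/PFc.
- by apply: PFX_sum => a; apply: PFX_sum => b; apply: PFXM => //; apply/PFXy/PFc.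
- by apply: PFX_sum => b; apply: PFXM => //; apply/PFXy/PFc.
- by apply: PFXM => //; apply/PFXy/PFc.
Qed.

(* If neither root of X^2 = del X + kap satisfied all the relations, the norm of a suitable relation would be a polynomial that vanishes on the image but not at [y]. *)
Lemma lift_root (J : Type) (z : J -> Y) (sig : J -> K) (y : Y) :
  (forall j, sig j * sig j = del (z j) * sig j + kap (z j)) ->
  (forall f, PF f -> (forall j, f (z j) = 0) -> f y = 0) ->
  exists s, s * s = del y * s + kap y /\
    forall f, PFX f -> (forall j, f (z j) (sig j) = 0) -> f y s = 0.
Proof.
move=> sigE yz; pose r := sqrtC (del y * del y + 4 * kap y).
have rr : r * r = del y * del y + 4 * kap y by rewrite -expr2 sqrtCK.
pose s1 := (del y + r) / 2; pose s2 := (del y - r) / 2.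
have two : 2 != 0 :> K by rewrite pnatr_eq0.
have E12 : s1 + s2 = del y by rewrite /s1 /s2; field.
have P12 : s1 * s2 = - kap y.
  transitivity ((del y * del y - r * r) / 4); first by rewrite /s1 /s2; field.
  by rewrite rr; field.
have root s : s = s1 \/ s = s2 -> s * s = del y * s + kap y.
  by rewrite -[kap y]opprK -P12 -E12; case=> ->; ring.
apply: contrapT => none.
have bad s : s = s1 \/ s = s2 -> exists f, [/\ PFX f, forall j, f (z j) (sig j) = 0 & f y s != 0].
  move=> ss; apply: contrapT => H; apply: none; exists s; split; first exact: root.
  move=> f pf fz; apply/eqP; apply: contrapT => /negP fs; apply: H; by exists f.
have [f1 [pf1 fz1 fs1]] := bad s1 (or_introl erefl).
have [f2 [pf2 fz2 fs2]] := bad s2 (or_intror erefl).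
have [f [pf fz g1 g2]] : exists f, [/\ PFX f, forall j, f (z j) (sig j) = 0, f y s1 != 0 & f y s2 != 0].
  (* If each of [f1], [f2] vanishes at the other's root, their sum vanishes at neither root. *)
  have [E1|] := eqVneq (f1 y s2) 0; last by exists f1.
  have [E2|] := eqVneq (f2 y s1) 0; last by exists f2.
  exists (fun y X => f1 y X + f2 y X); split; first exact: PFXD.
  - by move=> j; rewrite fz1 fz2 addr0.
  - by rewrite E2 addr0.
  - by rewrite E1 add0r.
case: pf => [[A B] /= [pA pB fE]].
have : A y * A y + A y * B y * del y - B y * B y * kap y = 0.
  apply: (yz (fun y => A y * A y + A y * B y * del y - B y * B y * kap y)).
    by apply: PFB; [apply: PFD|]; repeat apply: PFM.
  move=> j; have := fz j; rewrite fE // => /eqP; rewrite addr_eq0 => /eqP ->.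
  transitivity (B (z j) * B (z j) * (sig j * sig j - (del (z j) * sig j + kap (z j)))); first ring.
  by rewrite sigE subrr mulr0.
have : f y s1 * f y s2 != 0 by rewrite mulf_neq0.
rewrite (fE _ _ (root _ (or_introl erefl))) (fE _ _ (root _ (or_intror erefl))) => + N; case/eqP; rewrite -[RHS]N.
transitivity (A y * A y + A y * B y * (s1 + s2) + B y * B y * (s1 * s2)); first ring.
by rewrite E12 P12; ring.
Qed.
End QuadraticExtension.

(** The relations give [k_ab^2 = k_aa k_bb], so a zero diagonal forces [k = 0]; otherwise a column
    is divided by the square root of its nonzero diagonal entry. *)
Lemma rank_one (K : numClosedFieldType) m (k : 'I_m -> 'I_m -> K) :
  (forall a b, k a b = k b a) ->
  (forall a b c d, k a b * k c d = k a c * k b d) ->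
  exists e : 'I_m -> K, forall a b, k a b = e a * e b.
Proof.
move=> kC kk; have [/existsP[c kc]|] := boolP [exists c, k c c != 0]; last first.
  rewrite negb_exists => /forallP k0; exists (fun=> 0) => a b; rewrite mulr0.
  have := kk a b a b; have := k0 a; rewrite negbK => /eqP ->; rewrite mul0r => /eqP.
  by rewrite mulf_eq0 orbb => /eqP.
have rc : sqrtC (k c c) != 0 by rewrite sqrtC_eq0.
have rr : sqrtC (k c c) * sqrtC (k c c) = k c c by rewrite -expr2 sqrtCK.
move: (sqrtC _) rc rr => r rc rr; exists (fun a => k a c / r) => a b.
by apply: (mulIf kc); rewrite kk -rr; field.
Qed.

Section Lift.
Variables (K : numClosedFieldType) (m : nat) (T : 'I_m.+1 -> finType).
Variables (D : forall i, T i -> quad m K) (c : cone D).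
Hypothesis m_gt0 : (0 < m)%N.
Variable y : forall i, T i -> K.
Arguments y : clear implicits.
Hypothesis y_nz : forall i, exists t, y i t != 0.
Hypothesis y_closure : forall f, PF f -> (forall rho u v, f (chart D rho u v) = 0) -> f y = 0.
Hypothesis W0 : cW c ord0 y = 0.
Local Notation Y := (forall i, T i -> K).

(* On the chart, rho v_0^2 is a root of X^2 = del X + kap with del, kap among the coordinates; adjoining it recovers the middle moments from their traceless part. *)
Lemma boundary_mid (i0 : 'I_m.+1) : (0 < i0 < m)%N ->
  exists (S : K) (z : 'I_m -> K), (S != 0) || [exists a, z a != 0] /\
    forall i (h : T i -> K), (0 < i < m)%N -> lam h y = 0 ->
      qu (qlin h (@D i)) * S + quadpart (qlin h (@D i)) z = 0.
Proof.
move=> im0; have m2 : (1 < m)%N by lia.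
pose a0 := Ordinal m_gt0; pose a1 := Ordinal m2.
have a01 : a0 != a1 by [].
pose del (y : Y) := - lam (hd c i0 a1 a0) y.
pose kap (y : Y) := lam (hk c i0 a0 a1) y * lam (hk c i0 a0 a1) y.
have pdel : PF del by apply/PFN/PFlam.
have pkap : PF kap by apply: PFM; apply: PFlam.
pose J := (('I_m.+1 -> K) * K * ('I_m -> K))%type.
pose z (j : J) := chart D j.1.1 j.1.2 j.2.
pose sig (j : J) := j.1.1 i0 * (j.2 a0 * j.2 a0).
have sigE j : sig j * sig j = del (z j) * sig j + kap (z j).
  by rewrite /del /kap /z /sig !lam_chart hdE // hkE //; ring.
have yz f : PF f -> (forall j, f (z j) = 0) -> f y = 0.
  by move=> pf fz; apply: y_closure => // rho u v; apply: (fz (rho, u, v)).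
have [s [sE sz]] := lift_root pdel pkap sigE yz.
have seq f g : PFX del kap f -> PFX del kap g ->
    (forall j, f (z j) (sig j) = g (z j) (sig j)) -> f y s = g y s.
  move=> pf pg fg; apply/eqP; rewrite -subr_eq0; apply/eqP.
  by apply: (sz (fun y X => f y X - g y X)) => [|j]; [apply: (PFXB pdel pkap) | rewrite fg subrr].
(* With [X] in the role of rho v_0^2, these three are rho v_a^2, rho v_a v_b and rho u. *)
pose sg a (y : Y) (X : K) := X + lam (hd c i0 a a0) y.
pose kk a b (y : Y) (X : K) := if a == b then sg a y X else lam (hk c i0 a b) y.
pose SS (y : Y) (X : K) := lam (hA c i0) y + \sum_(b in A c i0) sg b y X.
have plam i (h : T i -> K) : PFX del kap (fun y _ => lam h y) by apply/PFXy/PFlam.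
have psg a : PFX del kap (sg a) by apply: PFXD => //; apply: PFXX.
have pkk a b : PFX del kap (kk a b) by rewrite /kk; case: eqP.
have pSS : PFX del kap SS by apply: PFXD => //; apply: PFX_sum.
have sgz a j : sg a (z j) (sig j) = j.1.1 i0 * (j.2 a * j.2 a).
  by rewrite /sg /z /sig lam_chart hdE //; ring.
have kkz a b j : kk a b (z j) (sig j) = j.1.1 i0 * (j.2 a * j.2 b).
  rewrite /kk; case: eqVneq => [<-|ab]; first exact: sgz.
  by rewrite /z lam_chart hkE.
have SSz j : SS (z j) (sig j) = j.1.1 i0 * j.1.2.
  rewrite /SS /z lam_chart hAE // mulrBr mulr_sumr.
  by rewrite (eq_bigr _ (fun a _ => sgz a j)) subrK.
pose S := SS y s; pose k a b := kk a b y s.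
have kC a b : k a b = k b a.
  by apply: (seq (kk a b) (kk b a)) => // j; rewrite !kkz; ring.
have kkE a b d e : k a b * k d e = k a d * k b e.
  apply: (seq (fun y X => kk a b y X * kk d e y X) (fun y X => kk a d y X * kk b e y X)).
  - exact: (PFXM pdel pkap).
  - exact: (PFXM pdel pkap).
  by move=> j; rewrite !kkz; ring.
have [e eE] := rank_one kC kkE.
have w0 : cW c i0 y = 0 := mid_W0 y_nz y_closure W0 im0.
(* The squares of the linear moments are multiples of [cW], which vanishes at [y]. *)
have n0 a : cV c i0 a y = 0.
  have : cV c i0 a y * cV c i0 a y = cW c i0 y * k a a.
    apply: (seq (fun y X => cV c i0 a y * cV c i0 a y) (fun y X => cW c i0 y * kk a a y X)).
    - by apply: (PFXM pdel pkap); apply: (plam _ (hv c i0 a)).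
    - by apply: (PFXM pdel pkap) => //; apply: (plam _ (h1 c i0)).
    by move=> j; rewrite kkz /z cV_chart cW_chart; ring.
  by rewrite w0 mul0r => /eqP; rewrite mulf_eq0 orbb => /eqP.
pose M i (t : T i) (y : Y) X := mom (D t) (SS y X) (fun a b => kk a b y X)
  (fun a => cV c i0 a y) (cW c i0 y).
have pM i (t : T i) : PFX del kap (M i t) by apply: (PFX_mom pdel pkap) => // [a|]; [apply: (plam _ (hv c i0 a)) | apply: (plam _ (h1 c i0))].
have Mz i (t : T i) j : M i t (z j) (sig j) = j.1.1 i0 * qval (D t) j.1.2 j.2.
  rewrite -mom_scale; apply: eq_mom => [|a b|a|]; rewrite ?SSz ?kkz //.
    by rewrite /z cV_chart.
  by rewrite /z cW_chart.
have My i (t : T i) : M i t y s = qu (D t) * S + quadpart (D t) e.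
  by rewrite /M -mom0; apply: eq_mom => // a b; apply: eE.
(* The block [y i0] is itself the vector of forms at these moments, so it would be zero if [S] and
   [e] were. *)
exists S, e; have nz : (S != 0) || [exists a, e a != 0].
  have [t] := y_nz i0; apply: contraNT; rewrite negb_or negbK negb_exists => /andP[/eqP SS0 /forallP e0].
  have yM : y i0 t = M i0 t y s.
    apply: (seq (fun y _ => y i0 t) (M i0 t)) => //; exact/PFXy/PFy.
  rewrite yM My SS0 mulr0 add0r /quadpart big1 // => a _; rewrite big1 // => b _.
  by have := e0 b; rewrite negbK => /eqP ->; rewrite mulr0.
split=> // i h im hy.
have [|r r0 rE] := mid_proportional c m_gt0 y_nz im nz.
  move=> t t'; rewrite -!My.
  apply: (seq (fun y X => M i t y X * y i t') (fun y X => M i t' y X * y i t)).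
  - by apply: (PFXM pdel pkap) => //; apply/PFXy/PFy.
  - by apply: (PFXM pdel pkap) => //; apply/PFXy/PFy.
  by move=> j; rewrite !Mz /z /chart; ring.
exact: mid_equation r0 rE hy.
Qed.
End Lift.

(** * Quadratic functions under ring morphisms and elimination *)

Definition qmap (R S : Type) m (f : R -> S) (d : quad m R) : quad m S :=
  Quad (f (q0 d)) (fun b => f (q1 d b)) (f (qu d)) (fun a b => f (q2 d a b)).

Section QuadMaps.
Variables (m : nat) (R S : comNzRingType) (f : {rmorphism R -> S}).
Implicit Types (d e : quad m R) (v : 'I_m -> R).

Lemma rmorph_quadpart d v : f (quadpart d v) = quadpart (qmap f d) (fun a => f (v a)).
Proof.
rewrite /quadpart rmorph_sum; apply: eq_bigr => a _; rewrite rmorph_sum.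
by apply: eq_bigr => b _; rewrite !rmorphM.
Qed.
Lemma rmorph_linpart d v : f (linpart d v) = linpart (qmap f d) (fun a => f (v a)).
Proof. by rewrite /linpart rmorph_sum; apply: eq_bigr => a _; rewrite rmorphM. Qed.
Lemma rmorph_qval d u v : f (qval d u v) = qval (qmap f d) (f u) (fun a => f (v a)).
Proof. by rewrite !qvalE !rmorphD rmorphM rmorph_quadpart rmorph_linpart. Qed.

(* The combination that eliminates [u]. *)
Definition qcomb p d : quad m R := Quad (qu p * q0 d - qu d * q0 p)
  (fun b => qu p * q1 d b - qu d * q1 p b) 0 (fun a b => qu p * q2 d a b - qu d * q2 p a b).

Lemma quadpart_qcomb p d v : quadpart (qcomb p d) v = qu p * quadpart d v - qu d * quadpart p v.
Proof.
rewrite /quadpart !mulr_sumr -sumrB; apply: eq_bigr => a _.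
by rewrite !mulr_sumr -sumrB; apply: eq_bigr => b _ /=; ring.
Qed.
Lemma linpart_qcomb p d v : linpart (qcomb p d) v = qu p * linpart d v - qu d * linpart p v.
Proof.
by rewrite /linpart !mulr_sumr -sumrB; apply: eq_bigr => a _ /=; ring.
Qed.
Lemma qval_qcomb p d u v : qval (qcomb p d) 0 v = qu p * qval d u v - qu d * qval p u v.
Proof. by rewrite !qvalE quadpart_qcomb linpart_qcomb /=; ring. Qed.

End QuadMaps.

Lemma qmap_qcomb m (R S : comNzRingType) (f : {rmorphism R -> S}) (p d : quad m R) :
  qmap f (qcomb p d) = qcomb (qmap f p) (qmap f d).
Proof.
rewrite /qmap /qcomb /= rmorphB !rmorphM rmorph0; congr Quad.
  by apply/funext => b; rewrite rmorphB !rmorphM.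
by apply/funext => a; apply/funext => b; rewrite rmorphB !rmorphM.
Qed.

Lemma qmap_comp m (R S U : Type) (f : R -> S) (g : S -> U) (d : quad m R) :
  qmap g (qmap f d) = qmap (g \o f) d.
Proof. by []. Qed.

Lemma qmap_qlin m (R S : comNzRingType) (f : {rmorphism R -> S}) (I : finType) (h : I -> R)
    (D : I -> quad m R) : qmap f (qlin h D) = qlin (f \o h) (fun t => qmap f (D t)).
Proof.
rewrite /qmap /qlin /=; congr Quad.
- by rewrite rmorph_sum; apply: eq_bigr => t _; rewrite rmorphM.
- by apply/funext => b; rewrite rmorph_sum; apply: eq_bigr => t _; rewrite rmorphM.
- by rewrite rmorph_sum; apply: eq_bigr => t _; rewrite rmorphM.
- by apply/funext => a; apply/funext => b; rewrite rmorph_sum; apply: eq_bigr => t _; rewrite rmorphM.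
Qed.

Definition polar m (R : comNzRingType) (d : quad m R) (v w : 'I_m -> R) :=
  \sum_a \sum_b (q2 d a b + q2 d b a) * v a * w b.

Lemma quadpartD m (R : comNzRingType) (d : quad m R) (v w : 'I_m -> R) :
  quadpart d (fun a => v a + w a) = quadpart d v + quadpart d w + polar d v w.
Proof.
pose X (v w : 'I_m -> R) := \sum_a \sum_b q2 d a b * v a * w b.
have -> : polar d v w = X v w + X w v.
  rewrite /polar [X w v]exchange_big -big_split; apply: eq_bigr => a _.
  by rewrite -big_split; apply: eq_bigr => b _ /=; ring.
rewrite -[quadpart d v]/(X v v) -[quadpart d w]/(X w w) -!big_split; apply: eq_bigr => a _.
by rewrite -!big_split; apply: eq_bigr => b _ /=; ring.
Qed.

(* A quadratic function on [K^m] determines its values in any torsion-free [K]-algebra. *)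
Lemma qval_transfer m (K : numFieldType) (d e : quad m K) :
  (forall v, qval d 0 v = qval e 0 v) ->
  forall w : 'I_m -> {mpoly K[m]},
    qval (qmap (@mpolyC m K) d) 0 w = qval (qmap (@mpolyC m K) e) 0 w.
Proof.
pose cut (c : quad m K) := Quad (q0 c) (q1 c) 0 (q2 c).
move=> de; have [|_ E0 E2 E1] := @qval_eq m K (cut d) (cut e).
  by move=> u v; have := de v; rewrite !qvalE /= !mul0r !mulr0.
pose dl (a b : 'I_m) : K := (b == a)%:R.
have F1 b : q1 d b = q1 e b.
  have H c : linpart (cut c) (dl b) = q1 c b.
    rewrite /linpart (bigD1 b) //= /dl eqxx mulr1 big1 ?addr0 // => j jb.
    by rewrite (negPf jb) mulr0.
  by rewrite -!H E1.
have F2 a b : q2 d a b + q2 d b a = q2 e a b + q2 e b a.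
  have H c : quadpart (cut c) (fun j => dl a j + dl b j) - quadpart (cut c) (dl a)
      - quadpart (cut c) (dl b) = q2 c a b + q2 c b a.
    rewrite quadpartD /polar (bigD1 a) //= (bigD1 b) //= /dl !eqxx !mulr1 !big1 ?addr0; first by ring.
      by move=> j ja; rewrite big1 // => l _; rewrite (negPf ja) mulr0 mul0r.
    by move=> j jb; rewrite (negPf jb) mulr0.
  by rewrite -!H !E2.
move=> w; rewrite !qvalE /= !mulr0 !add0r (_ : q0 d = q0 e) //; congr (_ + _ + _).
  have dbl (c : quad m K) : quadpart (qmap (@mpolyC m K) c) w *+ 2 =
      \sum_a \sum_b (q2 c a b + q2 c b a)%:MP * w a * w b.
    rewrite mulr2n {2}/quadpart exchange_big -big_split; apply: eq_bigr => a _.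
    by rewrite -big_split; apply: eq_bigr => b _ /=; rewrite mpolyCD; ring.
  have := dbl d; rewrite (_ : \sum_a _ = quadpart (qmap (@mpolyC m K) e) w *+ 2); last first.
    by rewrite dbl; do 2!apply: eq_bigr => ? _; rewrite F2.
  move=> H; apply/mpolyP => i; have /eqP := congr1 (mcoeff i) H.
  by rewrite !mcoeffMn eqrMn2r // => /eqP.
by apply: eq_bigr => b _ /=; rewrite F1.
Qed.

(** * Minors of the forms on CW_n *)

Section DetExpansion.
Variable R : comNzRingType.

(** Multilinearity in the rows: a form of Cauchy-Binet summed over all functions rather than
    increasing ones, so that neither order nor signs intervene. *)
Lemma det_mul_fun r N (A : 'M[R]_(r, N)) (B : 'M[R]_(N, r)) :
  \det (A *m B) = \sum_(f : {ffun 'I_r -> 'I_N}) (\prod_i A i (f i)) * \det (rowsub f B).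
Proof.
rewrite /determinant; under [RHS]eq_bigr do rewrite mulr_sumr.
rewrite exchange_big /=; apply: eq_bigr => s _.
under eq_bigr do rewrite mxE; rewrite bigA_distr_bigA mulr_sumr /=.
apply: eq_bigr => f _; rewrite mulrCA; congr (_ * _).
by rewrite -big_split; apply: eq_bigr => i _ /=; rewrite !mxE.
Qed.

Lemma det_mxsub_mul r N N' (G : 'M[R]_(N, N')) (M : 'M[R]_N') (f g : 'I_r -> 'I_N) :
  \det (mxsub f g (G *m M *m G^T)) =
  \sum_(f' : {ffun 'I_r -> 'I_N'}) \sum_(g' : {ffun 'I_r -> 'I_N'})
    (\prod_i G (f i) (f' i)) * (\prod_i G (g i) (g' i)) * \det (mxsub f' g' M).
Proof.
have -> : mxsub f g (G *m M *m G^T) = rowsub f G *m (M *m (rowsub g G)^T).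
  by rewrite mulmxA mul_rowsub_mx mxsub_mul trmx_mxsub.
rewrite det_mul_fun; apply: eq_bigr => f' _.
rewrite -mul_rowsub_mx -(det_tr (_ *m _)) trmx_mul trmxK det_mul_fun mulr_sumr.
apply: eq_bigr => g' _; rewrite mulrA; congr (_ * _).
  by congr (_ * _); apply: eq_bigr => i _; rewrite mxE.
by rewrite -det_tr; congr (\det _); apply/matrixP => i j; rewrite !mxE.
Qed.

Lemma det_mxsub_perm r N (M : 'M[R]_N) (f g : 'I_r -> 'I_N) (s t : 'S_r) :
  \det (mxsub (f \o s) (g \o t) M) = (-1) ^+ s * (-1) ^+ t * \det (mxsub f g M).
Proof.
have -> : mxsub (f \o s) (g \o t) M = row_perm s (col_perm t (mxsub f g M)).
  by apply/matrixP => i j; rewrite !mxE.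
by rewrite row_permE col_permE !det_mulmx !det_perm odd_permV [\det _ * _]mulrC mulrA.
Qed.

Lemma det_mxsub_noninj r N (M : 'M[R]_N) (f g : 'I_r -> 'I_N) :
  ~ injective f \/ ~ injective g -> \det (mxsub f g M) = 0.
Proof.
have H (f' g' : 'I_r -> 'I_N) (M' : 'M[R]_N) : ~ injective f' -> \det (mxsub f' g' M') = 0.
  move=> fi; have [i [j [ij fij]]] : exists i j, i != j /\ f' i = f' j.
    apply: contrapT => N'; apply: fi => i j fij; apply/eqP; apply: contrapT => /negP ij.
    by apply: N'; exists i, j.
  by apply: (determinant_alternate ij) => l; rewrite !mxE fij.
case=> [/H->//|gi]; rewrite -det_tr trmx_mxsub; exact: H.
Qed.

End DetExpansion.

Section Sorting.
Variables (R : comNzRingType) (N r : nat).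

Lemma sort_fun (f : 'I_r -> 'I_N) : injective f ->
  exists (s : wedge_idx N r) (p : 'S_r), f =1 tnth (val s) \o p.
Proof.
move=> fi; pose t := [tuple f i | i < r].
pose leqv := fun x y : 'I_N => (val x <= val y)%N.
have /tuple_permP[p pE] : perm_eq t [tuple of sort leqv t] by rewrite perm_sym perm_sort.
have st : sorted ltn [seq val i | i <- [tuple of sort leqv t]].
  rewrite ltn_sorted_uniq_leq map_inj_uniq; last exact: val_inj.
  rewrite sort_uniq map_inj_uniq ?enum_uniq //=.
  rewrite (@sorted_map _ _ val leq); apply: sort_sorted => x y; exact: leq_total.
exists (exist _ [tuple of sort leqv t] st), p => i /=.
have := congr1 (fun s => nth (f i) s i) pE; rewrite -!tnth_nth !tnth_mktuple; exact.
Qed.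

(** A repeated row or column gives zero; otherwise both selections are sorted at the cost of signs,
    and the symmetry of [M] allows the two sorted sets to be exchanged to fit [sym_idx]. *)
Lemma minor_compound (f g : 'I_r -> 'I_N) : exists h : sym_idx N r -> R,
  forall M : 'M[R]_N, M^T = M ->
    \det (mxsub f g M) = \sum_t h t * \det (mxsub (tnth (val (val t).1)) (tnth (val (val t).2)) M).
Proof.
have [fi|fi] := pselect (injective f); last first.
  exists (fun=> 0) => M _; rewrite det_mxsub_noninj; last by left.
  by rewrite big1 // => t _; rewrite mul0r.
have [gi|gi] := pselect (injective g); last first.
  exists (fun=> 0) => M _; rewrite det_mxsub_noninj; last by right.
  by rewrite big1 // => t _; rewrite mul0r.
have [s [p fE]] := sort_fun fi; have [t [p' gE]] := sort_fun gi.
have [x xE] : exists x : sym_idx N r, val x = (s, t) \/ val x = (t, s).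
  case: (leqP (enum_rank s) (enum_rank t)) => st.
    by exists (exist _ (s, t) st); left.
  by exists (exist _ (t, s) (ltnW st)); right.
exists (fun y => if y == x then (-1) ^+ p * (-1) ^+ p' else 0) => M MT.
rewrite (bigD1 x) //= eqxx big1 ?addr0 => [|y /negPf->]; last by rewrite mul0r.
have -> : mxsub f g M = mxsub (tnth (val s) \o p) (tnth (val t) \o p') M.
  by apply/matrixP => i j; rewrite !mxE fE gE.
rewrite det_mxsub_perm; congr (_ * _); case: xE => -> //=.
by rewrite -det_tr trmx_mxsub MT.
Qed.

End Sorting.

Definition Mst_ul (R : comNzRingType) (u w : R) : 'M[R]_2 :=
  \matrix_(i, j) (if (i == 0) && (j == 0) then u else if i == j then 0 else w).
Definition Mst_ur (R : comNzRingType) m (v : 'I_m -> R) : 'M[R]_(2, m) :=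
  \matrix_(i, b) (if i == 0 then v b else 0).

(* The Gram matrix of the form (x, y) |-> l (x y) in the basis 1, x_0 ^ 2, x_0, x_1, ..., where u = l 1, w = l (x_0 ^ 2) and v b = l (x_b). *)
HB.lock Definition Mst (R : comNzRingType) m u (v : 'I_m -> R) w : 'M[R]_(2 + m) :=
  block_mx (Mst_ul u w) (Mst_ur v) (Mst_ur v)^T w%:M.

Section StdMatrix.
Variables (R : comNzRingType) (m : nat).
Implicit Types (u w : R) (v : 'I_m -> R).

Definition i1 : 'I_(2 + m) := lshift m 0.
Definition iq : 'I_(2 + m) := lshift m 1.
Definition ix (b : 'I_m) : 'I_(2 + m) := rshift 2 b.

Lemma ixP (i : 'I_(2 + m)) : [\/ i = i1, i = iq | exists b, i = ix b].
Proof.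
case: (split_ordP i) => [j ->|b ->]; last by constructor 3; exists b.
by case: j => [[|[|//]] H]; [constructor 1 | constructor 2]; congr lshift; apply: val_inj.
Qed.

Lemma Mst11 u v w : Mst u v w i1 i1 = u.
Proof. by rewrite unlock block_mxEul mxE. Qed.
Lemma Mst1q u v w : Mst u v w i1 iq = w.
Proof. by rewrite unlock block_mxEul mxE. Qed.
Lemma Mst1x u v w b : Mst u v w i1 (ix b) = v b.
Proof. by rewrite unlock block_mxEur mxE. Qed.
Lemma Mstq1 u v w : Mst u v w iq i1 = w.
Proof. by rewrite unlock block_mxEul mxE. Qed.
Lemma Mstqq u v w : Mst u v w iq iq = 0.
Proof. by rewrite unlock block_mxEul mxE. Qed.
Lemma Mstqx u v w b : Mst u v w iq (ix b) = 0.
Proof. by rewrite unlock block_mxEur mxE. Qed.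
Lemma Mstx1 u v w b : Mst u v w (ix b) i1 = v b.
Proof. by rewrite unlock block_mxEdl !mxE. Qed.
Lemma Mstxq u v w b : Mst u v w (ix b) iq = 0.
Proof. by rewrite unlock block_mxEdl !mxE. Qed.
Lemma Mstxx u v w a b : Mst u v w (ix a) (ix b) = w *+ (a == b).
Proof. by rewrite unlock block_mxEdr !mxE. Qed.
Definition MstE := (Mst11, Mst1q, Mst1x, Mstq1, Mstqq, Mstqx, Mstx1, Mstxq, Mstxx).

Lemma Mst_tr u v w : (Mst u v w)^T = Mst u v w.
Proof.
apply/matrixP => i j; rewrite mxE.
case: (ixP i) => [->|->|[a ->]]; case: (ixP j) => [->|->|[b ->]]; rewrite ?MstE //.
by rewrite eq_sym.
Qed.

Lemma Mst_scale u v w r : Mst (r * u) (fun b => r * v b) (r * w) = r *: Mst u v w.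
Proof.
apply/matrixP => i j; rewrite [RHS]mxE.
case: (ixP i) => [->|->|[a ->]]; case: (ixP j) => [->|->|[b ->]]; rewrite ?MstE ?mulr0 //.
by rewrite mulrnAr.
Qed.

Lemma Mst_const u v w i j : i != i1 -> j != i1 -> Mst u v w i j = Mst 0 (fun=> 0) w i j.
Proof.
by case: (ixP i) => [->|->|[a ->]]; case: (ixP j) => [->|->|[b ->]]; rewrite ?eqxx // ?MstE.
Qed.

(* The inverse of [Mst u v 1]. *)
Definition Minv u v : 'M[R]_(2 + m) :=
  block_mx (\matrix_(i, j) (if (i == 1) && (j == 1) then \sum_b v b * v b - u else if i == j then 0 else 1))
    (\matrix_(i, b) (if i == 1 then - v b else 0))
    (\matrix_(b, i) (if i == 1 then - v b else 0)) 1%:M.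

Lemma Mst_Minv u v : Mst u v 1 *m Minv u v = 1%:M.
Proof.
rewrite [RHS]scalar_mx_block /Minv unlock mulmx_block; congr block_mx; apply/matrixP => i j.
- rewrite !mxE !big_ord_recl big_ord0 !mxE /=.
  have -> : \sum_l Mst_ur v i l * (\matrix_(b < m, i0 < 2) (if i0 == 1 then - v b else 0)) l j =
      (if (i == 0) && (j == 1) then - \sum_b v b * v b else 0).
    case: ifP => [/andP[/eqP -> /eqP ->]|/negbT].
      by rewrite -sumrN; apply: eq_bigr => l _; rewrite !mxE eqxx mulrN.
    rewrite negb_and => H; rewrite big1 // => l _; rewrite !mxE.
    by case/orP: H => /negPf ->; rewrite ?mul0r ?mulr0.
  by case: i => [[|[|//]] Hi]; case: j => [[|[|//]] Hj]; rewrite /=; try ring.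
- rewrite mulmx1 !mxE !big_ord_recl big_ord0 !mxE /=.
  by case: i => [[|[|//]] Hi] /=; ring.
- rewrite mul_scalar_mx scale1r !mxE !big_ord_recl big_ord0 !mxE /=.
  by case: j => [[|[|//]] Hj] /=; ring.
- rewrite mul_scalar_mx scale1r !mxE !big_ord_recl big_ord0 !mxE /=; ring.
Qed.

Lemma det_Mst u v : \det (Mst u v 1) = -1.
Proof.
have -> : Mst u v 1 = block_mx 1%:M (Mst_ur v) 0 1%:M *m
    block_mx (Mst_ul (u - \sum_b v b * v b) 1) 0 (Mst_ur v)^T 1%:M.
  rewrite mulmx_block !mul1mx !mul0mx !mulmx1 !add0r unlock; congr block_mx.
  apply/matrixP => i j; rewrite !mxE.
  have -> : \sum_l Mst_ur v i l * (Mst_ur v)^T l j =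
      (if (i == 0) && (j == 0) then \sum_b v b * v b else 0).
    case: ifP => [/andP[/eqP -> /eqP ->]|/negbT].
      by apply: eq_bigr => l _; rewrite !mxE eqxx.
    rewrite negb_and => H; rewrite big1 // => l _; rewrite !mxE.
    by case/orP: H => /negPf ->; rewrite ?mul0r ?mulr0.
  by case: ifP; rewrite ?subrK ?addr0.
rewrite det_mulmx det_ublock det_lblock !det1 !mul1r mulr1.
rewrite (expand_det_row _ 0) !big_ord_recl big_ord0 /cofactor !det_mx11 !mxE /=.
by rewrite /bump /=; ring.
Qed.

(** Up to sign, the entries of the adjugate are the minors of the last factor. *)
Lemma adj_Mst u v : \adj (Mst u v 1) = - Minv u v.
Proof. by rewrite -[LHS]mulmx1 -(Mst_Minv u v) mulmxA mul_adj_mx det_Mst mul_scalar_mx scaleN1r. Qed.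

End StdMatrix.

(** * The shape of the minors as functions of [u] and [v] *)

Section Forms.
Variables (K : numClosedFieldType) (m : nat).
Implicit Types (C : quad m K -> Prop) (F : K -> ('I_m -> K) -> K).

Definition FP C F := exists2 d, C d & forall u v, F u v = qval d u v.
Definition stable C := forall (I : finType) (h : I -> K) (D : I -> quad m K),
  (forall t, C (D t)) -> C (qlin h D).

(** [C1] and [C2] are the shapes found in the first and the last factor: no quadratic part,
    respectively a quadratic part tied to the coefficient of [u] as in [u - |v|^2]. [C0] serves the
    middle factors. *)
Definition C0 (d : quad m K) := True.
Definition C1 (d : quad m K) := forall a b, q2 d a b = 0.
Definition C2 (d : quad m K) := forall a b, q2 d a b = - qu d *+ (a == b).

Lemma stable0 : stable C0. Proof. by []. Qed.
Lemma stable1 : stable C1.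
Proof. by move=> I h D CD a b; rewrite /= big1 // => t _; rewrite CD mulr0. Qed.
Lemma stable2 : stable C2.
Proof.
move=> I h D CD a b /=; rewrite -sumrN -sumrMnl; apply: eq_bigr => t _.
by rewrite CD mulrnAr mulrN.
Qed.

Lemma FP_sum C (I : finType) (h : I -> K) (F : I -> K -> ('I_m -> K) -> K) : stable C ->
  (forall t, FP C (F t)) -> FP C (fun u v => \sum_t h t * F t u v).
Proof.
move=> sC H; pose D t := s2val (cid2 (H t)); exists (qlin h D).
  by apply: sC => t; apply: (s2valP (cid2 (H t))).
by move=> u v; rewrite qval_qlin; apply: eq_bigr => t _; rewrite (s2valP' (cid2 (H t))).
Qed.

Lemma FP_ext C F G : (forall u v, F u v = G u v) -> FP C F -> FP C G.
Proof. by move=> FG [d Cd dE]; exists d => // u v; rewrite -FG. Qed.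

Lemma FPZ C c F : stable C -> FP C F -> FP C (fun u v => c * F u v).
Proof.
move=> sC [d Cd dE]; have := @FP_sum C unit (fun=> c) (fun=> F) sC (fun=> ex_intro2 _ _ d Cd dE).
by apply: FP_ext => u v; rewrite big_const card_unit /= addr0.
Qed.

Lemma FPc C c : C (qlin (fun=> c) (fun _ : unit => e1 m K)) -> FP C (fun _ _ => c).
Proof.
move=> Cc; exists (qlin (fun=> c) (fun _ : unit => e1 m K)) => // u v.
by rewrite qval_qlin big_const card_unit /= qval_e1 mulr1 addr0.
Qed.

Definition affine (F : ('I_m -> K) -> K) := exists l c, forall v, F v = \sum_b l b * v b + c.

Lemma affine_const c : affine (fun=> c).
Proof. by exists (fun=> 0), c => v; rewrite big1 ?add0r // => b _; rewrite mul0r. Qed.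
Lemma affine_var b : affine (fun v => v b).
Proof.
exists (fun a => (a == b)%:R), 0 => v; rewrite (bigD1 b) //= eqxx mul1r addr0.
by rewrite big1 ?addr0 // => a /negPf ->; rewrite mul0r.
Qed.
Lemma affine_ext (F G : ('I_m -> K) -> K) : (forall v, F v = G v) -> affine F -> affine G.
Proof. by move=> FG [l [c E]]; exists l, c => v; rewrite -FG. Qed.
Lemma affineD (F G : ('I_m -> K) -> K) : affine F -> affine G -> affine (fun v => F v + G v).
Proof.
move=> [l [c E]] [l' [c' E']]; exists (fun b => l b + l' b), (c + c') => v.
by rewrite E E' addrACA -big_split; congr (_ + _); apply: eq_bigr => b _; rewrite mulrDl.
Qed.
Lemma affineZ c (F : ('I_m -> K) -> K) : affine F -> affine (fun v => c * F v).
Proof.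
move=> [l [c' E]]; exists (fun b => c * l b), (c * c') => v.
by rewrite E mulrDr mulr_sumr; congr (_ + _); apply: eq_bigr => b _; rewrite mulrA.
Qed.
Lemma affine_sum (I : Type) (r : seq I) (F : I -> ('I_m -> K) -> K) :
  (forall i, affine (F i)) -> affine (fun v => \sum_(i <- r) F i v).
Proof.
move=> AF; elim: r => [|i r IH].
  by apply: affine_ext (affine_const 0) => v; rewrite big_nil.
by apply: affine_ext (affineD (AF i) IH) => v; rewrite big_cons.
Qed.

Lemma FP_affineM (F G : ('I_m -> K) -> K) : affine F -> affine G -> FP C0 (fun _ v => F v * G v).
Proof.
move=> [l [c E]] [l' [c' E']].
exists (Quad (c * c') (fun b => c' * l b + c * l' b) 0 (fun a b => l a * l' b)) => // u v.
rewrite qvalE /= mul0r add0r E E' mulrDl !mulrDr addrA; congr (_ + _).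
rewrite -addrA; congr (_ + _).
  rewrite /quadpart big_distrlr /=; apply: eq_bigr => a _; apply: eq_bigr => b _; ring.
rewrite /linpart mulr_suml mulr_sumr -big_split; apply: eq_bigr => b _ /=; ring.
Qed.

Lemma FP_affine (F : ('I_m -> K) -> K) : affine F -> FP C0 (fun _ v => F v).
Proof.
move=> AF; apply: FP_ext (FP_affineM AF (affine_const 1)) => u v; exact: mulr1.
Qed.

Lemma affine_det r (A : ('I_m -> K) -> 'M[K]_r) (j0 : 'I_r) :
  (forall i, affine (fun v => A v i j0)) ->
  (forall v i j, j != j0 -> A v i j = A (fun=> 0) i j) ->
  affine (fun v => \det (A v)).
Proof.
move=> Aj0 Ac; apply: affine_ext (fun v => esym (expand_det_col (A v) j0)) _.
apply: affine_sum => i; apply: affine_ext (affineZ (cofactor (A (fun=> 0)) i j0) (Aj0 i)) => v.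
rewrite mulrC; congr (_ * _); rewrite /cofactor; congr (_ * \det _).
by apply/matrixP => x y; rewrite !mxE [RHS]Ac // eq_sym neq_lift.
Qed.

Lemma Mst_affine v0 i j : (i != i1 m) || (j != i1 m) -> affine (fun v : 'I_m -> K => Mst v0 v 1 i j).
Proof.
case: (ixP i) => [->|->|[a ->]]; case: (ixP j) => [->|->|[b ->]]; rewrite ?eqxx // => _;
  (eapply affine_ext; [by move=> v; rewrite MstE; reflexivity|]);
  by [apply: affine_const | apply: affine_var].
Qed.

(** Only the row and the column of the basis element 1 vary. In the expansion along that row, [u]
    meets a constant cofactor, while each other entry, affine in [v], meets a cofactor with at most
    one varying column, hence affine in [v]. *)
Lemma FP_minor_inj r (f g : 'I_r -> 'I_(2 + m)) : injective f -> injective g ->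
  FP C0 (fun u v => \det (mxsub f g (Mst u v 1))).
Proof.
move=> fi gi.
have [/existsP[i0 /eqP fi0]|] := boolP [exists i, f i == i1 m]; last first.
  rewrite negb_exists => /forallP f1.
  have [/existsP[j0 /eqP gj0]|] := boolP [exists j, g j == i1 m]; last first.
    rewrite negb_exists => /forallP g1; apply: FP_ext (FP_affine (affine_const (\det (mxsub f g (Mst 0 (fun=> 0) 1))))) => u v.
    by congr (\det _); apply/matrixP => i j; rewrite !mxE Mst_const.
  have H : affine (fun v => \det (mxsub f g (Mst 0 v 1))).
    apply: (@affine_det _ (fun v => mxsub f g (Mst 0 v 1)) j0) => [i|v i j jj0].
      apply: affine_ext (@Mst_affine 0 (f i) (g j0) _) => [v|]; first by rewrite mxE.
      by rewrite f1.
    rewrite !mxE Mst_const //; by rewrite -gj0 (inj_eq gi).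
  apply: FP_ext (FP_affine H) => u v; congr (\det _); apply/matrixP => i j; rewrite !mxE.
  have [jj0|jj0] := eqVneq j j0; last by rewrite Mst_const ?[RHS]Mst_const // -gj0 (inj_eq gi).
  by rewrite jj0 gj0; case: (ixP (f i)) (f1 i) => [->|->|[a ->]]; rewrite ?eqxx // !MstE.
have f1 i : f (lift i0 i) != i1 m by rewrite -fi0 (inj_eq fi) eq_sym neq_lift.
apply: FP_ext (fun u v => esym (expand_det_row _ i0)) _.
pose cof j (u : K) (v : 'I_m -> K) := cofactor (mxsub f g (Mst u v 1)) i0 j.
suff H j : FP C0 (fun u v => mxsub f g (Mst u v 1) i0 j * cof j u v).
  apply: FP_ext (FP_sum (fun=> 1) stable0 H) => u v.
  by apply: eq_bigr => j _; rewrite mul1r.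
have [gj|gj] := eqVneq (g j) (i1 m).
  have cofE u v : cof j u v = cof j 0 (fun=> 0).
    rewrite /cof /cofactor; congr (_ * \det _); apply/matrixP => x y; rewrite !mxE.
    by rewrite !Mst_const // -gj (inj_eq gi) eq_sym neq_lift.
  have pu : FP C0 (fun u _ => u) by exists (eu m K) => // u v; rewrite qval_eu.
  apply: FP_ext (FPZ (cof j 0 (fun=> 0)) stable0 pu) => u v.
  by rewrite cofE mxE fi0 gj Mst11 mulrC.
have cofA : affine (fun v => cof j 0 v).
  apply: affineZ; have [/existsP[j0 /eqP gj0]|] := boolP [exists j0, g (lift j j0) == i1 m].
    apply: (@affine_det _ (fun v => row' i0 (col' j (mxsub f g (Mst 0 v 1)))) j0) => [i|v i l ll].
      by apply: affine_ext (@Mst_affine 0 (f (lift i0 i)) (g (lift j j0)) _) => [v|]; rewrite ?f1 // !mxE.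
    by rewrite !mxE Mst_const // -gj0 (inj_eq gi) (inj_eq lift_inj).
  rewrite negb_exists => /forallP g1.
  apply: affine_ext (affine_const (\det (row' i0 (col' j (mxsub f g (Mst 0 (fun=> 0) 1)))))) => v.
  by congr (\det _); apply/matrixP => x y; rewrite !mxE Mst_const.
have cofE u v : cof j u v = cof j 0 v.
  rewrite /cof /cofactor; congr (_ * \det _); apply/matrixP => x y; rewrite !mxE.
  by case: (ixP (f (lift i0 x))) (f1 x) => [->|->|[a ->]]; case: (ixP (g (lift j y))) => [->|->|[b ->]]; rewrite ?eqxx // !MstE.
have rowA : affine (fun v => Mst 0 v 1 (i1 m) (g j)) by apply: Mst_affine; rewrite gj orbT.
apply: FP_ext (FP_affineM rowA cofA) => u v; rewrite cofE mxE fi0; congr (_ * _).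
by case: (ixP (g j)) gj => [->|->|[b ->]]; rewrite ?eqxx // !MstE.
Qed.

Lemma FP_minor r (f g : 'I_r -> 'I_(2 + m)) :
  FP C0 (fun u v => \det (mxsub f g (Mst u v 1))).
Proof.
have c0 : FP C0 (fun _ _ => 0) by apply: FPc.
have [fi|fi] := pselect (injective f); last first.
  by apply: FP_ext c0 => u v; rewrite det_mxsub_noninj //; left.
have [gi|gi] := pselect (injective g); last first.
  by apply: FP_ext c0 => u v; rewrite det_mxsub_noninj //; right.
exact: FP_minor_inj.
Qed.

Lemma FP_minor1 (f g : 'I_1 -> 'I_(2 + m)) :
  FP C1 (fun u v => \det (mxsub f g (Mst u v 1))).
Proof.
apply: FP_ext (fun u v => esym (etrans (det_mx11 _) (mxE _ _ _ _))) _.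
have c1 c : FP C1 (fun _ _ => c) by apply: FPc; apply: stable1.
have cv b : FP C1 (fun _ v => v b) by exists (ev K b) => // u v; rewrite qval_ev.
have cu : FP C1 (fun u _ => u) by exists (eu m K) => // u v; rewrite qval_eu.
by case: (ixP (f 0)) => [->|->|[a ->]]; case: (ixP (g 0)) => [->|->|[b ->]];
  (eapply FP_ext; [by move=> u v; rewrite MstE; reflexivity|]).
Qed.

Lemma lift_fun (f : 'I_m.+1 -> 'I_m.+2) : injective f ->
  exists (i0 : 'I_m.+2) (p : 'S_m.+1), f =1 lift i0 \o p.
Proof.
move=> fi; have [i0 fi0] : exists i0, i0 \notin codom f.
  apply/existsP; apply: contraT; rewrite negb_exists => /forallP H.
  have : (#|'I_m.+2| <= #|codom f|)%N.
    by apply: subset_leq_card; apply/fintype.subsetP => i _; have := H i; rewrite negbK.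
  by rewrite card_codom // !card_ord ltnn.
have ne i : i0 != f i by apply: contraNneq fi0 => ->; apply: codom_f.
pose g i := s2val (unlift_some (ne i)).
have gE i : f i = lift i0 (g i) := s2valP (unlift_some (ne i)).
have gi : injective g by move=> i j gij; apply: fi; rewrite !gE gij.
by exists i0, (perm gi) => i /=; rewrite permE.
Qed.

Lemma FP_minor2 (f g : 'I_m.+1 -> 'I_(2 + m)) :
  FP C2 (fun u v => \det (mxsub f g (Mst u v 1))).
Proof.
have c2 c : FP C2 (fun _ _ => c).
  by apply: FPc => a b /=; rewrite !big1 ?oppr0 ?mul0rn // => t _; rewrite mulr0.
have [fi|fi] := pselect (injective f); last first.
  by apply: FP_ext (c2 0) => u v; rewrite det_mxsub_noninj //; left.
have [gi|gi] := pselect (injective g); last first.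
  by apply: FP_ext (c2 0) => u v; rewrite det_mxsub_noninj //; right.
have [i0 [p fE]] := lift_fun fi; have [j0 [p' gE]] := lift_fun gi.
have cv b : FP C2 (fun _ v => v b).
  by exists (ev K b) => [a b'|u v]; rewrite ?qval_ev //= oppr0 mul0rn.
have ct : FP C2 (fun u v => \sum_b v b * v b - u).
  exists (ediag (-1) (fun=> 1)) => [a b|u v]; first by rewrite /= opprK.
  by rewrite qval_ediag mulN1r [RHS]addrC; congr (_ - _); apply: eq_bigr => b _; rewrite mul1r.
have inv : FP C2 (fun u v => Minv u v j0 i0).
  case: (ixP j0) => [->|->|[a ->]]; case: (ixP i0) => [->|->|[b ->]].
  - by apply: FP_ext (c2 0) => u v; rewrite block_mxEul mxE.
  - by apply: FP_ext (c2 1) => u v; rewrite block_mxEul mxE.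
  - by apply: FP_ext (c2 0) => u v; rewrite block_mxEur mxE.
  - by apply: FP_ext (c2 1) => u v; rewrite block_mxEul mxE.
  - by apply: FP_ext ct => u v; rewrite block_mxEul mxE.
  - by apply: FP_ext (FPZ (-1) stable2 (cv b)) => u v; rewrite block_mxEur mxE mulN1r.
  - by apply: FP_ext (c2 0) => u v; rewrite block_mxEdl mxE.
  - by apply: FP_ext (FPZ (-1) stable2 (cv a)) => u v; rewrite block_mxEdl mxE mulN1r.
  - by apply: FP_ext (c2 (a == b)%:R) => u v; rewrite block_mxEdr mxE.
apply: FP_ext (FPZ ((-1) ^+ p * (-1) ^+ p' * (-1) ^+ (i0 + j0) * -1) stable2 inv) => u v.
have -> : mxsub f g (Mst u v 1) = mxsub (lift i0 \o p) (lift j0 \o p') (Mst u v 1).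
  by apply/matrixP => i j; rewrite !mxE fE gE.
rewrite (@det_mxsub_perm _ _ _ (Mst u v 1) (lift i0) (lift j0)) -!mulrA; do 2!congr (_ * _).
have := congr1 (fun A : 'M_(2 + m) => A j0 i0) (adj_Mst u v); rewrite mxE /cofactor [RHS]mxE mulN1r => <-.
rewrite mulrA -expr2 sqrr_sign mul1r; congr (\det _).
by apply/matrixP => i j; rewrite !mxE.
Qed.

End Forms.

Lemma inj_avoid m r (Z : {set 'I_m}) : (#|Z| + r <= m)%N ->
  exists A : 'I_r -> 'I_m, injective A /\ forall i, A i \notin Z.
Proof.
move=> Zr; have rC : (r <= #|~: Z|)%N by rewrite cardsCs finset.setCK card_ord; lia.
exists (fun i => enum_val (widen_ord rC i)); split=> [i j /enum_val_inj/(congr1 val)|i].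
  by move=> ij; apply: val_inj.
by have := enum_valP (widen_ord rC i); rewrite inE.
Qed.

(** * Functions spanned by the minors of each size *)

Section Spans.
Variables (K : numClosedFieldType) (m : nat).
Variables (G H : 'M[K]_(2 + m)).
Hypotheses (GH : G *m H = 1%:M) (HG : H *m G = 1%:M).

(** [G] passes from the standard basis to an arbitrary basis of the algebra. It mixes only minors of
    equal size and is invertible, so the spans are those of [Mst]. *)
Definition Me u v w : 'M[K]_(m.+2) := G *m Mst u v w *m G^T.

Lemma Me_tr u v w : (Me u v w)^T = Me u v w.
Proof. by rewrite /Me !trmx_mul trmxK Mst_tr mulmxA. Qed.

Lemma Me_Mst u v w : H *m Me u v w *m H^T = Mst u v w.
Proof.
rewrite /Me !mulmxA HG mul1mx -mulmxA -trmx_mul HG trmx1 mulmx1 //.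
Qed.

Definition mcoord r (t : sym_idx m.+2 r) (M : 'M[K]_(m.+2)) :=
  \det (mxsub (tnth (val (val t).1)) (tnth (val (val t).2)) M).

Lemma compoundE r (M : 'M[K]_(m.+2)) t : compound r M t = mcoord t M.
Proof. by rewrite ffunE. Qed.

Lemma FP_mcoord C r (t : sym_idx m.+2 r) : stable C ->
  (forall f g : 'I_r -> 'I_(2 + m), FP C (fun u v => \det (mxsub f g (Mst u v 1)))) ->
  FP C (fun u v => mcoord t (Me u v 1)).
Proof.
move=> sC FC; apply: FP_ext (fun u v => esym (det_mxsub_mul _ _ _ _)) _.
pose cf (f' g' : {ffun 'I_r -> 'I_(2 + m)}) :=
  (\prod_i G (tnth (val (val t).1) i) (f' i)) * (\prod_i G (tnth (val (val t).2) i) (g' i)).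
have S f' : FP C (fun u v => \sum_(g' : {ffun 'I_r -> 'I_(2 + m)}) cf f' g' * \det (mxsub f' g' (Mst u v 1))).
  by apply: FP_sum.
by apply: FP_ext (FP_sum (fun=> 1) sC S) => u v; apply: eq_bigr => f' _; rewrite mul1r.
Qed.

Definition span r (F : K -> ('I_m -> K) -> K) := exists h : sym_idx m.+2 r -> K,
  forall u v, \sum_t h t * mcoord t (Me u v 1) = F u v.

Lemma span_ext r F F' : (forall u v, F u v = F' u v) -> span r F -> span r F'.
Proof. by move=> FF [h hE]; exists h => u v; rewrite hE. Qed.

Lemma span_sum r (I : finType) (c : I -> K) (F : I -> K -> ('I_m -> K) -> K) :
  (forall i, span r (F i)) -> span r (fun u v => \sum_i c i * F i u v).
Proof.
move=> SF; pose h i := sval (cid (SF i)); exists (fun t => \sum_i c i * h i t) => u v.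
under eq_bigr do rewrite mulr_suml; rewrite exchange_big; apply: eq_bigr => i _ /=.
by rewrite -(svalP (cid (SF i))) mulr_sumr; apply: eq_bigr => t _; rewrite mulrA.
Qed.

Lemma spanB r F F' : span r F -> span r F' -> span r (fun u v => F u v - F' u v).
Proof.
move=> [h hE] [h' hE']; exists (fun t => h t - h' t) => u v.
by rewrite -hE -hE' -sumrB; apply: eq_bigr => t _; rewrite mulrBl.
Qed.

Lemma spanN r F : span r F -> span r (fun u v => - F u v).
Proof.
move=> [h hE]; exists (fun t => - h t) => u v.
by rewrite -hE -sumrN; apply: eq_bigr => t _; rewrite mulNr.
Qed.

Lemma span0 r : span r (fun _ _ => 0).
Proof. by exists (fun=> 0) => u v; rewrite big1 // => t _; rewrite mul0r. Qed.

Lemma span_minor r (f g : 'I_r -> 'I_(2 + m)) : span r (fun u v => \det (mxsub f g (Mst u v 1))).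
Proof.
pose cf (f' g' : {ffun 'I_r -> 'I_(2 + m)}) :=
  (\prod_i H (f i) (f' i)) * (\prod_i H (g i) (g' i)).
have E u v : \det (mxsub f g (Mst u v 1)) =
   \sum_(f' : {ffun 'I_r -> 'I_(2 + m)}) \sum_(g' : {ffun 'I_r -> 'I_(2 + m)})
      cf f' g' * \det (mxsub f' g' (Me u v 1)).
  by rewrite -Me_Mst det_mxsub_mul.
apply: span_ext (fun u v => esym (E u v)) _.
have S f' : span r (fun u v => \sum_(g' : {ffun 'I_r -> 'I_(2 + m)}) cf f' g' * \det (mxsub f' g' (Me u v 1))).
  apply: span_sum => g'; have [h hE] := @minor_compound K m.+2 r f' g'.
  by exists h => u v; rewrite (hE _ (Me_tr u v 1)).
by apply: span_ext (span_sum (fun=> 1) S) => u v; apply: eq_bigr => f' _; rewrite mul1r.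
Qed.

Definition fcons r (x : 'I_(2 + m)) (A : 'I_r -> 'I_(2 + m)) (i : 'I_(1 + r)) : 'I_(2 + m) :=
  match fintype.split i with inl _ => x | inr a => A a end.

Lemma fconsl r (x : 'I_(2 + m)) (A : 'I_r -> 'I_(2 + m)) i : fcons x A (lshift r i) = x.
Proof. by rewrite /fcons; case: split_ordP => // j /eqP; rewrite eq_lrshift. Qed.

Lemma fconsr r (x : 'I_(2 + m)) (A : 'I_r -> 'I_(2 + m)) i : fcons x A (rshift 1 i) = A i.
Proof.
rewrite /fcons; case: split_ordP => j /eqP; first by rewrite eq_rlshift.
by rewrite eq_rshift => /eqP ->.
Qed.

Lemma mxsub_fcons r x x' (A A' : 'I_r -> 'I_(2 + m)) (M : 'M[K]_(2 + m)) :
  mxsub (fcons x A) (fcons x' A') M =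
  block_mx (M x x')%:M (\row_j M x (A' j)) (\col_i M (A i) x') (mxsub A A' M).
Proof.
apply/matrixP => i j; rewrite [LHS]mxE.
case: (split_ordP i) => i' ->; case: (split_ordP j) => j' ->; rewrite ?fconsl ?fconsr.
- by rewrite block_mxEul mxE !ord1 eqxx.
- by rewrite block_mxEur mxE.
- by rewrite block_mxEdl mxE.
- by rewrite block_mxEdr mxE.
Qed.

Lemma mxsub_ix r (A : 'I_r -> 'I_m) u v : injective A ->
  mxsub (@ix m \o A) (@ix m \o A) (Mst u v 1) = 1%:M :> 'M[K]_r.
Proof.
move=> Ai; apply/matrixP => i j; rewrite [LHS]mxE /= Mstxx mxE (inj_eq Ai).
by case: eqP.
Qed.

Lemma span_one r : (r <= m)%N -> span r (fun _ _ => 1).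
Proof.
move=> rm; have [|A [Ai _]] := @inj_avoid m r finset.set0; first by rewrite cards0.
by apply: span_ext (span_minor (@ix m \o A) (@ix m \o A)) => u v; rewrite mxsub_ix // det1.
Qed.

(** Rows 1 and [A] against columns x_b and [A], with [b] outside [A]: block triangular, with
    diagonal blocks [v b] and the identity. *)
Lemma span_var r b : (r < m)%N -> span r.+1 (fun _ v => v b).
Proof.
move=> rm; have [|A [Ai Ab]] := @inj_avoid m r [set b]%SET; first by rewrite cards1; lia.
apply: span_ext (span_minor (r := 1 + r) (fcons (i1 m) (@ix m \o A)) (fcons (ix b) (@ix m \o A))) => u v.
rewrite mxsub_fcons (_ : \col_i _ = 0) ?det_ublock ?mxsub_ix // ?det1 ?mulr1 ?det_scalar1 ?Mst1x //.
apply/matrixP => i j; rewrite !mxE /= Mstxx; case: eqP => // E.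
by have := Ab i; rewrite E inE eqxx.
Qed.

(** Rows x_a, 1, [A] against columns 1, x_b, [A]: triangular by blocks, with [v a], [v b] and the
    identity on the diagonal. Avoiding both indices is what requires two more indices than [A]
    has. *)
Lemma span_mul r a b : (r.+1 < m)%N -> a != b -> span r.+2 (fun _ v => v a * v b).
Proof.
move=> rm ab; have [|A [Ai Ab]] := @inj_avoid m r [set a; b]%SET.
  by rewrite cards2 ab; lia.
apply: span_ext (span_minor (r := 1 + (1 + r)) (fcons (ix a) (fcons (i1 m) (@ix m \o A)))
  (fcons (i1 m) (fcons (ix b) (@ix m \o A)))) => u v.
rewrite mxsub_fcons (_ : \row_j _ = 0) ?det_lblock.
  rewrite mxsub_fcons (_ : \col_i _ = 0) ?det_ublock ?mxsub_ix // ?det1 ?mulr1 ?det_scalar1 ?Mstx1 ?Mst1x //.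
  apply/matrixP => i j; rewrite !mxE /= Mstxx; case: eqP => // E.
  by have := Ab i; rewrite E !inE eqxx orbT.
apply/matrixP => i j; rewrite !mxE; case: (split_ordP j) => j' ->; rewrite ?fconsl ?fconsr /=.
  by rewrite Mstxx (negPf ab).
by rewrite Mstxx; case: eqP => // E; have := Ab j'; rewrite -E !inE eqxx.
Qed.

(** Schur complement of the identity block in the principal minor on 1 and [A]. *)
Lemma span_tau r (A : 'I_r -> 'I_m) : injective A ->
  span r.+1 (fun u v => u - \sum_i v (A i) * v (A i)).
Proof.
move=> Ai; apply: span_ext (span_minor (r := 1 + r) (fcons (i1 m) (@ix m \o A)) (fcons (i1 m) (@ix m \o A))) => u v.
rewrite mxsub_fcons mxsub_ix // Mst11.
set x := \row_j _; set y := \col_i _.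
have -> : block_mx u%:M x y 1%:M = block_mx 1%:M x 0 1%:M *m block_mx (u%:M - x *m y) 0 y 1%:M :> 'M[K]_(1 + r).
  by rewrite mulmx_block !mul1mx !mul0mx !mulmx1 !add0r subrK.
rewrite det_mulmx det_ublock det_lblock !det1 !mul1r mulr1 det_mx11 !mxE eqxx mulr1n; congr (_ - _).
by apply: eq_bigr => i _; rewrite !mxE /= Mst1x Mstx1.
Qed.

(** The difference of two forms from [span_tau] whose index sets differ only by exchanging [a] and
    [b]; [u] and the common squares cancel. *)
Lemma span_diff r a b : (r.+1 < m)%N -> a != b -> span r.+2 (fun _ v => v a * v a - v b * v b).
Proof.
move=> rm ab; have [|A [Ai Ab]] := @inj_avoid m r [set a; b]%SET.
  by rewrite cards2 ab; lia.
pose B (c : 'I_m) (i : 'I_(1 + r)) := match fintype.split i with inl _ => c | inr j => A j end.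
have Bl c i : B c (lshift r i) = c.
  by rewrite /B; case: split_ordP => // j /eqP; rewrite eq_lrshift.
have Br c i : B c (rshift 1 i) = A i.
  rewrite /B; case: split_ordP => j /eqP; first by rewrite eq_rlshift.
  by rewrite eq_rshift => /eqP ->.
have Bi c : c \in [set a; b]%SET -> injective (B c).
  move=> cab i j; case: (split_ordP i) => i' ->; case: (split_ordP j) => j' ->; rewrite ?Bl ?Br.
  - by rewrite !ord1.
  - by move=> E; have := Ab j'; rewrite -E cab.
  - by move=> E; have := Ab i'; rewrite E cab.
  - by move=> /Ai ->.
have BE c v : \sum_i v (B c i) * v (B c i) = v c * v c + \sum_i v (A i) * v (A i) :> K.
  rewrite big_split_ord big_ord1 Bl; congr (_ + _).
  by apply: eq_bigr => i _; rewrite Br.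
have ia : a \in [set a; b]%SET by rewrite !inE eqxx.
have ib : b \in [set a; b]%SET by rewrite !inE eqxx orbT.
apply: span_ext (spanB (span_tau (Bi _ ib)) (span_tau (Bi _ ia))) => u v.
by rewrite !BE; ring.
Qed.

Lemma span_last j0 i0 : span m.+1 (fun u v => Minv u v j0 i0).
Proof.
have E u v : \det (mxsub (lift i0) (lift j0) (Mst u v 1)) * (- (-1) ^+ (i0 + j0)) = Minv u v j0 i0 :> K.
  have := congr1 (fun A : 'M_(2 + m) => A j0 i0) (adj_Mst u v); rewrite mxE /cofactor [RHS]mxE => /(congr1 -%R).
  rewrite opprK => <-; rewrite mulrN mulrC; congr (- (_ * \det _)).
  by apply/matrixP => i j; rewrite !mxE.
have S : span m.+1 (fun u v => \sum_(i < 1) - (-1) ^+ (i0 + j0) * \det (mxsub (lift i0) (lift j0) (Mst u v 1))).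
  by apply: span_sum => i; apply: span_minor.
by apply: span_ext S => u v; rewrite big_ord1 -E mulrC.
Qed.

Lemma span_last_one : span m.+1 (fun _ _ => 1).
Proof. by apply: span_ext (span_last (i1 m) (iq m)) => u v; rewrite block_mxEul mxE. Qed.
Lemma span_last_var b : span m.+1 (fun _ v => v b).
Proof.
by apply: span_ext (spanN (span_last (iq m) (ix b))) => u v; rewrite block_mxEur mxE opprK.
Qed.
Lemma span_last_tau : span m.+1 (fun u v => u - \sum_b v b * v b).
Proof.
by apply: span_ext (spanN (span_last (iq m) (iq m))) => u v; rewrite block_mxEul mxE opprB.
Qed.
Lemma span_first_u : span 1 (fun u _ => u).
Proof.
by apply: span_ext (span_minor (fun=> i1 m) (fun=> i1 m)) => u v; rewrite det_mx11 mxE Mst11.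
Qed.

Hypothesis m_gt0 : (0 < m)%N.

Theorem minors_cone : exists D : forall i : 'I_m.+1, sym_idx m.+2 i.+1 -> quad m K,
  (forall i t u v, qval (D i t) u v = mcoord t (Me u v 1)) /\ inhabited (cone D).
Proof.
have HD (i : 'I_m.+1) (t : sym_idx m.+2 i.+1) : exists d : quad m K,
    [/\ forall u v, qval d u v = mcoord t (Me u v 1), i = ord0 -> C1 d & i = ord_max -> C2 d].
  have [i0|i0] := eqVneq i ord0.
    move: t; rewrite i0 => t; have [d d1 dE] := FP_mcoord t (@stable1 K m) (@FP_minor1 K m).
    by exists d; split=> // /(congr1 val) /= mE; exfalso; move: m_gt0; rewrite -mE.
  have [im|im] := eqVneq i ord_max.
    move: t; rewrite im => t; have [d d1 dE] := FP_mcoord t (@stable2 K m) (@FP_minor2 K m).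
    by exists d; split=> // /(congr1 val) /= mE; exfalso; move: m_gt0; rewrite mE.
  have [d d1 dE] := FP_mcoord t (@stable0 K m) (@FP_minor K m _).
  by exists d; split=> // E; [rewrite E eqxx in i0 | rewrite E eqxx in im].
pose D i t := sval (cid (HD i t)); exists D.
have DE i t u v : qval (D i t) u v = mcoord t (Me u v 1).
  by have [] := svalP (cid (HD i t)).
split=> //.
have spanD (i : 'I_m.+1) F : span i.+1 F -> exists h : sym_idx m.+2 i.+1 -> K,
    forall u v, qval (qlin h (D i)) u v = F u v.
  move=> [h hE]; exists h => u v; rewrite qval_qlin -hE.
  by apply: eq_bigr => t _; rewrite DE.
have im (i : 'I_m.+1) : (i < m)%N \/ i = ord_max.
  have := ltn_ord i; rewrite ltnS leq_eqVlt => /orP[/eqP E|]; [right|by left].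
  exact: val_inj.
have H1 (i : 'I_m.+1) : span i.+1 (fun _ _ => 1).
  by have [?|->] := im i; [apply: span_one | apply: span_last_one].
have Hv (i : 'I_m.+1) b : span i.+1 (fun _ v => v b).
  by have [?|->] := im i; [apply: span_var | apply: span_last_var].
have Hk (i : 'I_m.+1) a b : exists h : sym_idx m.+2 i.+1 -> K,
    (0 < i < m)%N -> a != b -> forall u v, qval (qlin h (D i)) u v = v a * v b.
  have [/andP[/andP[i0 im'] ab]|nab] := boolP ((0 < i < m)%N && (a != b)); last first.
    by exists (fun=> 0) => iM ab; rewrite iM ab in nab.
  have [|h hE] := spanD i (fun _ v => v a * v b); last by exists h.
  by case: i i0 im' => -[|j] //= jm _ jm'; apply: span_mul.
have Hd (i : 'I_m.+1) a b : exists h : sym_idx m.+2 i.+1 -> K,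
    (0 < i < m)%N -> forall u v, qval (qlin h (D i)) u v = v a * v a - v b * v b.
  have [/andP[i0 im']|nab] := boolP (0 < i < m)%N; last first.
    by exists (fun=> 0).
  have [|h hE] := spanD i (fun _ v => v a * v a - v b * v b); last by exists h.
  have [->|ab] := eqVneq a b.
    by apply: span_ext (span0 _) => u v; rewrite subrr.
  by case: i i0 im' => -[|j] //= jm _ jm'; apply: span_diff.
have HA (i : 'I_m.+1) : exists hA : (sym_idx m.+2 i.+1 -> K) * {set 'I_m}, (0 < i < m)%N ->
    #|hA.2| = i /\ forall u v, qval (qlin hA.1 (D i)) u v = u - \sum_(b in hA.2) v b * v b.
  have [/andP[i0 im']|nab] := boolP (0 < i < m)%N; last first.
    by exists (fun=> 0, finset.set0).
  have [|A [Ai _]] := @inj_avoid m i finset.set0; first by rewrite cards0 ltnW.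
  have [h hE] := spanD i _ (span_tau Ai).
  exists (h, [set A j | j : 'I_i]%SET) => _; split; first by rewrite card_imset // card_ord.
  move=> u v; rewrite hE; congr (_ - _).
  by rewrite big_imset /= => [|x y _ _]; [| apply: Ai].
have [hu huE] := spanD ord0 _ span_first_u.
have [ht htE] := spanD ord_max _ span_last_tau.
constructor.
apply: (@Cone K m _ D
  (fun i => sval (cid (spanD i _ (H1 i)))) (fun i b => sval (cid (spanD i _ (Hv i b))))
  hu ht (fun i a b => sval (cid (Hk i a b))) (fun i a b => sval (cid (Hd i a b)))
  (fun i => (sval (cid (HA i))).1) (fun i => (sval (cid (HA i))).2)).
- by move=> i; apply: (svalP (cid (spanD i _ (H1 i)))).
- by move=> i b; apply: (svalP (cid (spanD i _ (Hv i b)))).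
- exact: huE.
- exact: htE.
- by move=> i a b; apply: (svalP (cid (Hk i a b))).
- by move=> i a b; apply: (svalP (cid (Hd i a b))).
- by move=> i iM; have [] := svalP (cid (HA i)) iM.
- by move=> i iM; have [] := svalP (cid (HA i)) iM.
- by move=> t; have [_ /(_ erefl)] := svalP (cid (HD ord0 t)).
- by move=> t; have [_ _ /(_ erefl)] := svalP (cid (HD ord_max t)).
Qed.

End Spans.

(** * The variety and its chart *)

Lemma horner_mmap (K : fieldType) n (F : {mpoly K[n]}) (y : 'I_n -> {poly K}) x :
  (mmap (@polyC K) y F).[x] = F.@[fun i => (y i).[x]].
Proof.
rewrite mevalE /mmap horner_sum; apply: eq_bigr => m _.
by rewrite hornerM hornerC horner_prod; congr (_ * _); apply: eq_bigr => j _; rewrite horner_exp.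
Qed.

Lemma poly_eq0_pos (K : numFieldType) (p : {poly K}) :
  (forall x, x != 0 -> p.[x] = 0) -> p = 0.
Proof.
move=> p0; pose s : seq K := [seq i.+1%:R | i <- iota 0 (size p)].
apply: (@roots_geq_poly_eq0 _ _ s); last by rewrite size_map size_iota.
  by apply/allP => _ /mapP[i _ ->]; apply/eqP/p0; rewrite pnatr_eq0.
by rewrite map_inj_uniq ?iota_uniq // => i j /eqP; rewrite eqr_nat => /eqP[].
Qed.

Section Variety.
Variables (K : numClosedFieldType) (m : nat).
Variables (G H : 'M[K]_(2 + m)).
Hypotheses (GH : G *m H = 1%:M) (HG : H *m G = 1%:M).
Variable L : {vspace 'M[K]_(m.+2)}.
Hypothesis LP : forall M, (M \in L) <-> exists u v w, M = Me G u v w.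
Variable D : forall i : 'I_m.+1, sym_idx m.+2 i.+1 -> quad m K.
Arguments D : clear implicits.
Hypothesis DE : forall i t u v, qval (D i t) u v = mcoord t (Me G u v 1).

Lemma Me_unit u v : Me G u v 1 \in unitmx.
Proof.
rewrite unitmxE !det_mulmx det_tr det_Mst.
have : G \in unitmx by case: (mulmx1_unit GH).
by rewrite unitmxE => Gu; rewrite !unitrM Gu unitrN1.
Qed.

Lemma compound_qval (i : 'I_m.+1) u v :
  compound i.+1 (Me G u v 1) = [ffun t => qval (D i t) u v].
Proof. by apply/ffunP => t; rewrite compoundE ffunE DE. Qed.

Lemma chart_mem u v (x : quadric_space K m.+2) :
  (forall i : 'I_m.+1, val (x i) = <[[ffun t => qval (D i t) u v] : {ffun sym_idx m.+2 i.+1 -> K^o}]>%VS) ->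
  X_ L x.
Proof.
move=> xE F FZ; apply: FZ; exists (Me G u v 1).
  split; first by apply/LP; exists u, v, 1.
  by rewrite (mxrank_unit (Me_unit u v)) leq_pred.
by move=> i; rewrite xE compound_qval.
Qed.

Lemma compound_scale r c (M : 'M[K]_(m.+2)) t : compound r (c *: M) t = c ^+ r * compound r M t.
Proof.
rewrite !ffunE -detZ; congr (\det _); apply/matrixP => i j; by rewrite !mxE.
Qed.

Lemma Me_scale u v w r : Me G (r * u) (fun b => r * v b) (r * w) = r *: Me G u v w.
Proof. by rewrite /Me Mst_scale -scalemxAr -scalemxAl. Qed.

(** The chart is dense: matrices with [w = 0] are limits of matrices with [w = t], which rescale to
    [w = 1]. The limit is algebraic: a polynomial in [t] that vanishes off 0 is zero. *)
Lemma chart_closure (x : quadric_space K m.+2)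
    (F : {mpoly K[#|total_idx (fun i : 'I_m.+1 => sym_idx m.+2 i.+1)|]}) : X_ L x ->
  (forall rho u v, peval F (fun k : total_idx (fun i : 'I_m.+1 => sym_idx m.+2 i.+1) =>
     chart D rho u v (tagged k)) = 0) ->
  vanishes_at F x.
Proof.
move=> Xx F0; apply: Xx => z [M [/LP[u [v [w ->]]] _] zE] y yz.
have H' (i : 'I_m.+1) : exists rho, y i = rho *: compound i.+1 (Me G u v w).
  by apply/vlineP; rewrite -zE -yz; apply: memv_line.
pose rho i := sval (cid (H' i)).
have yE i t : y i t = rho i * compound i.+1 (Me G u v w) t.
  by rewrite {1}(svalP (cid (H' i))) ffunE.
pose T (i : 'I_m.+1) := sym_idx m.+2 i.+1.
pose MX : 'M[{poly K}]_(m.+2) :=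
  map_mx (@polyC K) G *m Mst u%:P (fun b => (v b)%:P) 'X *m (map_mx (@polyC K) G)^T.
pose Y (k : total_idx T) : {poly K} := (rho (tag k))%:P *
  \det (mxsub (tnth (val (val (tagged k)).1)) (tnth (val (val (tagged k)).2)) MX).
have MXE t : map_mx (horner_eval t) MX = Me G u v t.
  have GE : map_mx (horner_eval t) (map_mx (@polyC K) G) = G.
    by apply/matrixP => i j; rewrite !mxE /horner_eval hornerC.
  rewrite !map_mxM -map_trmx /= GE; congr (_ *m _ *m _).
  apply/matrixP => i j; rewrite [LHS]mxE.
  case: (ixP i) => [->|->|[a ->]]; case: (ixP j) => [->|->|[b ->]]; rewrite !MstE /horner_eval ?hornerC ?hornerX //.
  by rewrite hornerMn hornerX.
have YE t k : (Y k).[t] = rho (tag k) * compound (tag k).+1 (Me G u v t) (tagged k).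
  rewrite /Y hornerM hornerC ffunE -MXE; congr (_ * _).
  rewrite -[LHS]/(horner_eval t _) -det_map_mx; congr (\det _).
  by apply/matrixP => i j; rewrite !mxE.
pose P := mmap (@polyC K) (fun k => Y (enum_val k)) F.
have PE t : P.[t] = peval F (fun k : total_idx T => rho (tag k) * compound (tag k).+1 (Me G u v t) (tagged k)).
  by rewrite /P horner_mmap; apply: meval_eq => k; rewrite YE.
have P0 : P = 0.
  apply: poly_eq0_pos => t t0; rewrite PE.
  (* Minors of size [i.+1] scale by [t ^+ i.+1], and this power is absorbed in the independent
     scalars. *)
  rewrite -[RHS](F0 (fun i => rho i * t ^+ i.+1) (t^-1 * u) (fun b => t^-1 * v b)).
  apply: meval_eq => k; rewrite /chart DE -compoundE.
  have -> : Me G u v t = t *: Me G (t^-1 * u) (fun b => t^-1 * v b) 1.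
    rewrite -Me_scale mulr1 mulrA divff // mul1r; congr Me; apply/funext => b.
    by rewrite mulrA divff // mul1r.
  by rewrite compound_scale mulrA.
have := PE w; rewrite P0 horner0 => ->; apply: meval_eq => k; exact: yE.
Qed.

End Variety.

(** * The multiplication forms of the algebra *)

Section CWForms.
Variables (K : numClosedFieldType) (k : nat).
Local Notation m := k.+1.
Local Notation A := (CW K k.+2).
Local Notation P := {mpoly K[m]}.
Local Notation pi := (@CW_pi K k.+2).

Definition CWx (b : 'I_m) : A := pi 'X_b.
Definition CWq : A := pi ('X_ord0 ^+ 2).
Definition CWs (i : 'I_(2 + m)) : A :=
  match fintype.split i with inl j => if j == 0 then 1 else CWq | inr b => CWx b end.

Lemma CWs1 : CWs (i1 m) = 1.
Proof. by rewrite /CWs; case: split_ordP => j /eqP; rewrite ?eq_lshift ?eq_lrshift // => /eqP <-. Qed.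
Lemma CWsq : CWs (iq m) = CWq.
Proof. by rewrite /CWs; case: split_ordP => j /eqP; rewrite ?eq_lshift ?eq_lrshift // => /eqP <-. Qed.
Lemma CWsx b : CWs (ix b) = CWx b.
Proof.
rewrite /CWs; case: split_ordP => j /eqP; first by rewrite eq_rlshift.
by rewrite eq_rshift => /eqP ->.
Qed.

Lemma CW_gen0 p : CW_gens p -> pi p = 0.
Proof. by move=> gp; apply/CW_pi_eq0/ideal_gen_sub. Qed.

Lemma CWxx a b : CWx a * CWx b = CWq *+ (a == b).
Proof.
rewrite /CWx /CWq -rmorphM; have [<-|ab] := eqVneq a b; last first.
  by apply: CW_gen0; constructor 1; exists a, b.
rewrite mulr1n -expr2; have [->//|a0] := eqVneq a ord0.
by apply/eqP; rewrite -subr_eq0 -rmorphB; apply/eqP/CW_gen0; constructor 2; exists a, ord0.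
Qed.

Lemma CWxq a : CWx a * CWq = 0.
Proof.
have [->|a0] := eqVneq a ord0.
  by rewrite /CWx /CWq -rmorphM -exprS; apply: CW_gen0; constructor 3.
by rewrite /CWq expr2 rmorphM mulrA -/(CWx _) CWxx (negPf a0) mulr0n mul0r.
Qed.

Lemma CWqq : CWq * CWq = 0.
Proof. by rewrite {1}/CWq expr2 rmorphM -mulrA -/(CWx _) CWxq mulr0. Qed.

Lemma CWs_span (y : A) : exists c : 'I_(2 + m) -> K, y = \sum_i c i *: CWs i.
Proof.
have [p ->] := CW_pi_surj y.
pose c0 := p@_0%MM; pose cx b := p@_U_(b)%MM; pose cq := \sum_b p@_(U_(b) *+ 2)%MM.
exists (fun i => match fintype.split i with inl j => if j == 0 then c0 else cq | inr b => cx b end).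
rewrite big_split_ord /= 2!big_ord_recl big_ord0 addr0.
have sl j : fintype.split (lshift m j) = inl j := unsplitK (inl j : 'I_2 + 'I_m).
have sr j : fintype.split (rshift 2 j) = inr j := unsplitK (inr j : 'I_2 + 'I_m).
rewrite /CWs !sl /=.
have -> : \sum_(i < m) match fintype.split (rshift 2 i) with inl j => if j == 0 then c0 else cq | inr b => cx b end *:
     match fintype.split (rshift 2 i) with inl j => if j == 0 then 1 else CWq | inr b => CWx b end = \sum_b cx b *: CWx b.
  by apply: eq_bigr => b _; rewrite !sr.
pose p' : P := c0%:MP + cq *: 'X_ord0 ^+ 2 + \sum_b cx b *: 'X_b.
have -> : c0 *: 1 + cq *: CWq + \sum_b cx b *: CWx b = pi p'.
  rewrite /p' !rmorphD rmorph_sum /= linearZ /= -alg_mpolyC linearZ /= rmorph1; congr (_ + _).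
  by apply: eq_bigr => b _; rewrite linearZ.
apply/eqP; rewrite -subr_eq0 -rmorphB; apply/eqP/CW_pi_eq0/CW_nf_ideal/CW_nf_eq0.
have E u : p'@_u = c0 * (u == 0%MM)%:R + cq * ((U_(ord0) *+ 2)%MM == u)%:R + \sum_b cx b * (U_(b)%MM == u)%:R.
  rewrite !mcoeffD mcoeffC mcoeffZ mpolyXn mcoeffX raddf_sum /=; congr (_ + _).
  by apply: eq_bigr => b _; rewrite mcoeffZ mcoeffX.
have degF (m1 m2 : 'X_{1..m}) : mdeg m1 != mdeg m2 -> (m1 == m2) = false.
  by apply: contraNF => /eqP ->.
split=> [|b|].
- rewrite mcoeffB E eqxx degF ?mdegMn ?mdeg1 ?mdeg0 // mulr1 mulr0 addr0 big1 ?addr0 ?subrr // => b _.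
  by rewrite degF ?mulr0 // mdeg1 mdeg0.
- rewrite mcoeffB E !degF ?mdegMn ?mdeg1 ?mdeg0 // !mulr0 !add0r (bigD1 b) //= eqxx mulr1.
  rewrite big1 ?addr0 ?subrr // => a ab.
  by rewrite eq_mnm1 (negPf ab) mulr0.
rewrite (eq_bigr _ (fun b _ => mcoeffB _ _ _)) sumrB -/cq (bigD1 ord0) //= E eqxx mulr1.
rewrite degF ?mdegMn ?mdeg1 ?mdeg0 // mulr0 add0r.
rewrite big1 => [|b _]; last by rewrite degF ?mulr0 // mdegMn !mdeg1.
rewrite addr0 big1 ?addr0 ?subrr // => b b0; rewrite E.
rewrite degF ?mdegMn ?mdeg1 ?mdeg0 // mulr0 add0r big1 => [|a _]; last by rewrite degF ?mulr0 // mdegMn !mdeg1.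
case: eqP => [/mnmP/(_ b)|]; last by rewrite mulr0 addr0.
by rewrite !mulmnE !mnmE eqxx eq_sym (negPf b0).
Qed.

Variable e : k.+3.-tuple A.
Hypothesis he : basis_of fullv e.

Lemma CW_form_space : exists G H : 'M[K]_(2 + m), [/\ G *m H = 1%:M, H *m G = 1%:M &
  forall M, M \in form_space e <-> exists u v w, M = Me G u v w].
Proof.
have ce i := cid (CWs_span (tnth e i)).
pose G : 'M[K]_(2 + m) := \matrix_(i, j) sval (ce i) j.
pose H : 'M[K]_(2 + m) := \matrix_(j, i) coord e i (CWs j).
have eG i : tnth e i = \sum_j G i j *: CWs j.
  by rewrite {1}(svalP (ce i)); apply: eq_bigr => j _; rewrite mxE.
have GH : G *m H = 1%:M.
  apply/matrixP => i j; rewrite !mxE.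
  have fe := basis_free he.
  rewrite (_ : (i == j)%:R = coord e j (tnth e i)); last first.
    by rewrite (tnth_nth 0) coord_free // eq_sym.
  by rewrite eG linear_sum; apply: eq_bigr => l _; rewrite linearZ /= !mxE.
(* So far the standard elements are only known to span; since both matrices are square, the other
   product is the identity too. *)
have HG := mulmx1C GH.
exists G, H; split=> //.
have formE (l : 'Hom(A, K^o)) : mul_form e l = Me G (l 1) (fun b => l (CWx b)) (l CWq).
  apply/matrixP => i j; rewrite [LHS]mxE eG [tnth e j]eG.
  have -> : (\sum_a G i a *: CWs a) * (\sum_b G j b *: CWs b) =
      \sum_a \sum_b (G i a * G j b) *: (CWs a * CWs b).
    have := mulr_suml (index_enum 'I_(2 + m)) xpredT (fun a => G i a *: CWs a) (\sum_b G j b *: CWs b).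
    move=> ->; apply: eq_bigr => a _; have := mulr_sumr (index_enum 'I_(2 + m)) xpredT (fun b => G j b *: CWs b) (G i a *: CWs a).
    by move=> ->; apply: eq_bigr => b _; rewrite -scalerAl -scalerAr scalerA.
  rewrite linear_sum [RHS]mxE /=.
  rewrite [RHS](eq_bigr (fun b => \sum_a G i a * Mst (l 1) (fun b => l (CWx b)) (l CWq) a b * G j b)); last first.
    by move=> b _; rewrite [G^T b j]mxE [(G *m _) i b]mxE mulr_suml.
  rewrite exchange_big; apply: eq_bigr => a _ /=; rewrite linear_sum; apply: eq_bigr => b _ /=.
  rewrite linearZ /= [_ *: _]mulrAC; congr (_ * _ * _).
  case: (ixP a) => [->|->|[a' ->]]; case: (ixP b) => [->|->|[b' ->]]; rewrite !MstE ?CWs1 ?CWsq ?CWsx ?mulr1 ?mul1r //.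
  - by rewrite CWqq linear0.
  - by rewrite mulrC CWxq linear0.
  - by rewrite CWxq linear0.
  - by rewrite CWxx linearMn.
move=> M; split=> [/form_spaceP[l ->]|[u [v [w ->]]]].
  by exists (l 1), (fun b => l (CWx b)), (l CWq).
(* A functional with prescribed values [c] on the standard elements takes the values [G c] on [e],
   which defines it through the coordinates in [e]. *)
pose c (j : 'I_(2 + m)) : K := match fintype.split j with inl a => if a == 0 then u else w | inr b => v b end.
pose l : 'Hom(A, K^o) := \sum_(i < k.+3) (\sum_j G i j * c j) *: linfun (coord e i : A -> K^o).
have lE y : l y = \sum_(i < k.+3) (\sum_j G i j * c j) * coord e i y.
  rewrite sum_lfunE; apply: eq_bigr => i _; by rewrite scale_lfunE lfunE.
have lc j : l (CWs j) = c j.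
  rewrite lE.
  rewrite (eq_bigr (fun i => \sum_j' (H j i * G i j') * c j')); last first.
    by move=> i _; rewrite mulr_suml; apply: eq_bigr => j' _; rewrite [H j i]mxE; ring.
  rewrite exchange_big /= (eq_bigr (fun j' => (H *m G) j j' * c j')); last first.
    by move=> j' _; rewrite mxE mulr_suml.
  rewrite HG (bigD1 j) //= mxE eqxx mul1r big1 ?addr0 // => j' jj.
  by rewrite mxE eq_sym (negPf jj) mul0r.
have sl j : fintype.split (lshift m j) = inl j := unsplitK (inl j : 'I_2 + 'I_m).
have sr j : fintype.split (rshift 2 j) = inr j := unsplitK (inr j : 'I_2 + 'I_m).
apply/form_spaceP; exists l; rewrite formE; congr Me.
- by rewrite -CWs1 lc /c sl.
- by apply/funext => b; rewrite -CWsx lc /c sr.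
- by rewrite -CWsq lc /c sl.
Qed.

End CWForms.

(** * Elimination of [u] *)

Local Open Scope classical_set_scope.
Local Open Scope ring_scope.

Lemma pspace_gen (K : fieldType) (T : finType) (x : pspace K T) :
  exists2 v : {ffun T -> K^o}, v != 0 & val x = <[v]>%VS.
Proof.
have x1 := eqP (valP x); have v0 : vpick (val x) != 0.
  by rewrite vpick0 -dimv_eq0 x1.
exists (vpick (val x)) => //; apply/esym/eqP; rewrite eqEdim x1 dim_vline v0 andbT.
by rewrite -memvE memv_pick.
Qed.

Lemma mkpspace (K : fieldType) (T : finType) (v : {ffun T -> K^o}) : v != 0 ->
  exists x : pspace K T, val x = <[v]>%VS.
Proof. by move=> v0; exists (exist _ <[v]>%VS (introT eqP (etrans (dim_vline v) (congr1 nat_of_bool v0)))). Qed.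

Section Reduction.
Variables (K : numClosedFieldType) (m : nat) (T : 'I_m.+1 -> finType).
Variables (D : forall i, T i -> quad m K) (c : cone D).
Arguments D : clear implicits.
Variable b : nat -> nat.

Definition hidx : finType := {i : 'I_m.+1 & ('I_(b i.+1) * T i)%type}.
Definition eidx : finType := {i : 'I_m.+1 & 'I_(b i.+1)}.
Local Notation R0 := {mpoly K[#|hidx|]}.
Implicit Types (h : hidx -> K) (tau : eidx).

Definition hcoord tau (t : T (tag tau)) : hidx :=
  existT (fun i : 'I_m.+1 => ('I_(b i.+1) * T i)%type) (tag tau) (tagged tau, t).

Definition cfun h tau (t : T (tag tau)) : K := h (hcoord t).
Definition cpol tau (t : T (tag tau)) : R0 := 'X_(enum_rank (hcoord t)).

Definition equ h tau : quad m K := qlin (cfun h (tau := tau)) (D (tag tau)).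
Definition eqp tau : quad m R0 := qlin (cpol (tau := tau)) (fun t => qmap (@mpolyC _ K) (D (tag tau) t)).

Definition hev h : R0 -> K := meval (fun k => h (enum_val k)).
HB.instance Definition _ h := GRing.RMorphism.on (hev h).

Lemma qmap_eqp h tau : qmap (hev h) (eqp tau) = equ h tau.
Proof.
rewrite /eqp qmap_qlin /equ; congr qlin; apply/funext => t /=.
  by rewrite /cpol /hev mevalXU enum_rankK.
rewrite qmap_comp; case: (D _ t) => a0 a1 au a2; rewrite /qmap /=.
congr Quad; rewrite /hev ?mevalC //; first by apply/funext => j; rewrite mevalC.
by apply/funext => i; apply/funext => j; rewrite mevalC.
Qed.

Variables (p : eidx) (pi : eidx -> eidx) (phi : 'I_m -> eidx) (q : 'I_m -> bool).
Variables (B Binv : 'M[K]_m) (h0 : hidx -> K).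

Definition lin_of (S : pzRingType) (B : 'M[S]_m) (z : 'I_m -> S) (a : 'I_m) : S := \sum_l B a l * z l.

(** [p] is the pivot that determines [u], [phi] numbers the other equations, and [pi tau] is the
    equation that eliminates [u] from [tau]: either [p] or a second pivot that is itself reduced by
    [p]. *)
Definition elim_eq h j := qcomb (equ h (pi (phi j))) (equ h (phi j)).
Definition elim_pol (j : 'I_m) : {mpoly R0[m]} :=
  qval (qmap (@mpolyC m R0) (qcomb (eqp (pi (phi j))) (eqp (phi j)))) 0
    (lin_of (map_mx (fun x => (x%:MP)%:MP) B) (fun l => 'X_l)).

(** Covers the three uses of [elim_pol] at once: evaluation at a point, restriction to a line
    through the origin, and specialization of the hyperplane coefficients. *)
Lemma map_elim_pol (S : comNzRingType) h (f : {rmorphism K -> S}) (F : {rmorphism {mpoly R0[m]} -> S}) :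
  (forall x, F x%:MP = f (hev h x)) -> forall j,
  F (elim_pol j) = qval (qmap f (elim_eq h j)) 0 (lin_of (map_mx f B) (fun l => F 'X_l)).
Proof.
move=> FE j; rewrite /elim_pol rmorph_qval rmorph0 qmap_comp.
have -> : qmap (F \o @mpolyC m R0) (qcomb (eqp (pi (phi j))) (eqp (phi j)))
    = qmap f (elim_eq h j).
  rewrite /elim_eq -!qmap_eqp -qmap_qcomb qmap_comp; congr qmap.
  by apply/funext => x; rewrite /= FE.
congr qval; apply/funext => a; rewrite /lin_of rmorph_sum; apply: eq_bigr => l _.
by rewrite rmorphM !mxE FE /= /hev mevalC.
Qed.

Lemma qval0_size (d : quad m K) v : (size (qval (qmap (@polyC K) d) 0 (fun a => 'X * (v a)%:P)%R) <=
  if quadpart d v == 0%R then (if linpart d v == 0%R then 1 else 2) else 3)%N.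
Proof.
rewrite qvalE mulr0 add0r quadpart_scale linpart_scale -!rmorph_quadpart -!rmorph_linpart /=.
set x := quadpart d v; set y := linpart d v.
have sx : (size ('X * 'X * x%:P)%R <= if x == 0%R then 0 else 3)%N.
  rewrite mulrC mul_polyC -expr2; case: eqP => [->|_]; first by rewrite scale0r size_poly0.
  by apply: leq_trans (size_scale_leq _ _) _; rewrite size_polyXn.
have sy : (size ('X * y%:P)%R <= if y == 0%R then 0 else 2)%N.
  rewrite mulrC mul_polyC; case: eqP => [->|_]; first by rewrite scale0r size_poly0.
  by apply: leq_trans (size_scale_leq _ _) _; rewrite size_polyX.
apply: leq_trans (size_polyD _ _) _; rewrite geq_max; apply/andP; split; last first.
  by apply: leq_trans (size_polyC_leq1 _) _; do ?case: ifP.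
apply: leq_trans (size_polyD _ _) _; rewrite geq_max; apply/andP; split.
  by apply: leq_trans sx _; do ?case: ifP.
by apply: leq_trans sy _; do ?case: ifP.
Qed.

Lemma msize_qval (R : comNzRingType) (d : quad m R) (V : 'I_m -> {mpoly R[m]}) :
  (forall a, msize (V a) <= 2)%N ->
  (msize (qval (qmap (@mpolyC m R) d) 0 V) <= 3)%N /\
  ((forall a a', q2 d a a' = 0) -> (msize (qval (qmap (@mpolyC m R) d) 0 V) <= 2)%N).
Proof.
move=> V2; have msum I (r : seq I) (F : I -> {mpoly R[m]}) e :
    (forall i, msize (F i) <= e)%N -> (msize (\sum_(i <- r) F i) <= e)%N.
  move=> Fe; elim/big_ind: _ => // [|u v ue ve]; first by rewrite msize0.
  by apply: leq_trans (msizeD_le _ _) _; rewrite geq_max ue.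
have mC (x : R) : (msize (x%:MP : {mpoly R[m]}) <= 1)%N by rewrite msizeC; case: eqP.
have L : (msize (linpart (qmap (@mpolyC m R) d) V) <= 2)%N.
  by apply: msum => a; apply: (@msizeM_leD _ _ 0 1); [exact: mC | exact: V2].
have C2 : (msize (linpart (qmap (@mpolyC m R) d) V + q0 (qmap (@mpolyC m R) d)) <= 2)%N.
  by apply: leq_trans (msizeD_le _ _) _; rewrite geq_max L; apply: leq_trans (mC (q0 d)) _.
rewrite qvalE mulr0 add0r -addrA; split=> [|d2].
  apply: leq_trans (msizeD_le _ _) _; rewrite geq_max (leq_trans C2) // andbT.
  apply: (msum) => a; apply: (msum) => a'; apply: (@msizeM_leD _ _ 1 1) => //.
  by apply: (@msizeM_leD _ _ 0 1); [exact: mC | exact: V2].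
by rewrite quadpart0 ?add0r // => a a'; rewrite /= d2 mpolyC0.
Qed.

Hypothesis BK : forall v a, lin_of B (lin_of Binv v) a = v a.
Hypothesis BinvK : forall z a, lin_of Binv (lin_of B z) a = z a.
Hypothesis phiP : forall tau, tau = p \/ exists j, tau = phi j.
Hypothesis piP : forall tau, pi tau = p \/ pi (pi tau) = p.
Hypothesis q_lin : forall j, ~~ q j -> forall a a', q2 (qcomb (eqp (pi (phi j))) (eqp (phi j))) a a' = 0.
Hypothesis h0p : qu (equ h0 p) != 0.
Hypothesis h0pi : forall j, qu (equ h0 (pi (phi j))) != 0.
Hypothesis h0_lead : forall j, exists2 g : 'I_m -> {mpoly K[m]},
  forall i, (msize (g i) + q i <= (q j).+1)%N &
  (msize ('X_j ^+ (q j).+1 - \sum_i g i * qval (qmap (@mpolyC m K) (elim_eq h0 i)) 0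
    (lin_of (map_mx (@mpolyC m K) B) (fun l => 'X_l))) <= (q j).+1)%N.
Hypothesis h0_spt : forall (s : {set 'I_m}) j, qval (elim_eq h0 j) 0 (lin_of B (spt q K s)) = 0.

Variable X : set (forall i, pspace K (T i)).
Hypothesis chart_X : forall u v (x : forall i, pspace K (T i)),
  (forall i, val (x i) = <[[ffun t => qval (D i t) u v] : {ffun T i -> K^o}]>%VS) -> X x.
Hypothesis X_closure : forall x (F : {mpoly K[#|total_idx T|]}), X x ->
  (forall rho u v, peval F (fun k : total_idx T => chart D rho u v (tagged k)) = 0) ->
  vanishes_at F x.

Definition sect h : set (forall i, pspace K (T i)) :=
  [set x | forall (i : 'I_m.+1) (j : 'I_(b i.+1)),
     in_hyperplane (fun t => h (existT _ i (j, t))) (x i)].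

Hypothesis at_infinity : forall h, qu (equ h p) != 0 -> (forall j, qu (equ h (pi (phi j))) != 0) ->
  forall y : (forall i, T i -> K), (forall i, exists t, y i t != 0) ->
  (forall f, PF f -> (forall rho u v, f (chart D rho u v) = 0) -> f y = 0) ->
  cW c ord0 y = 0 -> (forall tau, lam (cfun h (tau := tau)) y = 0) ->
  exists2 v : 'I_m -> K, exists a, v a != 0 &
    forall j, quadpart (elim_eq h j) v = 0 /\ (~~ q j -> linpart (elim_eq h j) v = 0).

Lemma mmap_elim_pol h z j :
  mmap (hev h) z (elim_pol j) = qval (elim_eq h j) 0 (lin_of B z).
Proof.
rewrite (@map_elim_pol _ h idfun (mmap (hev h) z)) => [|x]; last by rewrite /= mmapC.
congr qval.
by apply/funext => a; apply: eq_bigr => l _; rewrite mxE /= mmapX mmap1U.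
Qed.

Lemma mmapX_elim_pol h z j :
  mmap (@polyC K \o hev h) (fun i => z i *: 'X) (elim_pol j) =
  qval (qmap (@polyC K) (elim_eq h j)) 0 (fun a => 'X * (lin_of B z a)%:P).
Proof.
rewrite (@map_elim_pol _ h (@polyC K) (mmap (@polyC K \o hev h) (fun i => z i *: 'X))) => [|x]; last first.
  by rewrite /= mmapC.
congr qval; apply/funext => a; rewrite /lin_of rmorph_sum mulr_sumr; apply: eq_bigr => l _.
by rewrite mxE /= mmapX mmap1U rmorphM -mul_polyC; ring.
Qed.

Lemma map_mpoly_elim_pol h j : map_mpoly (hev h) (elim_pol j) =
  qval (qmap (@mpolyC m K) (elim_eq h j)) 0 (lin_of (map_mx (@mpolyC m K) B) (fun l => 'X_l)).
Proof.
rewrite (@map_elim_pol _ h (@mpolyC m K) (map_mpoly (hev h))) => [|x]; last by rewrite /= map_mpolyC.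
by congr qval; apply/funext => a; apply: eq_bigr => l _; rewrite /= map_mpolyX.
Qed.

Lemma msize_elim_pol j : (msize (elim_pol j) <= (q j).+2)%N.
Proof.
have V2 a : (msize (lin_of (map_mx (fun x : K => (x%:MP)%:MP) B) (fun l => 'X_l : {mpoly R0[m]}) a) <= 2)%N.
  rewrite /lin_of; elim/big_ind: _ => [|u v ue ve|l _]; first by rewrite msize0.
    by apply: leq_trans (msizeD_le _ _) _; rewrite geq_max ue.
  apply: (@msizeM_leD _ _ 0 1); last by rewrite msizeX mdeg1.
  by rewrite mxE msizeC; case: eqP.
have [s3 s2] := msize_qval (qcomb (eqp (pi (phi j))) (eqp (phi j))) V2.
by case: (boolP (q j)) => [_|/q_lin /s2].
Qed.

Definition usol h z := - (quadpart (equ h p) (lin_of B z) + linpart (equ h p) (lin_of B z) + q0 (equ h p)) / qu (equ h p).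

Lemma lin_of_inj z z' : (forall a, lin_of B z a = lin_of B z' a) -> z =1 z'.
Proof. by move=> zz a; rewrite -BinvK -[RHS]BinvK; apply: eq_bigr => l _; rewrite zz. Qed.

Lemma usolP h z u : qu (equ h p) != 0 -> (qval (equ h p) u (lin_of B z) = 0 <-> u = usol h z).
Proof.
move=> p0; rewrite qvalE /usol; split=> [H|->]; last by field.
apply: (mulfI p0); rewrite mulrCA divff // mulr1; apply/eqP.
by rewrite -subr_eq0 opprK !addrA; apply/eqP.
Qed.

(** Once [u] solves the equation of [p], an eliminated equation gives back the original one as soon
    as its pivot equation holds; through the second pivot this takes two steps. *)
Lemma elim_solve h z : qu (equ h p) != 0 -> (forall j, qu (equ h (pi (phi j))) != 0) ->
  (forall j, mmap (hev h) z (elim_pol j) = 0) <->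
  (forall tau, qval (equ h tau) (usol h z) (lin_of B z) = 0).
Proof.
move=> p0 pi0; have Ep : qval (equ h p) (usol h z) (lin_of B z) = 0 by apply/usolP.
split=> [F0|E0 j]; last by rewrite mmap_elim_pol (qval_qcomb _ _ (usol h z)) !E0 !mulr0 subrr.
have E tau : qval (equ h (pi tau)) (usol h z) (lin_of B z) = 0 ->
    qval (equ h tau) (usol h z) (lin_of B z) = 0.
  have [->|[j ->]] := phiP tau; first by [].
  move=> Epi; have /eqP := F0 j; rewrite mmap_elim_pol (qval_qcomb _ _ (usol h z)) Epi mulr0 subr0.
  by rewrite mulf_eq0 (negPf (pi0 j)) => /eqP.
by move=> tau; apply: (E); have [->|pp] := piP tau; [| apply: (E); rewrite pp].
Qed.

Lemma chart_neq0 i u v : [ffun t => qval (D i t) u v] != 0 :> {ffun T i -> K^o}.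
Proof.
apply/eqP => /ffunP H; have := h1E c i u v; rewrite qval_qlin big1 => [/eqP|t _].
  by rewrite eq_sym oner_eq0.
by have := H t; rewrite !ffunE => ->; rewrite mulr0.
Qed.

Theorem reduction :
  generically (fun h : hidx -> K => (X `&` sect h #= `I_(2 ^ #|[set j | q j]%SET|))%card).
Proof.
have [|s j|G G0 GP] := @generic_bezout m q K R0 elim_pol (hev h0) msize_elim_pol.
- move=> j; have [g g1 g2] := h0_lead j; exists g => //.
  by under eq_bigr do rewrite map_mpoly_elim_pol.
- by rewrite mmap_elim_pol h0_spt.
have hevu h tau : hev h (qu (eqp tau)) = qu (equ h tau) by rewrite -qmap_eqp.
exists (G * (qu (eqp p) * \prod_j qu (eqp (pi (phi j))))).
  have : hev h0 (G * (qu (eqp p) * \prod_j qu (eqp (pi (phi j))))) != 0.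
    rewrite !rmorphM rmorph_prod /= !mulf_neq0 //; first by rewrite hevu.
    by apply/prodf_neq0 => j _; rewrite hevu.
  by apply: contraNneq => ->; rewrite rmorph0.
move=> h; rewrite /peval -/(hev h _) !rmorphM rmorph_prod /= !mulf_eq0 !negb_or hevu.
case/andP=> hG /andP[p0 /prodf_neq0 pi0'].
have {}pi0' j : qu (equ h (pi (phi j))) != 0 by rewrite -hevu pi0'.
have [[S [S_uniq <-] SP] top0] := GP (hev h) hG.
have [pt ptE] : exists pt : {ffun 'I_m -> K} -> forall i, pspace K (T i), forall z i,
    val (pt z i) = <[[ffun t => qval (D i t) (usol h z) (lin_of B z)] : {ffun T i -> K^o}]>%VS.
  have H z i := cid (mkpspace (chart_neq0 i (usol h z) (lin_of B z))).
  by exists (fun z i => projT1 (H z i)) => z i; apply: (projT2 (H z i)).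
have -> : X `&` sect h = (fun k => pt (nth [ffun=> 0] S k)) @` `I_(size S).
  apply/seteqP; split=> [x [Xx Hx]|_ [k kS <-]]; last first.
    set z := nth _ _ _; have zS : z \in S by apply: mem_nth.
    have E0 := (elim_solve z p0 pi0').1 ((SP z).1 zS).
    split; first by apply: (@chart_X (usol h z) (lin_of B z)); apply: ptE.
    move=> i j v; rewrite ptE => /vlineP[r ->].
    have := E0 (existT (fun i : 'I_m.+1 => 'I_(b i.+1)) i j); rewrite qval_qlin => E.
    move/(congr1 (fun x => r * x)): E; rewrite mulr0 => E; rewrite -[RHS]E mulr_sumr.
    apply: eq_bigr => t _.
    by rewrite !ffunE mulrCA.
  have H i := cid2 (pspace_gen (x i)).
  pose y i := s2val (H i); have y0 i : y i != 0 := s2valP (H i).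
  have yx i : val (x i) = <[y i]>%VS := s2valP' (H i).
  have y_nz i : exists t, y i t != 0.
    apply: contrapT => N; case/eqP: (y0 i); apply/ffunP => t; rewrite ffunE.
    by apply/eqP; apply: contrapT => /negP yt; apply: N; exists t.
  have y_cl f : PF f -> (forall rho u v, f (chart D rho u v) = 0) -> f y = 0.
    move=> [F FE] f0; rewrite -FE; apply: (X_closure Xx) => [rho u v|i]; last by rewrite yx.
    by rewrite FE f0.
  have y_eq tau : lam (cfun h (tau := tau)) y = 0.
    case: tau => i j; have := Hx i j (y i); rewrite yx => /(_ (memv_line _)); exact.
  (* A point outside the chart would yield a nonzero common zero of the leading forms, which [top0]
     excludes. *)
  have [W0|W0] := eqVneq (cW c ord0 y) 0.
    have [v [a va] vP] := at_infinity p0 pi0' y_nz y_cl W0 y_eq.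
    suff v0 l : lin_of Binv v l = 0.
      by case/eqP: va; rewrite -BK {1}/lin_of big1 // => l _; rewrite v0 mulr0.
    apply: (top0 (lin_of Binv v)) => j; rewrite mmapX_elim_pol; have [Q L] := vP j.
    apply: leq_trans (qval0_size _ _) _; rewrite (eq_quadpart _ (BK v)) (eq_linpart _ (BK v)) Q eqxx.
    by case: (boolP (q j)) => [_|/L ->]; [case: ifP | rewrite eqxx].
  have [u [v xuv]] := finite_point y_nz y_cl W0.
  have E0 tau : qval (equ h tau) u v = 0.
    have [r r0 rE] := xuv (tag tau); apply: (mulfI r0).
    rewrite mulr0 -[RHS](y_eq tau) /lam qval_qlin mulr_sumr; apply: eq_bigr => t _.
    by rewrite rE mulrCA.
  pose z := [ffun l => lin_of Binv v l].
  have zv a : lin_of B z a = v a by rewrite -[RHS]BK; apply: eq_bigr => l _; rewrite ffunE.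
  have {}E0 tau : qval (equ h tau) u (lin_of B z) = 0 by rewrite (_ : lin_of B z = v) //; apply/funext.
  have uE : u = usol h z by apply/usolP.
  have zS : z \in S by apply/SP/elim_solve => // tau; rewrite -uE.
  exists (index z S); first by rewrite /= index_mem.
  rewrite nth_index //; apply/functional_extensionality_dep => i; apply: val_inj.
  rewrite /= ptE yx; have [r r0 rE] := xuv i.
  have -> : y i = r *: ([ffun t => qval (D i t) (usol h z) (lin_of B z)] : {ffun T i -> K^o}).
    apply/ffunP => t; rewrite rE !ffunE -uE (_ : lin_of B z = v) //; exact/funext.
  apply/esym/eqP; rewrite eqEdim !dim_vline scaler_eq0 (negPf r0) /= leqnn andbT.
  by apply/vlineP; exists r.
(* Distinct solutions give distinct points: in the first factor the form [1] fixes the scalar, and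
   then the forms [v_a] recover [v]. *)
apply: inj_card_eq => k l; rewrite !inE => kS lS kl; apply/eqP.
rewrite -(nth_uniq [ffun=> 0] kS lS S_uniq); apply/eqP/ffunP.
set z := nth _ _ k in kl *; set z' := nth _ _ l in kl *; apply: lin_of_inj => a.
have /vlineP[r rE] : ([ffun t => qval (D ord0 t) (usol h z) (lin_of B z)] : {ffun T ord0 -> K^o}) \in
    <[[ffun t => qval (D ord0 t) (usol h z') (lin_of B z')] : {ffun T ord0 -> K^o}]>%VS.
  by rewrite -ptE -kl ptE; apply: memv_line.
have R (hh : T ord0 -> K) : qval (qlin hh (D ord0)) (usol h z) (lin_of B z) =
    r * qval (qlin hh (D ord0)) (usol h z') (lin_of B z').
  rewrite !qval_qlin mulr_sumr; apply: eq_bigr => t _.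
  by have /ffunP/(_ t) := rE; rewrite !ffunE => ->; rewrite mulrCA.
have := R (h1 c ord0); rewrite !h1E mulr1 => r1.
by have := R (hv c ord0 a); rewrite !hvE -r1 mul1r.
Qed.
End Reduction.

(** * Special systems with diagonal quadratic equations *)

Definition qpull m (R : comNzRingType) (B : 'M[R]_m) (d : quad m R) : quad m R :=
  Quad (q0 d) (fun l => \sum_a q1 d a * B a l) (qu d)
    (fun l l' => \sum_a \sum_a' q2 d a a' * B a l * B a' l').

Lemma qval_qpull m (R : comNzRingType) (B : 'M[R]_m) (d : quad m R) u z :
  qval (qpull B d) u z = qval d u (lin_of B z).
Proof.
rewrite !qvalE; congr (_ + _ + _ + _).
- rewrite /quadpart /=.
  under eq_bigr do under eq_bigr do rewrite !mulr_suml.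
  under eq_bigr do rewrite exchange_big.
  rewrite exchange_big; apply: eq_bigr => a _ /=.
  under eq_bigr do under eq_bigr do rewrite !mulr_suml.
  under eq_bigr do rewrite exchange_big.
  rewrite exchange_big; apply: eq_bigr => a' _ /=.
  rewrite /lin_of -mulrA mulr_suml mulr_sumr; apply: eq_bigr => l _.
  by rewrite !mulr_sumr; apply: eq_bigr => l' _; ring.
- rewrite /linpart /=; under eq_bigr do rewrite mulr_suml.
  rewrite exchange_big; apply: eq_bigr => a _ /=.
  by rewrite mulr_sumr; apply: eq_bigr => l _; rewrite mulrA.
Qed.

Lemma qmap_qpull m (R S : comNzRingType) (f : {rmorphism R -> S}) (B : 'M[R]_m) (d : quad m R) :
  qmap f (qpull B d) = qpull (map_mx f B) (qmap f d).
Proof.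
rewrite /qmap /qpull /=; congr Quad.
  by apply/funext => l; rewrite rmorph_sum; apply: eq_bigr => a _; rewrite rmorphM mxE.
apply/funext => l; apply/funext => l'; rewrite rmorph_sum; apply: eq_bigr => a _.
by rewrite rmorph_sum; apply: eq_bigr => a' _; rewrite !rmorphM !mxE.
Qed.

Section DiagonalCount.
Variables (K : numClosedFieldType) (m : nat) (T : 'I_m.+1 -> finType).
Variables (D : forall i, T i -> quad m K) (c : cone D).
Arguments D : clear implicits.
Variable b : nat -> nat.
Local Notation hidx := (hidx T b).
Local Notation eidx := (eidx m b).
Implicit Types (h : hidx -> K) (tau : eidx).
Local Notation equ := (equ D).

Variables (p : eidx) (pi : eidx -> eidx) (phi : 'I_m -> eidx) (q : 'I_m -> bool).
Variables (B Binv : 'M[K]_m).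
Hypothesis BK : forall v a, lin_of B (lin_of Binv v) a = v a.
Hypothesis BinvK : forall z a, lin_of Binv (lin_of B z) a = z a.
Hypothesis phiP : forall tau, tau = p \/ exists j, tau = phi j.
Hypothesis piP : forall tau, pi tau = p \/ pi (pi tau) = p.
Hypothesis q_tag : forall j, ~~ q j -> tag (pi (phi j)) = tag (phi j) /\
  (tag (phi j) = ord0 \/ tag (phi j) = ord_max).

Variables (fu : eidx -> K) (fz : eidx -> ('I_m -> K) -> K) (s : 'I_m -> 'I_m -> K).
Hypothesis target : forall tau, exists ht : T (tag tau) -> K,
  forall u v, qval (qlin ht (D (tag tau))) u v = fu tau * u + fz tau v.
Hypothesis fup : fu p != 0.
Hypothesis fupi : forall j, fu (pi (phi j)) != 0.
(** The common value of the square of the [l]-th coordinate at all points [spt]. *)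
Definition sqpt (l : 'I_m) : K := if q l then 4 ^+ l else 0.
Hypothesis elim_diag : forall j z,
  fu (pi (phi j)) * fz (phi j) (lin_of B z) - fu (phi j) * fz (pi (phi j)) (lin_of B z) =
  if q j then \sum_l s j l * (z l ^+ 2 - sqpt l) else z j.
Hypothesis s_inv : forall j, q j -> exists t : 'I_m -> K,
  forall l, q l -> \sum_(i | q i) t i * s i l = (l == j)%:R.

Definition diag_eq j : quad m K := if q j
  then Quad (- \sum_l s j l * sqpt l) (fun=> 0) 0 (fun a a' => s j a *+ (a == a')) else ev K j.

Lemma qval_diag_eq j z :
  qval (diag_eq j) 0 z = if q j then \sum_l s j l * (z l ^+ 2 - sqpt l) else z j.
Proof.
rewrite /diag_eq; case: ifP => _; last by rewrite qval_ev.
rewrite qvalE mul0r linpart0 // add0r addr0 -[quadpart _ _]/(quadpart (ediag 0 (s j)) z) quadpart_ediag -sumrB.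
by apply: eq_bigr => l _; rewrite mulrBr.
Qed.

Lemma qval_diag_eqX j : qval (qmap (@mpolyC m K) (diag_eq j)) 0 (fun l => 'X_l) =
  if q j then \sum_l (s j l)%:MP * ('X_l ^+ 2 - (sqpt l)%:MP) else 'X_j.
Proof.
rewrite /diag_eq; case: ifP => _.
  rewrite qvalE /= mulr0 linpart0 // add0r addr0 mpolyCN rmorph_sum /=.
  rewrite [quadpart _ _](_ : _ = quadpart (ediag 0 (fun l => (s j l)%:MP)) (fun l => 'X_l)).
    by rewrite quadpart_ediag -sumrB; apply: eq_bigr => l _; rewrite mulrBr mpolyCM expr2.
  by rewrite /quadpart; do 2!apply: eq_bigr => ? _; rewrite /= mpolyCMn.
rewrite [qmap _ _](_ : _ = ev _ j) ?qval_ev // /qmap /=; congr Quad; rewrite ?mpolyC0 //.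
apply/funext => l; case: eqP => _; by rewrite ?mpolyC1 ?mpolyC0.
Qed.

Variable X : set (forall i, pspace K (T i)).
Hypothesis chart_X : forall u v (x : forall i, pspace K (T i)),
  (forall i, val (x i) = <[[ffun t => qval (D i t) u v] : {ffun T i -> K^o}]>%VS) -> X x.
Hypothesis X_closure : forall x (F : {mpoly K[#|total_idx T|]}), X x ->
  (forall rho u v, peval F (fun k : total_idx T => chart D rho u v (tagged k)) = 0) ->
  vanishes_at F x.
Hypothesis at_infinity : forall h, qu (equ h p) != 0 -> (forall j, qu (equ h (pi (phi j))) != 0) ->
  forall y : (forall i, T i -> K), (forall i, exists t, y i t != 0) ->
  (forall f, PF f -> (forall rho u v, f (chart D rho u v) = 0) -> f y = 0) ->
  cW c ord0 y = 0 -> (forall tau, lam (cfun h (tau := tau)) y = 0) ->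
  exists2 v : 'I_m -> K, exists a, v a != 0 & forall j,
    quadpart (qcomb (equ h (pi (phi j))) (equ h (phi j))) v = 0 /\
    (~~ q j -> linpart (qcomb (equ h (pi (phi j))) (equ h (phi j))) v = 0).

(** In an end factor the quadratic part is the coefficient of [u] times a fixed form, namely 0 or
    [-|v|^2], so eliminating [u] between two of its equations removes the quadratic part as well. *)
Lemma q2_qcomb_end (R : comNzRingType) (f : {rmorphism K -> R}) i (h h' : T i -> R) :
  i = ord0 \/ i = ord_max -> forall a a',
  q2 (qcomb (qlin h (fun t => qmap f (D i t))) (qlin h' (fun t => qmap f (D i t)))) a a' = 0.
Proof.
case=> ei; subst i => a a' /=.
  have E (g : T ord0 -> R) : \sum_t g t * f (q2 (D ord0 t) a a') = 0.
    by rewrite big1 // => t _; rewrite (q2_0 c) rmorph0 mulr0.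
  by rewrite !E !mulr0 subrr.
have E (g : T ord_max -> R) : \sum_t g t * f (q2 (D ord_max t) a a') =
    - (\sum_t g t * f (qu (D ord_max t))) *+ (a == a').
  rewrite -sumrN -sumrMnl; apply: eq_bigr => t _.
  by rewrite (q2_max c) rmorphMn rmorphN mulrnAr mulrN.
by rewrite !E; case: (a == a'); rewrite ?mulr0n ?mulr0 ?subrr //; ring.
Qed.

Theorem diagonal_count : generically (fun h : hidx -> K =>
  (X `&` sect h #= `I_(2 ^ #|[set j | q j]%SET|))%card).
Proof.
pose ht tau := sval (cid (target tau)).
pose h0 (x : hidx) : K := ht (existT (fun i : 'I_m.+1 => 'I_(b i.+1)) (tag x) (tagged x).1) (tagged x).2.
have E0 tau u v : qval (equ h0 tau) u v = fu tau * u + fz tau v.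
  by case: tau => i j; rewrite -(svalP (cid (target (existT _ i j)))).
have U0 tau : qu (equ h0 tau) = fu tau.
  have := E0 tau 1 (fun=> 0); rewrite qvalE -addrA -addrA => H1.
  have := E0 tau 0 (fun=> 0); rewrite qvalE mulr0 add0r -addrA mulr0 add0r => H0.
  by move: H1; rewrite H0 !mulr1 => /addIr.
have Ez j z : qval (elim_eq D pi phi h0 j) 0 (lin_of B z) = qval (diag_eq j) 0 z.
  by rewrite (qval_qcomb _ _ 0) !U0 !E0 !mulr0 !add0r elim_diag qval_diag_eq.
have EX j : qval (qmap (@mpolyC m K) (elim_eq D pi phi h0 j)) 0
    (lin_of (map_mx (@mpolyC m K) B) (fun l => 'X_l)) =
    if q j then \sum_l (s j l)%:MP * ('X_l ^+ 2 - (sqpt l)%:MP) else 'X_j.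
  rewrite -qval_diag_eqX -qval_qpull -qmap_qpull; apply: qval_transfer => z.
  by rewrite qval_qpull Ez.
refine (@reduction K m T D c b p pi phi q B Binv h0 BK BinvK phiP piP _ _ _ _ _ X chart_X X_closure at_infinity).
- move=> j /q_tag[]; rewrite /eqp /cpol; move: (phi j) (pi (phi j)) => [i x] [i' x'] /= ei; subst i'.
  by move=> ie a a'; apply: (q2_qcomb_end (@mpolyC _ K)).
- by rewrite U0.
- by move=> j; rewrite U0.
- move=> j; case: (boolP (q j)) => [qj|qj]; last first.
    exists (fun i => (i == j)%:R) => [i|].
      by case: eqP => [->|_]; rewrite ?msize1 ?msize0 ?(negPf qj) //; case: (q i).
    rewrite (bigD1 j) //= eqxx mul1r EX (negPf qj) big1 ?addr0 ?subrr ?msize0 // => i /negPf ->.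
    by rewrite mul0r.
  have [t tE] := s_inv qj.
  pose w l := \sum_(i | q i) t i * s i l.
  (* [t] inverts [s] on the quadratic indices. The squares of the other unknowns that the
     combination brings in are cancelled by multiples of the equations [z_i = 0]. *)
  exists (fun i => if q i then (t i)%:MP else - ((w i)%:MP * 'X_i)) => [i|].
    case: ifP => qi; first by rewrite msizeC addn1; case: eqP.
    rewrite addn0 msizeN; apply: (@msizeM_leD _ _ 0 1); last by rewrite msizeX mdeg1.
    by rewrite msizeC; case: eqP.
  rewrite (_ : _ - _ = (\sum_l w l * sqpt l)%:MP); first by rewrite msizeC; case: eqP.
  rewrite (bigID q) /= rmorph_sum /=.
  have -> : \sum_(i | q i) (if q i then (t i)%:MP else - ((w i)%:MP * 'X_i)) *
      qval (qmap (@mpolyC m K) (elim_eq D pi phi h0 i)) 0 (lin_of (map_mx (@mpolyC m K) B) (fun l => 'X_l))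
      = \sum_l (w l)%:MP * ('X_l ^+ 2 - (sqpt l)%:MP).
    rewrite (eq_bigr (fun i => \sum_l (t i * s i l)%:MP * ('X_l ^+ 2 - (sqpt l)%:MP))).
      by rewrite exchange_big; apply: eq_bigr => l _; rewrite /w rmorph_sum /= mulr_suml.
    move=> i qi; rewrite EX qi mulr_sumr; apply: eq_bigr => l _.
    by rewrite mpolyCM mulrA.
  have -> : \sum_(i | ~~ q i) (if q i then (t i)%:MP else - ((w i)%:MP * 'X_i)) *
      qval (qmap (@mpolyC m K) (elim_eq D pi phi h0 i)) 0 (lin_of (map_mx (@mpolyC m K) B) (fun l => 'X_l))
      = - \sum_(l | ~~ q l) (w l)%:MP * 'X_l ^+ 2.
    rewrite -sumrN; apply: eq_bigr => i qi; rewrite EX (negPf qi) mulNr; congr (- _).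
    by rewrite expr2 mulrA.
  rewrite (eq_bigr _ (fun l _ => mulrBr _ _ _)) sumrB.
  have -> : \sum_l (w l)%:MP * 'X_l ^+ 2 = 'X_j ^+ 2 + \sum_(l | ~~ q l) (w l)%:MP * 'X_l ^+ 2 :> {mpoly K[m]}.
    rewrite (bigID q) /= (bigD1 j) //= {1}/w tE // eqxx mul1r [X in _ + X + _]big1 ?addr0 // => l /andP[ql lj].
    by rewrite /w tE // (negPf lj) mul0r.
  rewrite [RHS](eq_bigr (fun l => (w l)%:MP * (sqpt l)%:MP)) => [|l _]; last by rewrite mpolyCM.
  by ring.
- move=> S j; rewrite Ez qval_diag_eq /spt.
  have E l : (if q l then if l \in S then 2 ^+ l else - 2 ^+ l else 0) ^+ 2 = sqpt l :> K.
    rewrite /sqpt; case: ifP => _; last by rewrite expr0n.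
    case: ifP => _; rewrite ?sqrrN -exprM mulnC exprM (_ : 2 ^+ 2 = 4) //; ring.
  case: ifP => qj /=; last by rewrite qj.
  by rewrite big1 // => l _; rewrite E subrr mulr0.
Qed.
End DiagonalCount.

(** * The four cases *)

Lemma enum_compl1 (E : finType) (p : E) m : (0 < m)%N -> #|E| = m.+1 ->
  exists (phi : 'I_m -> E) (psi : E -> 'I_m), [/\ forall j, psi (phi j) = j,
    forall j, phi j != p & forall t, t = p \/ exists j, t = phi j].
Proof.
move=> m_gt0 Em; have cE : m = #|[set~ p]%SET| by rewrite cardsC1 Em.
pose phi j := enum_val (cast_ord cE j).
have phi_inj : injective phi by move=> j j' /enum_val_inj/cast_ord_inj.
exists phi, (fun t => odflt (Ordinal m_gt0) [pick j | phi j == t]); split=> [j|j|t].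
- by case: pickP => [j' /eqP/phi_inj //|/(_ j)]; rewrite eqxx.
- by have := enum_valP (cast_ord cE j); rewrite !inE.
- have [->|tp] := eqVneq t p; [by left | right].
  have tP : t \in [set~ p]%SET by rewrite !inE.
  by exists (cast_ord (esym cE) (enum_rank_in tP t)); rewrite /phi cast_ordKV enum_rankK_in.
Qed.

Lemma card_compl1 (E : finType) (p : E) m (phi : 'I_m -> E) (Q : pred E) : injective phi ->
  (forall j, phi j != p) -> (forall t, t = p \/ exists j, t = phi j) ->
  #|[set j | Q (phi j)]%SET| = #|[set t | (t != p) && Q t]%SET|.
Proof.
move=> phi_inj phip phiP; rewrite -(card_imset _ phi_inj); apply: eq_card => t.
rewrite [RHS]inE; apply/imsetP/idP => [[j] + ->|/andP[tp Qt]]; first by rewrite inE phip => ->.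
by have [tp'|[j tj]] := phiP t; [rewrite tp' eqxx in tp | exists j; rewrite // inE -tj].
Qed.

Lemma card_eidx m b (P : pred 'I_m.+1) :
  #|[set tau : eidx m b | P (tag tau)]%SET| = (\sum_(i | P i) b i.+1)%N.
Proof.
rewrite -sum1_card (eq_bigl (fun tau : eidx m b => P (tag tau) && true)); last first.
  by move=> tau; rewrite inE andbT.
rewrite -(sig_big_dep P (fun _ _ => true) (fun _ _ => 1%N)) /=.
by apply: eq_bigr => i _; rewrite sum1_card card_ord.
Qed.

Section Targets.
Variables (K : numClosedFieldType) (m : nat) (T : finType) (D : T -> quad m K).

Definition attained (F : K -> ('I_m -> K) -> K) :=
  exists h : T -> K, forall u v, qval (qlin h D) u v = F u v.

Lemma attained_ext F F' : (forall u v, F u v = F' u v) -> attained F -> attained F'.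
Proof. by move=> FF [h hE]; exists h => u v; rewrite hE. Qed.

Lemma attained_sum (I : finType) (g : I -> K) (F : I -> K -> ('I_m -> K) -> K) :
  (forall i, attained (F i)) -> attained (fun u v => \sum_i g i * F i u v).
Proof.
move=> SF; pose h i := sval (cid (SF i)); exists (fun t => \sum_i g i * h i t) => u v.
rewrite qval_qlin; under eq_bigr do rewrite mulr_suml; rewrite exchange_big; apply: eq_bigr => i _ /=.
by rewrite -(svalP (cid (SF i))) qval_qlin mulr_sumr; apply: eq_bigr => t _; rewrite mulrA.
Qed.

Lemma attainedD F F' : attained F -> attained F' -> attained (fun u v => F u v + F' u v).
Proof.
move=> aF aF'; apply: attained_ext (attained_sum (fun=> 1) (F := fun b : bool => if b then F else F') _).
  by move=> u v; rewrite big_bool /= !mul1r.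
by case.
Qed.

Lemma attainedZ g F : attained F -> attained (fun u v => g * F u v).
Proof. by move=> aF; apply: attained_ext (attained_sum (I := unit) (fun=> g) (fun=> aF)) => u v; rewrite big_const card_unit /= addr0. Qed.
End Targets.

(* For [m > 1] the rows of [Binv] are isotropic. *)
Lemma isotropic_coords (K : numClosedFieldType) m : (0 < m)%N -> exists B Binv : 'M[K]_m,
  [/\ forall v a, lin_of B (lin_of Binv v) a = v a, forall z a, lin_of Binv (lin_of B z) a = z a
    & (1 < m)%N -> forall l, \sum_a Binv l a ^+ 2 = 0].
Proof.
have linM (A B : 'M[K]_m) : A *m B = 1%:M -> forall v a, lin_of A (lin_of B v) a = v a.
  move=> AB v a; rewrite /lin_of.
  under eq_bigr do rewrite mulr_sumr; rewrite exchange_big /=.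
  rewrite (eq_bigr (fun j => (a == j)%:R * v j)) => [|j _].
    rewrite (bigD1 a) //= eqxx mul1r big1 ?addr0 // => j ja.
    by rewrite eq_sym (negPf ja) mul0r.
  have /matrixP/(_ a j) := AB; rewrite !mxE => <-; rewrite mulr_suml.
  by apply: eq_bigr => l _; rewrite mulrA.
case: m linM => // -[|m] linM _.
  by exists 1%:M, 1%:M; split=> //; apply: linM; rewrite mulmx1.
(* The rows are x_0 - i x_1 and, for l > 0, x_0 + i x_l, of norm 1 + i^2 = 0. The first two
   determine x_0, and the rows l > 0 then give the other coordinates. *)
pose sg (l : 'I_m.+2) : K := if l == ord0 then - 'i else 'i.
pose pt (l : 'I_m.+2) : 'I_m.+2 := if l == ord0 then 1 else l.
pose L : 'M[K]_m.+2 := \matrix_(l, a) ((a == ord0)%:R + sg l * (a == pt l)%:R).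
have pt0 l : pt l != ord0 by rewrite /pt; case: ifPn.
have LE (v : 'I_m.+2 -> K) l : \sum_a v a * L l a = v ord0 + v (pt l) * sg l.
  under eq_bigr do rewrite mxE mulrDr.
  rewrite big_split /= (bigD1 ord0) //= ?eqxx mulr1 big1 ?addr0 => [|a /negPf ->]; last by rewrite mulr0.
  rewrite (bigD1 (pt l)) //= eqxx mulr1 big1 ?addr0 => [|a /negPf ->]; last by rewrite !mulr0.
  by [].
have Lu : L \in unitmx.
  rewrite -unitmx_tr -row_free_unit; apply: inj_row_free => v /rowP v0.
  have H l : v 0 ord0 + v 0 (pt l) * sg l = 0.
    rewrite -(LE (v 0)); have := v0 l; rewrite [LHS]mxE [RHS]mxE => E; rewrite -[RHS]E.
    by apply: eq_bigr => a _; rewrite [L^T a l]mxE.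
  have i0 : 'i != 0 :> K by rewrite neq0Ci.
  have z0 : v 0 ord0 = 0.
    have := H ord0; have := H 1; rewrite /pt /sg /= => E1 E2.
    have : v 0 ord0 *+ 2 = 0 by rewrite -[RHS]addr0 -{1}E1 -E2; ring.
    by move/eqP; rewrite mulrn_eq0 => /eqP.
  apply/rowP => a; rewrite mxE; have [->//|a0] := eqVneq a ord0.
  have := H a; rewrite z0 add0r /pt /sg (negPf a0) => /eqP.
  by rewrite mulf_eq0 (negPf i0) orbF => /eqP.
exists (invmx L), L; split; [by apply: linM; rewrite mulVmx | by apply: linM; rewrite mulmxV |].
move=> _ l; rewrite (eq_bigr (fun a => L l a * L l a)) ?LE => [|a _]; last by rewrite expr2.
rewrite !mxE !eqxx [ord0 == _]eq_sym (negPf (pt0 l)) mulr1 mulr0 addr0 add0r -expr2.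
by rewrite /sg; case: ifP => _; rewrite ?sqrrN sqrCi subrr.
Qed.

Section Cases.
Variables (K : numClosedFieldType) (m : nat) (T : 'I_m.+1 -> finType).
Variables (D : forall i, T i -> quad m K) (c : cone D).
Arguments D : clear implicits.
Hypothesis m_gt0 : (0 < m)%N.
Variable b : nat -> nat.
Local Notation hidx := (hidx T b).
Local Notation eidx := (eidx m b).
Implicit Types (h : hidx -> K) (tau : eidx).
Local Notation equ := (equ D).
Hypothesis card_e : #|eidx| = m.+1.

Definition mid tau := (0 < tag tau < m)%N.

Lemma nmid tau : ~~ mid tau -> tag tau = ord0 \/ tag tau = ord_max.
Proof.
rewrite /mid; case: tau => i j /= im; have [i0|i0] := posnP i; [left | right]; apply: val_inj => //=.
by move: im; rewrite i0 /= -leqNgt => im; apply/eqP; rewrite eqn_leq im -ltnS ltn_ord.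
Qed.

Lemma attained1 i g : attained (D i) (fun _ _ => g).
Proof.
by apply: attained_ext (attainedZ g (ex_intro _ (h1 c i) (h1E c i))) => u v; rewrite mulr1.
Qed.

Lemma attained_v i a : attained (D i) (fun _ v => v a).
Proof. by exists (hv c i a) => u v; apply: hvE. Qed.

Lemma attained_diff (i : 'I_m.+1) a a' : (0 < i < m)%N ->
  attained (D i) (fun _ v => v a * v a - v a' * v a').
Proof. by move=> im; exists (hd c i a a') => u v; apply: hdE. Qed.

(** The square of an isotropic form is traceless: each [v_a^2] may be replaced by [v_a^2 - v_o^2],
    because the coefficients of the added [v_o^2] sum to zero. *)
Lemma attained_isotropic (i : 'I_m.+1) (Binv : 'M[K]_m) l : (0 < i < m)%N ->
  \sum_a Binv l a ^+ 2 = 0 -> attained (D i) (fun _ v => lin_of Binv v l ^+ 2).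
Proof.
move=> im L0; pose o := Ordinal m_gt0.
pose F (x : 'I_m * 'I_m) (u : K) (v : 'I_m -> K) := if x.1 == x.2
  then v x.1 * v x.1 - v o * v o else v x.1 * v x.2.
have aF x : attained (D i) (F x).
  rewrite /F; case: eqP => [_|/eqP x12]; first exact: attained_diff.
  by exists (hk c i x.1 x.2) => u v; apply: hkE.
apply: attained_ext (attained_sum (fun x => Binv l x.1 * Binv l x.2) aF) => u v.
rewrite -(pair_bigA _ (fun a a' => Binv l a * Binv l a' * F (a, a') u v)) /=.
have -> : \sum_a \sum_a' Binv l a * Binv l a' * F (a, a') u v =
    \sum_a ((\sum_a' (Binv l a * v a) * (Binv l a' * v a')) - Binv l a ^+ 2 * (v o * v o)).
  apply: eq_bigr => a _; rewrite (bigD1 a) //= [in RHS](bigD1 a) //= /F /= eqxx addrAC; congr (_ + _).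
    by ring.
  by apply: eq_bigr => a'; rewrite eq_sym => /negPf -> ; ring.
rewrite sumrB -mulr_suml L0 mul0r subr0 /lin_of expr2 mulr_suml; apply: eq_bigr => a _.
by rewrite mulr_sumr.
Qed.

Variable X : set (forall i, pspace K (T i)).
Hypothesis chart_X : forall u v (x : forall i, pspace K (T i)),
  (forall i, val (x i) = <[[ffun t => qval (D i t) u v] : {ffun T i -> K^o}]>%VS) -> X x.
Hypothesis X_closure : forall x (F : {mpoly K[#|total_idx T|]}), X x ->
  (forall rho u v, peval F (fun k : total_idx T => chart D rho u v (tagged k)) = 0) ->
  vanishes_at F x.

Definition count_is N := generically (fun h : hidx -> K => (X `&` sect h #= `I_N)%card).

Lemma quadpart_ord0 (h : T ord0 -> K) v : quadpart (qlin h (D ord0)) v = 0.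
Proof. by apply: quadpart0 => a a' /=; rewrite big1 // => t _; rewrite (q2_0 c) mulr0. Qed.

Lemma quadpart_ordmax (h : T ord_max -> K) v :
  quadpart (qlin h (D ord_max)) v = - (qu (qlin h (D ord_max)) * \sum_a v a * v a).
Proof.
pose e := ediag 0 (fun=> - qu (qlin h (D ord_max))) : quad m K.
transitivity (quadpart e v); last by rewrite quadpart_ediag -mulr_sumr mulNr.
rewrite /quadpart; do 2!apply: eq_bigr => ? _; rewrite /= -sumrN -sumrMnl.
do 2!congr (_ * _); apply: eq_bigr => t _.
by rewrite (q2_max c) mulrnAr mulrN.
Qed.

(** Apart from the pivot, the special equations are [z_l^2 - 4^l] in middle factors and [z_l] in end
    factors. They do not involve [u], so elimination by the pivot leaves them unchanged. *)
Lemma count_one_pivot (p : eidx) (fp : ('I_m -> K) -> K) :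
  attained (D (tag p)) (fun u v => u + fp v) ->
  (forall tau, ~~ mid tau -> tag tau = tag p) ->
  (forall h, qu (equ h p) != 0 ->
    forall y : (forall i, T i -> K), (forall i, exists t, y i t != 0) ->
    (forall f, PF f -> (forall rho u v, f (chart D rho u v) = 0) -> f y = 0) ->
    cW c ord0 y = 0 -> (forall tau, lam (cfun h (tau := tau)) y = 0) ->
    exists2 v : 'I_m -> K, exists a, v a != 0 & forall tau,
      quadpart (qcomb (equ h p) (equ h tau)) v = 0 /\
      (~~ mid tau -> linpart (qcomb (equ h p) (equ h tau)) v = 0)) ->
  count_is (2 ^ #|[set tau | (tau != p) && mid tau]%SET|).
Proof.
move=> ap tagp infty; have [phi [psi [phiK phip phiP]]] := enum_compl1 p m_gt0 card_e.
have [B [Binv [BK BinvK iso]]] := isotropic_coords K m_gt0.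
rewrite -(card_compl1 _ (can_inj phiK) phip phiP).
pose q j := mid (phi j).
pose fu tau : K := (tau == p)%:R.
pose fz tau v := if tau == p then fp v else
  let z := lin_of Binv v (psi tau) in if mid tau then z ^+ 2 - 4 ^+ psi tau else z.
apply: (@diagonal_count _ _ _ _ c b p (fun=> p) phi q B Binv BK BinvK phiP _ _ fu fz
  (fun i l => (i == l)%:R)) => //.
- by left.
- by move=> j /[dup] /tagp <- /nmid.
- move=> tau; rewrite /fu /fz; have [->|tp] := eqVneq tau p.
    by apply: attained_ext ap => u v; rewrite mul1r.
  case: (boolP (mid tau)) => [tm|_] /=.
    apply: attained_ext (attainedD (attained_isotropic tm (iso _ (psi tau))) (attained1 _ (- 4 ^+ psi tau))).
      by move=> u v; rewrite mul0r add0r.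
    by move: tm; rewrite /mid; lia.
  apply: attained_ext (attained_sum (fun a => Binv (psi tau) a) (attained_v (tag tau))) => u v.
  by rewrite mul0r add0r.
- by rewrite /fu eqxx oner_eq0.
- by move=> _; rewrite /fu eqxx oner_eq0.
- move=> j z; rewrite /fu /fz eqxx (negPf (phip j)) mul1r mul0r subr0 /= phiK BinvK.
  rewrite -/(q j); case: ifP => // qj; rewrite (bigD1 j) //= eqxx mul1r big1 ?addr0 /sqpt ?qj //.
  by move=> l lj; rewrite eq_sym (negPf lj) mul0r.
- move=> j qj; exists (fun i => (i == j)%:R) => l ql; rewrite (bigD1 j) //= eqxx mul1r big1 ?addr0.
    by rewrite eq_sym.
  by move=> i /andP[_ /negPf ->]; rewrite mul0r.
move=> h p0 _ y y_nz y_cl W0 y_eq; have [v v0 vP] := infty h p0 y y_nz y_cl W0 y_eq.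
by exists v.
Qed.

(** The pivot has to be a middle equation, which costs one quadratic equation and explains the
    exponent lowered by one. *)
Lemma count_mid (p : eidx) : (forall tau, mid tau) ->
  count_is (2 ^ #|[set tau | (tau != p) && mid tau]%SET|).
Proof.
move=> allmid; apply: (@count_one_pivot p (fun v => - \sum_(a in A c (tag p)) v a * v a)) => [|tau|].
- exists (hA c (tag p)); exact: (hAE c (allmid p)).
- by rewrite allmid.
move=> h p0 y y_nz y_cl W0 y_eq.
have [S [z [Sz E]]] := boundary_mid m_gt0 y_nz y_cl W0 (allmid p).
have {}E tau : qu (equ h tau) * S + quadpart (equ h tau) z = 0 by apply: (E); [exact: allmid | exact: y_eq].
have Q tau : quadpart (equ h tau) z = - (qu (equ h tau) * S).
  by apply/eqP; rewrite -addr_eq0 addrC E.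
exists z => [|tau]; last by rewrite allmid quadpart_qcomb !Q; split=> //; ring.
(* If [z] were zero, [S] would not be, contradicting the equation of the pivot, whose coefficient of
   [u] is nonzero. *)
apply/existsP; case/orP: Sz => // S0; apply: contraNT S0 => /existsPn z0.
have : quadpart (equ h p) z = 0.
  by rewrite /quadpart big1 // => a _; rewrite big1 // => a' _; have /negPn/eqP -> := z0 a; rewrite mulr0 mul0r.
by rewrite Q => /eqP; rewrite oppr_eq0 mulf_eq0 (negPf p0).
Qed.

Lemma count_last (p : eidx) : tag p = ord_max -> (forall tau, ~~ mid tau -> tag tau = ord_max) ->
  count_is (2 ^ #|[set tau | (tau != p) && mid tau]%SET|).
Proof.
case: p => ip jp /= pm; subst ip; set p : eidx := existT (fun i : 'I_m.+1 => 'I_(b i.+1)) _ jp => tagp.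
apply: (@count_one_pivot p (fun v => - \sum_a v a * v a)) => [|tau /tagp //|].
  by exists (ht c) => u v; apply: htE.
move=> h p0 y y_nz y_cl W0 y_eq.
have [z z0 [Qm Lm]] := boundary_last m_gt0 y_nz y_cl W0 (y_eq p) p0.
have Q tau : quadpart (equ h tau) z = - (qu (equ h tau) * \sum_a z a * z a).
  case: (boolP (mid tau)) => [tm|/tagp]; last first.
    by case: tau => i j /= ei; subst i; apply: quadpart_ordmax.
  by apply/eqP; rewrite -addr_eq0 addrC; apply/eqP/Qm => //; apply: y_eq.
exists z => // tau; rewrite quadpart_qcomb !Q linpart_qcomb; split=> [|/tagp]; first by ring.
case: tau => i j /= ei; subst i; apply/eqP; rewrite subr_eq0; apply/eqP/Lm.
exact: (y_eq (existT _ ord_max j)).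
Qed.

Lemma count_first (p : eidx) : tag p = ord0 -> (forall tau, ~~ mid tau -> tag tau = ord0) ->
  count_is (2 ^ #|[set tau | (tau != p) && mid tau]%SET|).
Proof.
case: p => ip jp /= pm; subst ip; set p : eidx := existT (fun i : 'I_m.+1 => 'I_(b i.+1)) _ jp => tagp.
apply: (@count_one_pivot p (fun=> 0)) => [|tau /tagp //|].
  by exists (hu c) => u v; rewrite addr0; apply: huE.
move=> h p0 y y_nz y_cl W0 y_eq.
have [z z0 [Qm Lm _]] := boundary_first m_gt0 y_nz y_cl W0 (y_eq p) p0.
have Q tau : quadpart (equ h tau) z = 0.
  case: (boolP (mid tau)) => [tm|/tagp]; first by apply: Qm => //; apply: y_eq.
  by case: tau => i j /= ei; subst i; apply: quadpart_ord0.
exists z => // tau; rewrite quadpart_qcomb !Q linpart_qcomb; split=> [|/tagp]; first by ring.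
case: tau => i j /= ei; subst i; apply/eqP; rewrite subr_eq0; apply/eqP/Lm.
exact: (y_eq (existT _ ord0 j)).
Qed.

(** Reduced by [p], the equation of [p'] has the leading form [-|v|^2], so the unknowns are the
    coordinates [v] themselves. The other equations of the last factor are reduced by [p'] and
    become linear. *)
Lemma count_both (p p' : eidx) : tag p = ord0 -> tag p' = ord_max ->
  count_is (2 ^ #|[set tau | (tau != p) && (mid tau || (tau == p'))]%SET|).
Proof.
case: p => ip jp /= ep; subst ip; set p : eidx := existT (fun i : 'I_m.+1 => 'I_(b i.+1)) _ jp.
case: p' => ip' jp' /= ep'; subst ip'; set p' : eidx := existT (fun i : 'I_m.+1 => 'I_(b i.+1)) _ jp'.
have pm : ~~ mid p by [].
have p'm : ~~ mid p' by rewrite /mid /= ltnn andbF.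
have [phi [psi [phiK phip phiP]]] := enum_compl1 p m_gt0 card_e.
rewrite -(card_compl1 _ (can_inj phiK) phip phiP).
pose q j := mid (phi j) || (phi j == p').
pose pi tau := if (tag tau == ord_max) && (tau != p') then p' else p.
have pip' : pi p' = p by rewrite /pi eqxx andbF.
have pimid tau : mid tau -> pi tau = p.
  by rewrite /pi; case: eqP => //= E; rewrite /mid E /= ltnn andbF.
(* In a middle factor, adding the differences [v_l^2 - v_a^2] over [A] to
   [-(u - \sum_(a in A) v_a^2)] gives [-u] plus [#|A|] times [v_l^2]: hence the -1 and the factor
   [tag tau]. The constant in the equation of [p'] makes it vanish at all special points once [u] is
   eliminated. *)
pose fu tau : K := if mid tau then -1 else ((tau == p) || (tau == p'))%:R.
pose fz tau (v : 'I_m -> K) := if tau == p then 0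
  else if tau == p' then - \sum_l v l * v l + \sum_l sqpt K q l
  else let l := psi tau in if mid tau then (tag tau)%:R * (v l * v l - sqpt K q l) else v l.
have fup : fu p = 1 by rewrite /fu (negPf pm) eqxx.
have fup' : fu p' = 1 by rewrite /fu (negPf p'm) eqxx orbT.
have l1 (v : 'I_m -> K) a : lin_of 1%:M v a = v a.
  rewrite /lin_of (bigD1 a) //= mxE eqxx mul1r big1 ?addr0 // => l la.
  by rewrite mxE eq_sym (negPf la) mul0r.
apply: (@diagonal_count _ _ _ _ c b p pi phi q 1%:M 1%:M _ _ phiP _ _ fu fz
  (fun i l => if phi i == p' then -1 else (tag (phi i))%:R * (i == l)%:R)) => //.
- by move=> v a; rewrite !l1.
- by move=> v a; rewrite !l1.
- by move=> tau; rewrite {1 3}/pi; case: ifP => _; [right; rewrite pip' | left].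
- move=> j; rewrite /q negb_or => /andP[/nmid tm tp'].
  split=> //; rewrite /pi tp' andbT; case: eqP => [->//|tx].
  by case: tm => [->//|/tx].
- move=> tau; rewrite /fu /fz; have [->|tp] := eqVneq tau p.
    by rewrite (negPf pm); exists (hu c) => u v; rewrite mul1r addr0; apply: huE.
  have [->|tp'] := eqVneq tau p'.
    rewrite (negPf p'm); apply: attained_ext (attainedD (ex_intro _ (ht c) (htE c)) (attained1 ord_max (\sum_l sqpt K q l))) => u v.
    by rewrite mul1r addrA.
  case: (boolP (mid tau)) => [tm|_] /=; last first.
    by apply: attained_ext (attained_v (tag tau) (psi tau)) => u v; rewrite mul0r add0r.
  pose l := psi tau.
  have aA := attainedZ (-1) (ex_intro _ (hA c (tag tau)) (hAE c tm)).
  have aS : attained (D (tag tau)) (fun u v => \sum_a ((a \in A c (tag tau))%:R * (v l * v l - v a * v a))).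
    by apply: attained_sum => a; apply: attained_diff.
  apply: attained_ext (attainedD (attainedD aA aS) (attained1 _ (- (tag tau)%:R * sqpt K q l))) => u v.
  have -> : \sum_a ((a \in A c (tag tau))%:R * (v l * v l - v a * v a)) =
      (tag tau)%:R * (v l * v l) - \sum_(a in A c (tag tau)) v a * v a.
    under eq_bigr do rewrite mulrBr; rewrite sumrB -mulr_suml -natr_sum -big_mkcond sum1_card (cardA c tm).
    by congr (_ - _); rewrite [RHS]big_mkcond; apply: eq_bigr => a _; case: ifP; rewrite ?mul1r ?mul0r.
  by rewrite -/l; ring.
- by rewrite fup oner_eq0.
- by move=> j; rewrite /pi; case: ifP => _; rewrite ?fup ?fup' oner_eq0.
- move=> j z; have -> : lin_of 1%:M z = z by apply/funext => a; rewrite l1.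
  rewrite {1}/fz (negPf (phip j)) phiK /q; case: eqVneq => [E|E] /=.
    rewrite E pip' fup fup' {1}/fz eqxx (negPf p'm) /= !mul1r subr0.
    rewrite -sumrN -big_split; apply: eq_bigr => l _; rewrite /= /sqpt; ring.
  rewrite orbF; case: (boolP (mid (phi j))) => jm.
    rewrite (pimid _ jm) fup /fz eqxx mulr0 subr0 mul1r (bigD1 j) //= eqxx mulr1 big1 ?addr0 // => l lj.
    by rewrite eq_sym (negPf lj) mulr0 mul0r.
  rewrite {1}/pi; case: ifP => _; rewrite ?fup ?fup' mul1r /fu (negPf jm) (negPf (phip j)) (negPf E) /=.
    by rewrite mul0r subr0.
  by rewrite mul0r subr0.
(* On the quadratic indices [s] is diagonal with entries [d i], except for the row of [p'], which is
   constantly -1; its entries off the diagonal are cleared by the other rows. *)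
- move=> j qj; pose d i : K := (tag (phi i))%:R.
  have dd i : q i -> phi i != p' -> (d i)^-1 * d i = 1.
    rewrite /q => qi ip'; move: qi; rewrite (negPf ip') orbF => /andP[i0 _].
    by rewrite mulVf // /d pnatr_eq0 -lt0n.
  have [E|E] := eqVneq (phi j) p'.
    have jE i : (phi i == p') = (i == j) by rewrite -E (inj_eq (can_inj phiK)).
    exists (fun i => if i == j then -1 else - (d i)^-1) => l ql.
    rewrite (bigD1 j) //= eqxx E eqxx mulrNN mulr1.
    rewrite (eq_bigr (fun i => - (i == l)%:R)) => [|i /andP[qi ij]]; last first.
      by rewrite jE (negPf ij) mulrA mulNr dd ?mulN1r // jE.
    rewrite sumrN; have [->|lj] := eqVneq l j.
      by rewrite big1 ?subr0 // => i /andP[_ /negPf ->].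
    by rewrite (bigD1 l) /= ?ql // eqxx big1 ?addr0 ?subrr // => i /andP[_ /negPf ->].
  exists (fun i => (i == j)%:R * (d j)^-1) => l ql.
  rewrite (bigD1 j) //= eqxx mul1r (negPf E) mulrA dd // mul1r big1 ?addr0 1?eq_sym // => i /andP[_ /negPf ->].
  by rewrite !mul0r.
move=> h p0 pi0 y y_nz y_cl W0 y_eq.
have [z z0 [Qm L0 Lm]] := boundary_first m_gt0 y_nz y_cl W0 (y_eq p) p0.
have Q0 tau : tag tau = ord0 -> quadpart (equ h tau) z = 0.
  by case: tau => i j /= ei; subst i; apply: quadpart_ord0.
have Qx tau : tag tau = ord_max ->
    quadpart (equ h tau) z = - (qu (equ h tau) * \sum_a z a * z a).
  by case: tau => i j /= ei; subst i; apply: quadpart_ordmax.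
have Qp' : quadpart (equ h p') z = 0.
  rewrite Qx //; have [->|u0] := eqVneq (qu (equ h p')) 0; first by rewrite mul0r oppr0.
  by have [-> _] := Lm _ (y_eq p') u0; rewrite mulr0 oppr0.
exists z => // j; rewrite quadpart_qcomb linpart_qcomb; move: (pi0 j).
case: (boolP (mid (phi j))) => [jm|jm].
  rewrite pimid // [quadpart (equ h p) z]Q0 // (Qm _ _ jm (y_eq (phi j))) !mulr0 subrr => _; split=> //.
  by rewrite /q jm.
have [E|E] := eqVneq (phi j) p'.
  by rewrite /q E eqxx orbT pip' Qp' [quadpart (equ h p) z]Q0 // !mulr0 subrr.
have [j0|jx] := nmid jm.
  have -> : pi (phi j) = p by rewrite /pi j0 -val_eqE /= (ltn_eqF m_gt0).
  move=> _; rewrite !Q0 // !mulr0 subrr; split=> // _.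
  move: (phi j) j0 => [i x] /= ei; subst i; apply/eqP; rewrite subr_eq0; apply/eqP/L0.
  exact: (y_eq (existT (fun i : 'I_m.+1 => 'I_(b i.+1)) ord0 x)).
have -> : pi (phi j) = p' by rewrite /pi jx eqxx E.
move=> u0; have [S0 {}Lm] := Lm _ (y_eq p') u0.
rewrite Qp' Qx // S0 !(mulr0, oppr0) addr0; split=> // _.
move: (phi j) jx => [i x] /= ei; subst i; apply/eqP; rewrite subr_eq0; apply/eqP/Lm.
exact: (y_eq (existT (fun i : 'I_m.+1 => 'I_(b i.+1)) ord_max x)).
Qed.
End Cases.

(** * From counts of equations to the formula *)

Section CharNumbers.
Variables (K : numClosedFieldType) (k : nat).
Local Notation m := k.+1.
Variables (e : k.+3.-tuple (CW K k.+2)) (a : nat -> nat).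
Hypothesis he : basis_of fullv e.
Hypothesis ha : (\sum_(1 <= i < k.+3) a i = k.+2)%N.
Local Notation s := (\sum_(2 <= i < k.+2) a i)%N.
Local Notation E := (eidx m a).
Implicit Types tau p : E.

Lemma CW_counts : exists (T : 'I_m.+1 -> finType) (D : forall i, T i -> quad m K) (c : cone D) X,
  [/\ (forall u v (x : forall i, pspace K (T i)),
  (forall i, val (x i) = <[[ffun t => qval (D i t) u v] : {ffun T i -> K^o}]>%VS) -> X x),
   (forall x (F : {mpoly K[#|total_idx T|]}), X x ->
  (forall rho u v, peval F (fun k : total_idx T => chart D rho u v (tagged k)) = 0) ->
  vanishes_at F x) & forall N, count_is a X N -> is_char_number (form_space e) a N].
Proof.
have [G [H [GH HG LP]]] := CW_form_space he.
have [D [DE [c]]] := minors_cone HG (ltn0Sn k).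
exists _, D, c, (X_ (form_space e)); split.
- exact: (chart_mem GH LP DE).
- exact: (chart_closure LP DE).
- by [].
Qed.

(** The number of equations equals the number of unknowns, [u] and the [m] coordinates of [v]. *)
Lemma card_E : #|E| = m.+1.
Proof.
rewrite -cardsT -[RHS]ha big_add1 big_mkord -(@card_eidx m a xpredT).
by apply: eq_card => tau; rewrite !inE.
Qed.

(** The tag [i] carries the exponent [a i.+1], so the tags strictly between 0 and [m] correspond to
    the exponents [a 2, ..., a k.+1]. *)
Lemma card_mid : #|[set tau : E | mid tau]%SET| = s.
Proof.
rewrite (@card_eidx m a (fun i => 0 < i < m)%N) 2!big_add1 /=.
rewrite -(big_mkord (fun i => 0 < i < m)%N (fun i => a i.+1)) big_mkcond /=.
rewrite big_nat_recl //= add0n big_nat_recr //= ltnn addn0 [RHS]big_nat [LHS]big_nat.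
by apply: eq_bigr => i /= ik; rewrite ltnS ik.
Qed.

Lemma no_eq tau i : a i = 0%N -> (tag tau).+1 != i.
Proof. by case: tau => j [x xa] ai; rewrite /= neq_ltn; case: ltngtP => // ji; rewrite ji ai in xa. Qed.

Lemma CW_char_number : is_char_number (form_space e) a
     (if (a 1%N == 0%N) && (a k.+2 == 0%N) then (2 ^ (s - 1))%N
     else if (a 1%N == 0%N) || (a k.+2 == 0%N) then (2 ^ s)%N
     else (2 ^ (s + 1))%N).
Proof.
have [T [D [c [X [cX Xc XN]]]]] := CW_counts.
have pick (i : 'I_m.+1) : a i.+1 != 0%N -> exists p, tag p = i.
  by rewrite -lt0n => ai; exists (existT (fun i : 'I_m.+1 => 'I_(a i.+1)) i (Ordinal ai)).
have not_mid (tau : E) i : tag tau = i -> i = ord0 \/ i = ord_max -> ~~ mid tau.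
  by rewrite /mid => -> [] ->; rewrite /= ?ltnn ?andbF.
have nfst (tau : E) : a 1%N = 0%N -> tag tau != ord0.
  by move=> /no_eq - /(_ tau); apply: contraNneq => ->.
have nlst (tau : E) : a k.+2 = 0%N -> tag tau != ord_max.
  by move=> /no_eq - /(_ tau); apply: contraNneq => ->.
have midN p : ~~ mid p -> #|[set tau : E | (tau != p) && mid tau]%SET| = s.
  move=> pm; rewrite -card_mid; apply: eq_card => tau; rewrite !inE.
  by case: eqP => // ->; rewrite (negPf pm).
apply: XN; case: (eqVneq (a 1%N) 0%N) => a1; case: (eqVneq (a k.+2) 0%N) => an /=.
- have allmid (tau : E) : mid tau.
    by apply: contraT => /nmid[] /eqP; rewrite (negPf (nfst _ a1), negPf (nlst _ an)).
  have [p _] : exists p : E, true by have /card_gt0P[p] : (0 < #|E|)%N; [rewrite card_E | exists p].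
  rewrite (_ : (s - 1)%N = #|[set tau : E | (tau != p) && mid tau]%SET|).
    exact: (count_mid c _ card_E cX Xc).
  rewrite -card_mid (cardsD1 p) inE allmid add1n subn1 /=.
  by apply: eq_card => tau; rewrite !inE.
- have [p pm] := pick ord_max an.
  rewrite -(midN p); last by apply: not_mid pm _; right.
  apply: (count_last c _ card_E cX Xc) => // tau /nmid[] // /eqP.
  by rewrite (negPf (nfst _ a1)).
- have [p pm] := pick ord0 a1.
  rewrite -(midN p); last by apply: not_mid pm _; left.
  apply: (count_first c _ card_E cX Xc) => // tau /nmid[] // /eqP.
  by rewrite (negPf (nlst _ an)).
have [p p0] := pick ord0 a1; have [p' pm] := pick ord_max an.
have p'm : ~~ mid p' by apply: not_mid pm _; right.
rewrite (_ : (s + 1)%N = #|[set tau : E | (tau != p) && (mid tau || (tau == p'))]%SET|).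
  exact: (count_both c _ card_E cX Xc).
rewrite (_ : [set tau : E | _]%SET = p' |: [set tau : E | mid tau]%SET)%SET.
  by rewrite cardsU1 inE p'm card_mid addn1.
apply/setP => tau; rewrite !inE orbC; have [->|//] := eqVneq tau p.
rewrite (negPf (not_mid _ _ p0 _)); last by left.
by rewrite orbF; apply/esym/eqP => pp'; move: pm; rewrite -pp' p0 => /(congr1 val).
Qed.
End CharNumbers.

Theorem proposition4p16 (R : realType) (n : nat) (hn : (2 <= n)%N)
    (e : n.+1.-tuple (CW R[i] n)) (he : basis_of fullv e)
    (a : nat -> nat) (ha : (\sum_(1 <= i < n.+1) a i = n)%N) :
  is_char_number (form_space e) a
    (let s := (\sum_(2 <= i < n) a i)%N in
     if (a 1%N == 0%N) && (a n == 0%N) then (2 ^ (s - 1))%N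
     else if (a 1%N == 0%N) || (a n == 0%N) then (2 ^ s)%N
     else (2 ^ (s + 1))%N).
Proof. by case: n hn e he ha => [|[|k]] // _ e he ha; apply: CW_char_number. Qed.
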